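(* Let $\alpha\in(0,2)$ and let $\{X_t\}_{t\in\mathbb Z^d}$ be a stationary symmetric $\alpha$-stable random field generated by a conservative nonsingular $\mathbb Z^d$-action $\{\phi_t\}_{t\in\mathbb Z^d}$ with cocycle $\{c_t\}$. Let $K,F,p,l,H,\oplus,U,V,\Delta$ be the objects attached to the action as described in the context. Assume $1\le p<d$, that $\{\phi_t\}_{t\in F}$ is dissipative, and that $c_v\equiv1$ for all $v\in K$. Let $(W,\nu)$ and $h\in L^\alpha(W\times H,\nu\otimes\zeta_H)$ be as in the mixed moving average representation of $\{X_s\}_{s\in H}$ described in the context, with the normalization stated there. Let $\gamma_n>0$ satisfy $n^{p/\alpha}/\gamma_n\to0$. Then for every $y>0$, $$\lim_{n\to\infty}\frac{\gamma_n^\alpha}{n^p}\mathbb P\Big(\max_{\|t\|_\infty\le n}X_t>\gamma_ny\Big)= l\,\mathrm{Leb}(\Delta)\,y^{-\alpha}\int_W\Big(\big(\sup_{u\in H}h^+(v,u)\big)^\alpha+\big(\sup_{u\in H}h^-(v,u)\big)^\alpha\Big)\nu(dv).$$ In particular, for all $a>0$ and $\lambda>0$, with $\tau^a_n:=\inf\{\|t\|_\infty:X_t>a\gamma_n\}$, $$\lim_{n\to\infty}\frac{\gamma_n^\alpha}{n^p}\mathbb P(\tau^a_n\le\lambda n)=\lambda^pa^{-\alpha}\,l\,\mathrm{Leb}(\Delta)\int_W\Big(\big(\sup_{u\in H}h^+(v,u)\big)^\alpha+\big(\sup_{u\in H}h^-(v,u)\big)^\alpha\Big)\nu(dv).$$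
   Context: General notation: $x^+=\max(x,0)$, $x^-=\max(-x,0)$; $\|\cdot\|_\infty$ is the max norm. $\nu_\alpha$ is the symmetric measure on $[-\infty,\infty]\setminus\{0\}$ with $\nu_\alpha(x,\infty]=\nu_\alpha[-\infty,-x)=x^{-\alpha}$, $x>0$. Group actions: a nonsingular action $\{\phi_t\}_{t\in G}$ of a countable abelian group $G$ on a $\sigma$-finite standard Borel space $(S,\mathcal S,\mu)$ is a family of measurable maps with $\phi_0=\mathrm{id}$, $\phi_{t_1+t_2}=\phi_{t_1}\circ\phi_{t_2}$ and $\mu\circ\phi_t^{-1}$ equivalent to $\mu$. A measurable $A\subseteq S$ is wandering if the sets $\phi_t(A)$, $t\in G$, are pairwise disjoint. The action is dissipative if $S=\bigcup_{t}\phi_t(W^* )$ for some wandering set $W^*$, and conservative if there is no wandering set of positive $\mu$-measure. A cocycle is a family of measurable $\pm1$-valued maps $c_t$ with $c_{t_1+t_2}(s)=c_{t_2}(s)c_{t_1}(\phi_{t_2}(s))$. A stationary symmetric $\alpha$-stable (S$\alpha$S) field $\{X_t\}_{t\in\mathbb Z^d}$ is generated by $\{\phi_t\}$ if, in finite-dimensional distributions, $X_t\stackrel{d}{=}\int_S c_t(s)\big(\frac{d\mu\circ\phi_t}{d\mu}(s)\big)^{1/\alpha}f(\phi_t(s))\,M(ds)$, with $M$ an S$\alpha$S random measure with control measure $\mu$, $f\in L^\alpha(S,\mu)$, $\{c_t\}$ a cocycle, and $\bigcup_t \mathrm{support}(f\circ\phi_t)=S$. Algebraic objects: $K=\{t\in\mathbb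 Z^d:\phi_t=1_S\}$ and $A=\{\phi_t:t\in\mathbb Z^d\}\simeq\mathbb Z^d/K$. Write $A=\overline F\oplus\overline N$ with $\overline F$ free abelian of rank $p$ and $\overline N$ finite with $|\overline N|=l$. Let $\Psi:\overline F\to\mathbb Z^d$ be an injective homomorphism with $\Phi\circ\Psi=\mathrm{id}_{\overline F}$, where $\Phi(t)=\phi_t$, and let $F=\Psi(\overline F)$. Then $F+K$ is a direct sum, $K$ has rank $d-p$ and $\mathbb Z^d/(F+K)\simeq\overline N$. Let $x_1,\dots,x_l$ be coset representatives of $F+K$ in $\mathbb Z^d$ and $H=\bigcup_{k=1}^l(x_k+F)$, an abelian group (isomorphic to $\mathbb Z^d/K$) under addition $\oplus$ modulo $K$ ($s_1\oplus s_2$ is the unique $s\in H$ with $s_1+s_2-s\in K$). Each $t\in\mathbb Z^d$ is uniquely $t=t_H+t_K$ with $t_H\in H$, $t_K\in K$; $\pi(t)=t_H$. $U$ is a $d\times p$ matrix whose columns form a ($\mathbb Z$-)basis of $F$ and $V$ a $d\times(d-p)$ matrix whose columns form a ($\mathbb Z$-)basis of $K$. $\Delta=\{y\in\mathbb R^p:\exists\lambda\in\mathbb R^{d-p},\ \|Uy+V\lambda\|_\infty\le1\}$. Representation and normalization: under the stated assumptions $\{X_s\}_{s\in H}$ is a mixed moving average: there are a standard Borel space $(W,\mathcal W)$ with $\sigma$-finite measure $\nu$ and $h\in L^\alpha(W\times H,\nu\otimes\zeta_H)$ ($\zeta_H$ counting measure on $H$) with $X_s\stackrel{d}{=}\int_{W\times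 H}h(v,u\oplus s)M'(dv,du)$, $s\in H$, $M'$ an S$\alpha$S random measure with control measure $\nu\otimes\zeta_H$; moreover $X_t=X_{\pi(t)}$ a.s. for $t\in\mathbb Z^d$. After multiplication of the field by a deterministic positive constant (a standing normalization), $X_s=\sum_{i=1}^\infty j_ih(v_i,u_i\oplus s)$, $s\in H$, where $\sum_i\delta_{(j_i,v_i,u_i)}$ is a Poisson random measure on $([-\infty,\infty]\setminus\{0\})\times W\times H$ with mean measure $\nu_\alpha\otimes\nu\otimes\zeta_H$; the series is the limit in probability as $\delta\downarrow0$ of the finite sums over terms of modulus greater than $\delta$. *)

(* Defs.v *)
From HB Require Import structures.
From mathcomp Require Import all_boot all_order all_algebra.
From mathcomp Require Import all_classical all_reals all_analysis.
From mathcomp Require Import measurable_realfun.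

Set Implicit Arguments.
Unset Strict Implicit.
Unset Printing Implicit Defensive.

Import Order.TTheory GRing.Theory Num.Theory.
Import numFieldNormedType.Exports HBSimple.

Local Open Scope classical_set_scope.
Local Open Scope ring_scope.

(* Elements of Z^d are integer column vectors; Z^d carries the discrete
   sigma-algebra. *)
HB.instance Definition _ := isPointed.Build int 0%R.

HB.instance Definition _ (d : nat) :=
  @isMeasurable.Build default_measure_display 'cV[int]_d
    discrete_measurable discrete_measurable0
    discrete_measurableC discrete_measurableU.

Definition supnorm (d : nat) (t : 'cV[int]_d) : nat :=
  \max_(i < d) `|t i ord0|%N.

Section CountingOn.
Context (R : realType) (d : nat) (H : set 'cV[int]_d).

Lemma measurable_Zd : measurable H. Proof. by []. Qed.

Definition counting_on : set 'cV[int]_d -> \bar R :=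
  mrestr (@counting _ R) measurable_Zd.

HB.instance Definition _ := Measure.on counting_on.

Let counting_on_sigma_finite : sigma_finite [set: 'cV[int]_d] counting_on.
Proof.
exists (fun n => [set t | (pickle t <= n)%N]).
  by apply/seteqP; split=> // t _; exists (pickle t) => //=.
move=> n; split => //; rewrite /counting_on /mrestr /= /counting.
have fin : finite_set ([set t : 'cV[int]_d | (pickle t <= n)%N] `&` H).
  apply: (@sub_finite_set _ _ [set t : 'cV[int]_d | (pickle t < n.+1)%N]).
    by move=> t [].
  have inj : set_inj [set: 'cV[int]_d] (@pickle 'cV[int]_d).
    by move=> t s _ _; exact: (pcan_inj pickleK).
  rewrite -[X in finite_set X](_ : pickle @^-1` `I_n.+1 = _)//.
  by apply: finite_preimage => [t s _ _|//]; exact: (pcan_inj pickleK).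
by rewrite asboolT// ltry.
Qed.

HB.instance Definition _ :=
  @Measure_isSigmaFinite.Build _ _ _ counting_on counting_on_sigma_finite.

End CountingOn.

(* Standard Borel: isomorphic, as a measurable space, to a Polish space with
   its Borel sigma-algebra. *)
Definition standard_Borel (R : realType) (d : measure_display)
    (T : measurableType d) : Prop :=
  exists (Q : completePseudoMetricType R) (g : T -> Q),
    [/\ hausdorff_space Q,
        exists2 D : set Q, countable D & dense D,
        bijective g &
        forall A : set T, measurable A <-> <<s @open Q >> (g @` A)].

(* Lebesgue outer measure on R^p: infimum of the total volume of countable
   covers by closed boxes.  It is Lebesgue measure on measurable sets. *)
Definition Leb (R : realType) (p : nat) (A : set 'cV[R]_p) : \bar R :=
  ereal_inf [set (\sum_(0 <= k <oo)
                    (\prod_(i < p) (ab.2 k i ord0 - ab.1 k i ord0))%:E)%E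
            | ab in [set ab : (nat -> 'cV[R]_p) * (nat -> 'cV[R]_p) |
                (forall k i, ab.1 k i ord0 <= ab.2 k i ord0) /\
                A `<=` \bigcup_k [set y : 'cV[R]_p |
                  forall i, ab.1 k i ord0 <= y i ord0 <= ab.2 k i ord0]]].

Section Probability.
Context (R : realType).

(* Mutual independence of Y_0, ..., Y_{n-1}; subfamilies are covered by taking
   some of the B i to be setT. *)
Definition independent (d d' : measure_display) (Om : measurableType d)
    (E : measurableType d') (P : probability Om R) (n : nat)
    (Y : 'I_n -> Om -> E) : Prop :=
  forall B : 'I_n -> set E, (forall i, measurable (B i)) ->
    P [set w | forall i, B i (Y i w)] =
    (\prod_(i < n) P [set w | B i (Y i w)])%E.

(* Equality of the finite-dimensional distributions of two processes, at
   index points taken in D. *)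
Definition fdd_eq_on (I : Type) (D : set I) (d d' : measure_display)
    (Om : measurableType d) (Om' : measurableType d')
    (P : probability Om R) (X : I -> Om -> R)
    (P' : probability Om' R) (Y : I -> Om' -> R) : Prop :=
  forall (n : nat) (t : n.-tuple I) (B : set (n.-tuple R)),
    (forall i, D (tnth t i)) -> measurable B ->
    P [set w | B [tuple X (tnth t i) w | i < n]] =
    P' [set w | B [tuple Y (tnth t i) w | i < n]].

(* The characteristic function of Y is theta |-> exp(-sigma^alpha
   |theta|^alpha), real and imaginary parts being given separately. *)
Definition SaS_law (d : measure_display) (Om : measurableType d)
    (P : probability Om R) (alpha sigma : R) (Y : Om -> R) : Prop :=
  forall theta : R,
    ('E_P[fun w => cos (theta * Y w)] =
       (expR (- (sigma * `|theta|) `^ alpha))%:E)%E /\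
    ('E_P[fun w => sin (theta * Y w)] = 0)%E.

Definition SaS_field (I : Type) (d : measure_display)
    (Om : measurableType d) (P : probability Om R) (alpha : R)
    (X : I -> Om -> R) : Prop :=
  forall (n : nat) (t : 'I_n -> I) (a : 'I_n -> R),
    exists2 sigma : R, 0 <= sigma &
      SaS_law P alpha sigma (fun w => \sum_(i < n) a i * X (t i) w).

Definition stationary (d : measure_display) (Om : measurableType d)
    (P : probability Om R) (k : nat) (X : 'cV[int]_k -> Om -> R) : Prop :=
  forall s : 'cV[int]_k, fdd_eq_on setT P (fun t => X (t + s)) P X.

Definition in_Lalpha (d : measure_display) (T : measurableType d)
    (m : set T -> \bar R) (alpha : R) (D : set T) (g : T -> R) : Prop :=
  measurable_fun D g /\
  (\int[m]_(z in D) (`|g z| `^ alpha)%:E < +oo)%E.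

(* M A is only meaningful for measurable A of finite control measure. *)
Definition SaS_random_measure (d d' : measure_display)
    (Om : measurableType d) (T : measurableType d') (P : probability Om R)
    (alpha : R) (m : set T -> \bar R) (M : set T -> Om -> R) : Prop :=
  [/\ forall A, measurable A -> (m A < +oo)%E ->
        measurable_fun setT (M A) /\
        SaS_law P alpha (fine (m A) `^ alpha^-1) (M A),
      forall (n : nat) (A : 'I_n -> set T),
        (forall i, measurable (A i) /\ (m (A i) < +oo)%E) ->
        trivIset setT A -> independent P (fun i => M (A i)) &
      forall A : nat -> set T,
        (forall k, measurable (A k)) -> trivIset setT A ->
        (m (\bigcup_k A k) < +oo)%E ->
        {ae P, forall w,
          series (fun k => M (A k) w) @ \oo --> M (\bigcup_k A k) w}].

Definition simple_stable_integral (d d' : measure_display)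
    (Om : measurableType d) (T : measurableType d') (M : set T -> Om -> R)
    (g : T -> R) (w : Om) : R :=
  \sum_(x \in range g `\ 0) x * M (g @^-1` [set x]) w.

(* Y is (a version of) the integral of g with respect to M: a limit in
   probability of integrals of simple functions tending to g in L^alpha. *)
Definition is_stable_integral (d d' : measure_display)
    (Om : measurableType d) (T : measurableType d') (P : probability Om R)
    (alpha : R) (m : set T -> \bar R) (M : set T -> Om -> R)
    (g : T -> R) (Y : Om -> R) : Prop :=
  measurable_fun setT Y /\
  exists g_ : nat -> {sfun T >-> R},
    [/\ forall k, in_Lalpha m alpha setT (g_ k),
        (fun k => \int[m]_z (`|g_ k z - g z| `^ alpha)%:E)%E @ \oo --> 0%E &
        forall eps : R, 0 < eps ->
          (fun k => P [set w |
             eps < `|simple_stable_integral M (g_ k) w - Y w|]) @ \oo --> 0%E].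

End Probability.

Section Action.
Context (R : realType) (k : nat) (dS : measure_display)
  (S : measurableType dS) (mu : {sigma_finite_measure set S -> \bar R}).
Implicit Types (phi : 'cV[int]_k -> S -> S) (c : 'cV[int]_k -> S -> R)
  (G : set 'cV[int]_k).

Definition nonsingular_action phi : Prop :=
  [/\ forall t, measurable_fun setT (phi t),
      phi 0 = id,
      forall t1 t2, phi (t1 + t2) = phi t1 \o phi t2 &
      forall t, pushforward mu (phi t) `<< mu /\
                mu `<< pushforward mu (phi t)].

Definition wandering phi G (A : set S) : Prop :=
  measurable A /\ trivIset G (fun t => phi t @` A).

Definition dissipative phi G : Prop :=
  exists2 Wst : set S, wandering phi G Wst &
    \bigcup_(t in G) (phi t @` Wst) = setT.

Definition conservative phi G : Prop :=
  forall A : set S, wandering phi G A -> mu A = 0%E.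

Definition cocycle phi c : Prop :=
  [/\ forall t, measurable_fun setT (c t),
      forall t s, c t s = 1 \/ c t s = -1 &
      forall t1 t2 s, c (t1 + t2) s = c t2 s * c t1 (phi t2 s)].

(* r t is a version of d(mu o phi_t)/d mu; the library's Radon-Nikodym
   derivative is restricted to finite measures. *)
Definition action_density phi (r : 'cV[int]_k -> S -> R) : Prop :=
  forall t, [/\ measurable_fun setT (r t), forall s, 0 <= r t s &
    forall A, measurable A ->
      mu (phi t @` A) = (\int[mu]_(s in A) (r t s)%:E)%E].

Definition generated_by phi c (alpha : R) (d : measure_display)
    (Om : measurableType d) (P : probability Om R)
    (X : 'cV[int]_k -> Om -> R) : Prop :=
  exists (f : S -> R) (r : 'cV[int]_k -> S -> R)
    (d' : measure_display) (Om' : measurableType d') (P' : probability Om' R)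
    (M : set S -> Om' -> R) (Y : 'cV[int]_k -> Om' -> R),
    [/\ in_Lalpha mu alpha setT f /\
          \bigcup_t [set s | f (phi t s) != 0] = setT,
        action_density phi r,
        SaS_random_measure P' alpha mu M,
        forall t, is_stable_integral P' alpha mu M
          (fun s => c t s * r t s `^ alpha^-1 * f (phi t s)) (Y t) &
        fdd_eq_on setT P X P' Y].

End Action.

Section Lattice.
Context (d : nat).
Implicit Types (K F H : set 'cV[int]_d).

Definition action_kernel (S : Type) (phi : 'cV[int]_d -> S -> S) : set 'cV[int]_d :=
  [set t | phi t = id].

(* Subgroups of the group A = {phi_t} of transformations, under composition.
   A is commutative, so one-sided inverses suffice. *)
Definition transf_subgroup (S : Type) (phi : 'cV[int]_d -> S -> S)
    (B : set (S -> S)) : Prop :=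
  [/\ B `<=` range phi, B id,
      forall a b, B a -> B b -> B (a \o b) &
      forall a, B a -> exists2 b, B b & a \o b = id].

(* A = Fbar (+) Nbar, with Fbar free abelian of rank p (isomorphic to Z^p) and
   Nbar finite with l elements. *)
Definition transf_decomposition (S : Type) (phi : 'cV[int]_d -> S -> S)
    (p l : nat) (Fbar Nbar : set (S -> S)) : Prop :=
  [/\ transf_subgroup phi Fbar, transf_subgroup phi Nbar,
      forall a, range phi a ->
        exists! q : (S -> S) * (S -> S),
          [/\ Fbar q.1, Nbar q.2 & a = q.1 \o q.2],
      exists2 e : 'cV[int]_p -> (S -> S),
        forall a b, e (a + b) = e a \o e b & set_bij setT Fbar e &
      (Nbar #= `I_l)%card].

Definition transf_section (S : Type) (phi : 'cV[int]_d -> S -> S)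
    (Fbar : set (S -> S)) (Psi : (S -> S) -> 'cV[int]_d) : Prop :=
  [/\ forall a b, Fbar a -> Fbar b -> Psi (a \o b) = Psi a + Psi b,
      set_inj Fbar Psi &
      forall a, Fbar a -> phi (Psi a) = a].

Definition coset_representatives (l : nat) (x : 'I_l -> 'cV[int]_d) F K
    : Prop :=
  forall t, exists! i : 'I_l,
    exists u v, [/\ F u, K v & t = x i + (u + v)].

Definition coset_union (l : nat) (x : 'I_l -> 'cV[int]_d) F
    : set 'cV[int]_d :=
  [set t | exists i : 'I_l, exists2 u, F u & t = x i + u].

(* The unique element of H congruent to t modulo K. *)
Definition coset_proj K H (t : 'cV[int]_d) : 'cV[int]_d :=
  xget 0 [set s | H s /\ K (t - s)].

Definition oplus K H (s1 s2 : 'cV[int]_d) : 'cV[int]_d := coset_proj K H (s1 + s2).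

(* The columns of B form a Z-basis of L. *)
Definition Zbasis (q : nat) (B : 'M[int]_(d, q)) (L : set 'cV[int]_d) : Prop :=
  set_bij [set: 'cV[int]_q] L (fun a => B *m a).

(* The norm of a real column vector is its max norm. *)
Definition Delta (R : realType) (p q : nat) (U : 'M[int]_(d, p))
    (V : 'M[int]_(d, q)) : set 'cV[R]_p :=
  [set y | exists lam : 'cV[R]_q,
     `|map_mx intr U *m y + map_mx intr V *m lam| <= 1].

End Lattice.

Arguments Delta {d} R {p q} U V _.

Section Representation.
Context (R : realType) (d : nat) (dW : measure_display)
  (W : measurableType dW) (nu : {sigma_finite_measure set W -> \bar R})
  (K H : set 'cV[int]_d).

(* H and the measure nu (x) zeta_H live on W * Z^d; values of h outside W * H
   play no role, since oplus takes values in H. *)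
Definition mixed_moving_average (alpha : R) (h : W * 'cV[int]_d -> R)
    (dO : measure_display) (Om : measurableType dO) (P : probability Om R)
    (X : 'cV[int]_d -> Om -> R) : Prop :=
  (exists (d' : measure_display) (Om' : measurableType d')
     (P' : probability Om' R) (M' : set (W * 'cV[int]_d) -> Om' -> R)
     (Y : 'cV[int]_d -> Om' -> R),
     [/\ SaS_random_measure P' alpha (nu \x counting_on R H)%E M',
         forall s, H s ->
           is_stable_integral P' alpha (nu \x counting_on R H)%E M'
             (fun z => h (z.1, oplus K H z.2 s)) (Y s) &
         fdd_eq_on H P X P' Y]) /\
  (forall t, {ae P, forall w, X t w = X (coset_proj K H t) w}).

Definition is_nu_alpha (alpha : R) (na : {measure set (\bar R) -> \bar R})
    : Prop :=
  na [set 0%E] = 0%E /\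
  forall x : R, 0 < x ->
    na [set z | (x%:E < z)%E] = (x `^ (- alpha))%:E /\
    na [set z | (z < (- x)%:E)%E] = (x `^ (- alpha))%:E.

(* sum_i delta_(pt i) is a Poisson random measure on E with mean measure m
   (at rate 0 the formula gives 0 ^+ 0 = 1). *)
Definition Poisson_random_measure (dO dE : measure_display)
    (Om : measurableType dO) (E : measurableType dE) (P : probability Om R)
    (m : set E -> \bar R) (pt : nat -> Om -> E) : Prop :=
  let N (B : set E) (w : Om) : \bar R :=
    (\sum_(0 <= i <oo) \d_(pt i w) B)%E in
  [/\ forall i, measurable_fun setT (pt i),
      forall B, measurable B -> (m B < +oo)%E -> forall k : nat,
        P [set w | N B w = k%:R%:E] =
        (expR (- fine (m B)) * fine (m B) ^+ k / k`!%:R)%:E,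
      forall B, measurable B -> m B = +oo%E ->
        P [set w | N B w = +oo%E] = 1%E &
      forall (n : nat) (B : 'I_n -> set E),
        (forall i, measurable (B i)) -> trivIset setT B ->
        independent P (fun i => N (B i))].

(* X_s = sum_i a_i, the sum being the limit in probability, as delta decreases
   to 0, of the (a.s. finite) sums over the terms with |a_i| > delta. *)
Definition sum_in_probability (dO : measure_display) (Om : measurableType dO)
    (P : probability Om R) (a : nat -> Om -> R) (Y : Om -> R) : Prop :=
  forall eps : R, 0 < eps ->
    P [set w | eps <
      `|(\sum_(i \in [set i : nat | delta < `|a i w|]) a i w) - Y w|]
    @[delta --> 0^'+] --> 0%E.

Definition Poisson_series (alpha : R) (h : W * 'cV[int]_d -> R)
    (na : {measure set (\bar R) -> \bar R})
    (dO : measure_display) (Om : measurableType dO) (P : probability Om R)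
    (j : nat -> Om -> \bar R) (v : nat -> Om -> W)
    (u : nat -> Om -> 'cV[int]_d) (X : 'cV[int]_d -> Om -> R) : Prop :=
  [/\ is_nu_alpha alpha na,
      forall i w, j i w != 0%E /\ H (u i w),
      Poisson_random_measure P ((na \x nu) \x counting_on R H)%E
        (fun i w => ((j i w, v i w), u i w)) &
      forall s, H s ->
        sum_in_probability P
          (fun i w => fine (j i w) * h (v i w, oplus K H (u i w) s)) (X s)].

Definition sup_integral (alpha : R) (h : W * 'cV[int]_d -> R) : \bar R :=
  (\int[nu]_v
     (ereal_sup [set (Num.max (h (v, u)) 0)%:E | u in H] `^ alpha +
      ereal_sup [set (Num.max (- h (v, u)) 0)%:E | u in H] `^ alpha))%E.

End Representation.

(* inf {|t| : X_t > b}, equal to +oo when X never exceeds b. *)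
Definition hitting_radius (R : realType) (d : nat) (Om : Type)
    (X : 'cV[int]_d -> Om -> R) (b : R) (w : Om) : \bar R :=
  ereal_inf [set (supnorm t)%:R%:E | t in [set t | b < X t w]].

(* Main.v *)
(** As X_t = X_(pi t) a.s., the maximum over the box ||t|| <= n is the maximum of X
    over the image T_n of the box in H, and counting the lattice points of the slabs
    {y : |U y + V lambda| <= n for some lambda} gives |T_n| ~ l Leb(Delta) n^p.

    At levels of order gamma_n >> n^(p/alpha) a single big jump decides.  Let theta be
    small compared with eps.  A union bound over T_n shows that, up to a probability
    small compared with n^p / gamma_n^alpha, every X_s with s in T_n differs by
    at most eps gamma_n from the sum of its terms of modulus greater than
    theta gamma_n, and that at most one point of the Poisson process contributes such
    terms.  So the probability is asymptotically the mean number of points (j, v, u)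
    with j h(v, u (+) s) > gamma_n y for some s in T_n.  A mark (j, v) for which
    sup_u j h(v, u) exceeds the level is counted at least |T_n| times and, once the
    tail of h outside a ball of radius k is discarded, at most |T_(n+k)| times; the
    measure of these marks is the integral of the statement times
    (gamma_n y)^(-alpha). *)

Require Import Defs.
From HB Require Import structures.
From mathcomp Require Import all_boot all_order all_algebra finmap.
From mathcomp Require Import all_classical all_reals all_analysis.
From mathcomp Require Import measurable_realfun.
From mathcomp Require Import ring lra zify.

Set Implicit Arguments.
Unset Strict Implicit.
Unset Printing Implicit Defensive.

Import Order.TTheory GRing.Theory Num.Theory.
Import numFieldNormedType.Exports.

Local Open Scope classical_set_scope.
Local Open Scope ring_scope.


(** * Poisson random measures *)

Section PoissonMoments.
Context (R : realType).
Local Open Scope ereal_scope.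
Implicit Types (m : R) (k : nat).

(** The Poisson hypothesis speaks only of counts of sets, so the moments of sums over points must be
    recovered from counts: the laws of the points add up to the mean measure, and the laws of the
    pairs to a measure that is known on rectangles. This gives the variance of sums over sets of
    finite mass, which is all that Chebyshev's inequality needs.

    The field is reached from its truncated sums only through a limit in probability, so the bound
    on the small jumps has to be uniform in the lower truncation [delta]. The truncated second
    moment has this uniformity because [alpha < 2].

    [Leb] is an outer measure given by covers with boxes, and the two halves of the lattice count
    are adapted to it. Cells at the lattice points form an explicit cover, which bounds the measure
    by the count. Conversely a nearly optimal cover, slightly enlarged, bounds the count, because
    the slab is a linear image of a compact cube. *)

Definition poisson_weight m k : R := (expR (- m) * m ^+ k / k`!%:R)%R.

Lemma poisson_weight_ge0 m k : (0 <= m)%R -> (0 <= poisson_weight m k)%R.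
Proof. by move=> m0; rewrite !mulr_ge0 ?expR_ge0 ?exprn_ge0. Qed.

Lemma nneseries_recS (f : nat -> \bar R) : (forall k, 0 <= f k) ->
  \sum_(0 <= k <oo) f k = f 0%N + \sum_(0 <= k <oo) f k.+1.
Proof.
move=> f0; rewrite nneseries_recl//; congr (_ + _).
by rewrite -(nneseries_addn 1)//; apply: eq_eseriesr => i _; rewrite addn1.
Qed.

Lemma poisson_weight_sum m : (0 <= m)%R ->
  \sum_(0 <= k <oo) (poisson_weight m k)%:E = 1.
Proof.
move=> m0.
have -> : 1 = (expR (- m))%:E * (expR m)%:E :> \bar R.
  by rewrite -EFinM expRN mulVf ?gt_eqF ?expR_gt0.
under eq_eseriesr do rewrite /poisson_weight -mulrA EFinM.
rewrite nneseriesZl/=; last first.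
  by move=> n _; rewrite lee_fin divr_ge0// exprn_ge0.
congr *%E; rewrite expRE -EFin_lim; last first.
  rewrite /pseries/=; under eq_fun do rewrite mulrC.
  exact: is_cvg_series_exp_coeff.
apply/congr_lim/funext => n/=; rewrite /pseries/= /series/= -sumEFin//.
by under eq_bigr do rewrite mulrC.
Qed.

(** A factor [k] in a series is traded for [m] and a shift of the index, which reduces both moments
    below to the total mass. *)
Lemma poisson_weightS m k :
  (k.+1%:R * poisson_weight m k.+1 = m * poisson_weight m k)%R.
Proof.
rewrite /poisson_weight factS natrM exprS invfM.
have : (k.+1%:R : R) != 0%R by rewrite pnatr_eq0.
have : (k`!%:R : R) != 0%R by rewrite pnatr_eq0 -lt0n fact_gt0.
move: (k.+1%:R : R) (k`!%:R : R) => a b b0 a0.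
by field; rewrite a0 b0.
Qed.

Lemma poisson_weight_mean m : (0 <= m)%R ->
  \sum_(0 <= k <oo) (k%:R%:E * (poisson_weight m k)%:E) = m%:E.
Proof.
move=> m0; rewrite nneseries_recS; last first.
  by move=> k; rewrite mule_ge0 ?lee_fin ?poisson_weight_ge0.
rewrite mul0e add0e.
under eq_eseriesr do rewrite -EFinM poisson_weightS EFinM.
rewrite nneseriesZl ?poisson_weight_sum ?mule1// => k _.
by rewrite lee_fin poisson_weight_ge0.
Qed.

Lemma poisson_weight_mean2 m : (0 <= m)%R ->
  \sum_(0 <= k <oo) (k%:R%:E * k%:R%:E * (poisson_weight m k)%:E) =
  (m * m + m)%:E.
Proof.
move=> m0; rewrite nneseries_recS; last first.
  by move=> k; rewrite !mule_ge0 ?lee_fin ?poisson_weight_ge0.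
rewrite !mul0e add0e.
have w0 k : 0 <= (poisson_weight m k)%:E by rewrite lee_fin poisson_weight_ge0.
transitivity (\sum_(0 <= k <oo) (m%:E * (k%:R%:E * (poisson_weight m k)%:E +
    (poisson_weight m k)%:E))).
  apply: eq_eseriesr => k _; rewrite [RHS]/=; congr EFin.
  by rewrite -mulrA poisson_weightS; rewrite -natr1; ring.
rewrite nneseriesZl; last first.
  by move=> k _; rewrite adde_ge0 ?mule_ge0 ?lee_fin ?poisson_weight_ge0.
rewrite nneseriesD//; last by move=> *; rewrite mule_ge0// lee_fin.
by rewrite poisson_weight_mean// poisson_weight_sum// -EFinD -EFinM mulrDr mulr1.
Qed.

End PoissonMoments.

Section CountablePartition.
Context (R : realType) (d : measure_display) (Om : measurableType d)
  (P : probability Om R) (Z : Om -> \bar R).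
Hypothesis mZ : measurable_fun setT Z.
Local Open Scope ereal_scope.
Hypothesis Z1 : \sum_(0 <= k <oo) P [set w | Z w = k%:R%:E] = 1.

Lemma measurable_value k : measurable [set w | Z w = k].
Proof.
rewrite -[X in measurable X]setTI.
exact: (mZ measurableT (emeasurable_set1 k)).
Qed.

Let U := \bigcup_(k in [set: nat]) [set w | Z w = k%:R%:E].

Let mU : measurable U.
Proof. by apply: bigcupT_measurable => k; exact: measurable_value. Qed.

Let trivZ : trivIset setT (fun k : nat => [set w | Z w = k%:R%:E]).
Proof.
move=> i k _ _ [w [/= -> /eqP]]; rewrite eqe.
by rewrite eqr_nat => /eqP.
Qed.

(** The masses at the natural numbers already add up to 1, so nothing is left for other values,
    [+oo] included. *)
Lemma natural_ae : P (~` U) = 0.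
Proof.
rewrite probability_setC// (_ : P U = 1) ?subee//.
rewrite /U measure_bigcup//; last by move=> k _; exact: measurable_value.
by rewrite -Z1; apply: eq_eseriesl => k; rewrite in_setT.
Qed.

(** The law of a count is given by its point masses only; cutting along the level sets turns
    integrals into series in these masses. *)
Lemma integral_values (D : set Om) (f : Om -> \bar R) :
  measurable D -> measurable_fun setT f -> (forall w, 0 <= f w) ->
  \int[P]_(w in D) f w =
  \sum_(0 <= k <oo) \int[P]_(w in D `&` [set w | Z w = k%:R%:E]) f w.
Proof.
move=> mD mf f0.
rewrite (@ge0_negligible_integral _ _ _ _ _ (~` U))//; last 3 first.
- exact: measurableC.
- exact: measurable_funS mf.
- exact: natural_ae.
have -> : D `\` ~` U =
    \bigcup_k (D `&` [set w | Z w = k%:R%:E]).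
  by rewrite setDE setCK /U setI_bigcupr.
rewrite ge0_integral_bigcup//.
- by move=> k; apply: measurableI => //; exact: measurable_value.
- exact: measurable_funS mf.
- by move=> i k _ _ [w [[_ h1] [_ h2]]]; apply: trivZ => //; exists w.
Qed.

End CountablePartition.

Section PoissonCounts.
Context (R : realType) (dO dE : measure_display) (Om : measurableType dO)
  (E : measurableType dE) (P : probability Om R) (m : {measure set E -> \bar R})
  (pt : nat -> Om -> E).
Local Open Scope ereal_scope.

Definition count (B : set E) (w : Om) : \bar R :=
  \sum_(0 <= i <oo) \d_(pt i w) B.

Hypothesis prm : Poisson_random_measure P m pt.

Let mpt i : measurable_fun setT (pt i).
Proof. by case: prm. Qed.

Lemma count_ge0 B w : 0 <= count B w.
Proof. exact: nneseries_ge0. Qed.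

Lemma measurable_count B : measurable B -> measurable_fun setT (count B).
Proof.
move=> mB; apply: (ge0_emeasurable_sum (P := xpredT)) => // k _.
apply/measurable_EFinP; apply: (measurableT_comp _ (mpt k)).
exact: measurable_indic.
Qed.

Lemma count_pmf B k : measurable B -> m B < +oo ->
  P [set w | count B w = k%:R%:E] = (poisson_weight (fine (m B)) k)%:E.
Proof. by move=> mB fB; case: prm => _ + _ _; exact. Qed.

Lemma count_pmf_sum B : measurable B -> m B < +oo ->
  \sum_(0 <= k <oo) P [set w | count B w = k%:R%:E] = 1.
Proof.
move=> mB fB; under eq_eseriesr do rewrite count_pmf//.
by rewrite poisson_weight_sum// fine_ge0.
Qed.

Lemma integral_count_on D B : measurable D -> measurable B -> m B < +oo ->
  \int[P]_(w in D) count B w =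
  \sum_(0 <= k <oo) (k%:R%:E * P (D `&` [set w | count B w = k%:R%:E])).
Proof.
move=> mD mB fB; have mN := measurable_count mB.
rewrite (integral_values mN (count_pmf_sum mB fB))//; last exact: count_ge0.
apply: eq_eseriesr => k _.
rewrite -integral_cst; last by apply: measurableI => //; exact: measurable_value.
by apply: eq_integral => w; rewrite inE/= => -[_ ->].
Qed.

Lemma expectation_count B : measurable B -> m B < +oo ->
  \int[P]_w count B w = m B.
Proof.
move=> mB fB; rewrite integral_count_on//.
under eq_eseriesr do rewrite setTI count_pmf//.
by rewrite poisson_weight_mean ?fine_ge0// fineK// ge0_fin_numE.
Qed.

Lemma expectation_count_sq B : measurable B -> m B < +oo ->
  \int[P]_w (count B w * count B w) = m B * m B + m B.
Proof.
move=> mB fB; have mN := measurable_count mB.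
rewrite (integral_values mN (count_pmf_sum mB fB))//; last 2 first.
- exact: emeasurable_funM.
- by move=> w; rewrite mule_ge0// count_ge0.
have -> : m B * m B + m B =
    (fine (m B) * fine (m B) + fine (m B))%:E.
  by rewrite EFinD EFinM fineK// ge0_fin_numE.
rewrite -poisson_weight_mean2 ?fine_ge0//; apply: eq_eseriesr => k _.
rewrite -count_pmf// -EFinM -integral_cst; last exact: measurable_value.
by rewrite setTI; apply: eq_integral => w; rewrite inE/= => ->.
Qed.

Lemma count_independent A B k l : measurable A -> measurable B ->
  A `&` B = set0 ->
  P ([set w | count A w = k] `&` [set w | count B w = l]) =
  P [set w | count A w = k] * P [set w | count B w = l].
Proof.
move=> mA mB AB; case: prm => _ _ _ /(_ 2%N (fun i => if val i == 0%N then A else B)).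
move=> /(_ _ _ (fun i => if val i == 0%N then [set k] else [set l])).
rewrite !big_ord_recl big_ord0/= mule1 => <-; last 3 first.
- by move=> i; case: ifP.
- by apply/trivIsetP => -[[|[|//]] ?] [[|[|//]] ?] _ _ //=; rewrite setIC.
- by move=> i; case: ifP => _; exact: emeasurable_set1.
congr (P _); apply/seteqP; split => w /=.
  by move=> [? ?] i; case: ifP.
by move=> h; split; [have := h ord0 | have := h (lift ord0 ord0)].
Qed.

Lemma expectation_count_disjoint A B : measurable A -> measurable B ->
  m A < +oo -> m B < +oo -> A `&` B = set0 ->
  \int[P]_w (count A w * count B w) = m A * m B.
Proof.
move=> mA mB fA fB AB.
have mNA := measurable_count mA; have mNB := measurable_count mB.
rewrite (integral_values mNA (count_pmf_sum mA fA))//; last 2 first.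
- exact: emeasurable_funM.
- by move=> w; rewrite mule_ge0// count_ge0.
have key k : \int[P]_(w in [set w | count A w = k%:R%:E]) count B w =
    (poisson_weight (fine (m A)) k)%:E * m B.
  rewrite integral_count_on//; last exact: measurable_value.
  have -> : m B = \sum_(0 <= l <oo) (l%:R%:E * (poisson_weight (fine (m B)) l)%:E).
    by rewrite poisson_weight_mean ?fine_ge0// fineK// ge0_fin_numE.
  rewrite -nneseriesZl; last first.
    by move=> l _; rewrite mule_ge0// lee_fin poisson_weight_ge0// fine_ge0.
  apply: eq_eseriesr => l _; rewrite count_independent// count_pmf// count_pmf//.
  by rewrite muleCA.
transitivity (\sum_(0 <= k <oo)
    (m B * (k%:R%:E * (poisson_weight (fine (m A)) k)%:E))).
  apply: eq_eseriesr => k _; rewrite setTI.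
  rewrite (eq_integral (fun w => k%:R%:E * count B w)); last first.
    by move=> w; rewrite inE/= => ->.
  rewrite ge0_integralZl//.
  - by rewrite key muleA muleC.
  - exact: measurable_value.
  - exact: measurable_funS mNB.
  - by move=> w _; exact: count_ge0.
rewrite -[m B]fineK ?ge0_fin_numE// nneseriesZl; last first.
  by move=> l _; rewrite mule_ge0// lee_fin poisson_weight_ge0// fine_ge0.
by rewrite poisson_weight_mean ?fine_ge0// !fineK ?ge0_fin_numE// muleC.
Qed.

Lemma countU A B w : measurable A -> measurable B -> A `&` B = set0 ->
  count (A `|` B) w = count A w + count B w.
Proof.
move=> mA mB AB; rewrite /count -nneseriesD//.
by apply: eq_eseriesr => i _; rewrite measureU.
Qed.

(** Cutting along the intersection leaves products of counts of disjoint sets, whose expectations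
    factor, and the square of the common count. The latter has second moment equal to the square of
    its mean plus its mean, which is the extra term. *)
Lemma expectation_countM A B : measurable A -> measurable B ->
  m A < +oo -> m B < +oo ->
  \int[P]_w (count A w * count B w) = m A * m B + m (A `&` B).
Proof.
move=> mA mB fA fB.
have mI := measurableI _ _ mA mB.
have mA' := measurableD mA mB; have mB' := measurableD mB mA.
have dA : (A `\` B) `&` (A `&` B) = set0.
  by apply/seteqP; split => // z [[_ h] [_ /h]].
have dB : (A `&` B) `&` (B `\` A) = set0.
  by apply/seteqP; split => // z [[h _] [_ /(_ h)]].
have dAB : (A `\` B) `&` B = set0 by apply/seteqP; split => // z [[_ h] /h].
have EA : A = (A `\` B) `|` (A `&` B) by rewrite setUC setUIDK.
have EB : B = (A `&` B) `|` (B `\` A) by rewrite setIC setUIDK.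
have fI : m (A `&` B) < +oo by apply: le_lt_trans fA; apply: le_measure; rewrite ?inE.
have fA' : m (A `\` B) < +oo by apply: le_lt_trans fA; apply: le_measure; rewrite ?inE.
have fB' : m (B `\` A) < +oo by apply: le_lt_trans fB; apply: le_measure; rewrite ?inE.
transitivity (\int[P]_w (count (A `\` B) w * count B w +
   (count (A `&` B) w * count (A `&` B) w +
    count (A `&` B) w * count (B `\` A) w))).
  apply: eq_integral => w _.
  have -> : count A w = count (A `\` B) w + count (A `&` B) w.
    by rewrite {1}EA countU.
  rewrite ge0_muleDl ?count_ge0//; congr +%E.
  have -> : count B w = count (A `&` B) w + count (B `\` A) w.
    by rewrite {1}EB countU.
  by rewrite ge0_muleDr ?count_ge0.
have mN C (mC : measurable C) := measurable_count mC.
have M0 C D w : 0 <= count C w * count D w by rewrite mule_ge0 ?count_ge0.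
rewrite ge0_integralD//; last 3 first.
- exact: emeasurable_funM (mN _ _) (mN _ _).
- by move=> w _; rewrite adde_ge0.
- by apply: emeasurable_funD; apply: emeasurable_funM; exact: mN.
rewrite ge0_integralD//; last 2 first.
- exact: emeasurable_funM (mN _ _) (mN _ _).
- exact: emeasurable_funM (mN _ _) (mN _ _).
rewrite expectation_count_disjoint// expectation_count_sq//.
rewrite expectation_count_disjoint//.
have -> : m A = m (A `\` B) + m (A `&` B) by rewrite {1}EA measureU.
have EmB : m B = m (A `&` B) + m (B `\` A) by rewrite {1}EB measureU.
rewrite ge0_muleDl// -[RHS]addeA; congr +%E.
rewrite EmB ge0_muleDr// -!addeA; congr +%E.
by rewrite addeC.
Qed.

End PoissonCounts.

(** * Campbell's formulas for the first two moments *)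

Section Campbell.
Context (R : realType).
Local Open Scope ereal_scope.

Lemma nneseriesZ (k : \bar R) (a : nat -> \bar R) : 0 <= k ->
  (forall i, 0 <= a i) ->
  \sum_(0 <= i <oo) (k * a i) = k * \sum_(0 <= i <oo) a i.
Proof.
move=> k0 a0; rewrite -!ge0_integral_count// ?ge0_integralZl//.
by move=> i; rewrite mule_ge0.
Qed.

Lemma nneseriesM (a b : nat -> \bar R) :
  (forall i, 0 <= a i) -> (forall i, 0 <= b i) ->
  (\sum_(0 <= i <oo) a i) * (\sum_(0 <= j <oo) b j) =
  \sum_(0 <= i <oo) \sum_(0 <= j <oo) (a i * b j).
Proof.
move=> a0 b0; rewrite muleC -nneseriesZ//; last exact: nneseries_ge0.
by apply: eq_eseriesr => i _; rewrite nneseriesZ// muleC.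
Qed.

Definition image_measure d1 d2 (T1 : measurableType d1) (T2 : measurableType d2)
    (m : {measure set T1 -> \bar R}) (f : T1 -> T2)
    (mf : measurable_fun setT f) : {measure set T2 -> \bar R} :=
  measure_function_pushforward__canonical__measure_function_Measure m mf.

Lemma integral_image_measure d1 d2 (T1 : measurableType d1)
    (T2 : measurableType d2) (m : {measure set T1 -> \bar R}) (f : T1 -> T2)
    (mf : measurable_fun setT f) (g : T2 -> \bar R) :
  measurable_fun setT g -> (forall y, 0 <= g y) ->
  \int[image_measure m mf]_y g y = \int[m]_x g (f x).
Proof. by move=> mg g0; rewrite ge0_integral_pushforward. Qed.

(** Agreement inside [D] suffices for integrands that vanish off [D]. In the applications to Poisson
    points [D] has finite mass, and only there are the moments of the counts known. *)
Lemma integral_support d (T : measurableType d) (m1 m2 : {measure set T -> \bar R})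
    (D : set T) (f : T -> \bar R) :
  (forall z, ~ D z -> f z = 0) ->
  (forall A, measurable A -> A `<=` D -> m1 A = m2 A) ->
  \int[m1]_z f z = \int[m2]_z f z.
Proof.
move=> f0 m12.
have -> : f = f \_ D.
  apply/funext => z; rewrite patchE; case: ifPn => //.
  by rewrite notin_setE => /f0.
by rewrite -!integral_mkcond; exact: eq_measure_integral.
Qed.

Context (dO dE : measure_display) (Om : measurableType dO)
  (E : measurableType dE) (P : probability Om R) (m : {measure set E -> \bar R})
  (pt : nat -> Om -> E).
Hypothesis prm : Poisson_random_measure P m pt.

Let mpt i : measurable_fun setT (pt i).
Proof. by case: prm. Qed.

Let mpp i j : measurable_fun setT (fun w => (pt i w, pt j w)).
Proof. exact: measurable_fun_pair. Qed.

Variables (D : set E) (mD : measurable D) (fD : m D < +oo).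

Let fsub A : measurable A -> A `<=` D -> m A < +oo.
Proof.
by move=> mA AD; apply: le_lt_trans fD; apply: le_measure; rewrite ?inE.
Qed.

Definition psum (f : E -> \bar R) (w : Om) : \bar R :=
  \sum_(0 <= i <oo) f (pt i w).

Section fixed.
Variable f : E -> \bar R.
Hypotheses (mf : measurable_fun setT f) (f0 : forall z, 0 <= f z)
  (fsupp : forall z, ~ D z -> f z = 0).

Lemma psum_ge0 w : 0 <= psum f w.
Proof. exact: nneseries_ge0. Qed.

Lemma measurable_psum : measurable_fun setT (psum f).
Proof.
apply: (ge0_emeasurable_sum (P := xpredT)) => // k _.
exact: measurableT_comp (mpt k).
Qed.

(** The laws of the points add up to a measure that coincides with [m] inside [D], since its value
    on a set is the mean count of that set. *)
Lemma expectation_psum : \int[P]_w psum f w = \int[m]_z f z.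
Proof.
rewrite (integral_support (m2 := mseries (fun i => image_measure P (mpt i)) 0) fsupp).
  rewrite ge0_integral_measure_series// integral_nneseries//; last first.
    by move=> i; exact: measurableT_comp (mpt i).
  by apply: eq_eseriesr => i _; rewrite integral_image_measure.
move=> A mA AD; rewrite -(expectation_count prm) ?fsub//.
rewrite integral_nneseries//; last first.
  move=> i; apply/measurable_EFinP; apply: (measurableT_comp _ (mpt i)).
  exact: measurable_indic.
apply: eq_eseriesr => i _.
rewrite -[LHS](integral_image_measure P (mpt i) (g := fun z => (\1_A z)%:E)).
- by rewrite integral_indic// setIT.
- exact/measurable_EFinP/measurable_indic.
- by move=> y; rewrite lee_fin.
Qed.

Let muD := mfrestr mD fD.
Let Q := mseries (fun i => mseries (fun j => image_measure P (mpp i j)) 0) 0.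
Let mdiag : measurable_fun setT (fun z : E => (z, z)).
Proof. exact: measurable_fun_pair. Qed.
Let mDD : measurable (D `*` D).
Proof. exact: measurableX. Qed.

Let Q_rectangle A B : measurable A -> measurable B ->
  mrestr Q mDD (A `*` B) = m (A `&` D) * m (B `&` D) + m (A `&` B `&` D).
Proof.
move=> mA mB; rewrite /mrestr -setXI.
have mAD := measurableI _ _ mA mD; have mBD := measurableI _ _ mB mD.
have -> : A `&` B `&` D = (A `&` D) `&` (B `&` D).
  by rewrite setIACA setIid.
rewrite -(expectation_countM prm)//; last 2 first.
- by apply: fsub => //; exact: subIsetr.
- by apply: fsub => //; exact: subIsetr.
have mc C i : measurable C -> measurable_fun setT (fun w => \d_(pt i w) C : \bar R).
  move=> mC; apply/measurable_EFinP; apply: (measurableT_comp _ (mpt i)).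
  exact: measurable_indic.
transitivity (\int[P]_w \sum_(0 <= i <oo) \sum_(0 <= j <oo)
    (\d_(pt i w) (A `&` D) * \d_(pt j w) (B `&` D))); last first.
  by apply: eq_integral => w _; rewrite /count nneseriesM.
rewrite integral_nneseries//; last 2 first.
- move=> i; apply: (ge0_emeasurable_sum (P := xpredT)) => [j w _ _|j _].
    by rewrite mule_ge0.
  by apply: emeasurable_funM; exact: mc.
- by move=> i w _; apply: nneseries_ge0 => // j _ _; rewrite mule_ge0.
apply: eq_eseriesr => i _; rewrite integral_nneseries//; last 2 first.
- by move=> j; apply: emeasurable_funM; exact: mc.
- by move=> j w _; rewrite mule_ge0.
apply: eq_eseriesr => j _.
transitivity (\int[P]_w (\1_((A `&` D) `*` (B `&` D)) (pt i w, pt j w))%:E).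
  rewrite -[RHS](integral_image_measure P (mpp i j)
    (g := fun z => (\1_((A `&` D) `*` (B `&` D)) z)%:E)).
  - by rewrite integral_indic// ?setIT//; exact: measurableX.
  - by apply/measurable_EFinP/measurable_indic; exact: measurableX.
  - by move=> y; rewrite lee_fin.
apply: eq_integral => w _; rewrite /dirac -EFinM; congr EFin.
by rewrite !indicE in_setX -natrM mulnb.
Qed.

(* The second factorial moment: diagonal pairs (pt i, pt i) contribute the image
   of m, off-diagonal ones the product measure; rectangles determine Q. *)
Let Q_eq X : measurable X ->
  mrestr Q mDD X = measure_add (muD \x muD) (image_measure muD mdiag) X.
Proof.
pose C : set (set (E * E)) := [set A `*` B | A in measurable & B in measurable].
move=> mX; apply: (measure_unique C (fun=> setT)) => //.
- exact: measurable_prod_measurableType.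
- move=> _ _ [A mA [B mB <-]] [A' mA' [B' mB' <-]]; rewrite -setXI.
  by exists (A `&` A'); [exact: measurableI|exists (B `&` B') => //; exact: measurableI].
- by move=> _; exists setT => //; exists setT => //; rewrite setXTT.
- by apply/seteqP; split => // z _; exists 0%N.
- move=> _ [A mA [B mB <-]].
  suff : mrestr Q mDD (A `*` B) =
    measure_add (muD \x muD) (image_measure muD mdiag) (A `*` B) by [].
  rewrite Q_rectangle// measure_addE; congr +%E.
  exact/esym/product_measure1E.
(* Finite total mass on the square of [D] is what lets rectangles determine the measure. *)
- move=> _; suff : mrestr Q mDD setT < +oo by [].
  rewrite -setXTT Q_rectangle// !setTI.
  by rewrite lte_add_pinfty// lte_mul_pinfty// ge0_fin_numE.
Qed.

(** The product part of the pair measure gives the square of the mean, and its diagonal part gives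
    the variance. *)
Lemma expectation_psum_sq :
  \int[P]_w (psum f w * psum f w) =
  (\int[m]_z f z) * (\int[m]_z f z) + \int[m]_z (f z * f z).
Proof.
pose F (z : E * E) := f z.1 * f z.2.
have mF : measurable_fun setT F.
  by apply: emeasurable_funM; apply: measurableT_comp => //; exact: measurable_fst || exact: measurable_snd.
have F0 z : 0 <= F z by rewrite mule_ge0.
have FD z : ~ (D `*` D) z -> F z = 0.
  rewrite /F => /not_andP[] /fsupp ->; first by rewrite mul0e.
  by rewrite mule0.
transitivity (\int[Q]_z F z).
  rewrite ge0_integral_measure_series//.
  transitivity (\int[P]_w \sum_(0 <= i <oo) \sum_(0 <= j <oo)
      (f (pt i w) * f (pt j w))).
    by apply: eq_integral => w _; rewrite /psum nneseriesM.
  rewrite integral_nneseries//; last 2 first.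
  - move=> i; apply: (ge0_emeasurable_sum (P := xpredT)) => [j w _ _|j _].
      by rewrite mule_ge0.
    by apply: emeasurable_funM; exact: measurableT_comp.
  - by move=> i w _; apply: nneseries_ge0 => // j _ _; rewrite mule_ge0.
  apply: eq_eseriesr => i _; rewrite ge0_integral_measure_series//.
  rewrite integral_nneseries//; last 2 first.
  - by move=> j; apply: emeasurable_funM; exact: measurableT_comp.
  - by move=> j w _; rewrite mule_ge0.
  by apply: eq_eseriesr => j _; rewrite integral_image_measure.
rewrite (integral_support (m2 := mrestr Q mDD) FD); last first.
  move=> X mX XD; suff : Q X = mrestr Q mDD X by [].
  by rewrite /mrestr setIidl.
rewrite (eq_measure_integral (measure_add (muD \x muD) (image_measure muD mdiag))).
  2: by move=> X mX _; exact: Q_eq.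
rewrite ge0_integral_measure_add// integral_image_measure//.
have restr (g : E -> \bar R) : (forall z, ~ D z -> g z = 0) ->
    \int[m]_z g z = \int[muD]_z g z.
  move=> g0; apply: (integral_support g0) => A mA AD.
  suff : m A = muD A by [].
  by rewrite /muD /mfrestr /mrestr setIidl.
rewrite -(restr (fun z => f z * f z)); last by move=> z /fsupp ->; rewrite mul0e.
congr +%E; rewrite fubini_tonelli1//= /fubini_F/= /F/= (restr f fsupp).
under eq_integral do rewrite ge0_integralZl//.
by rewrite ge0_integralZr// integral_ge0.
Qed.

End fixed.
End Campbell.

(** * Concentration of Poisson sums *)

Section Chebyshev.
Context (R : realType) (dO dE : measure_display) (Om : measurableType dO)
  (E : measurableType dE) (P : probability Om R) (m : {measure set E -> \bar R})
  (pt : nat -> Om -> E).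
Hypothesis prm : Poisson_random_measure P m pt.
Variables (D : set E) (mD : measurable D) (fD : (m D < +oo)%E).
Variable f : E -> R.
Hypotheses (mf : measurable_fun setT f) (f0 : forall z, 0 <= f z)
  (fsupp : forall z, ~ D z -> f z = 0).

Let fE : E -> \bar R := EFin \o f.
Let X w := fine (psum pt fE w).
Let mfE : measurable_fun setT fE. Proof. exact/measurable_EFinP. Qed.
Let fE0 z : (0 <= fE z)%E. Proof. by rewrite lee_fin. Qed.
Let fEsupp z : ~ D z -> fE z = 0%E. Proof. by move=> /fsupp; rewrite /fE/= => ->. Qed.

Lemma measurable_fine_psum : measurable_fun setT X.
Proof.
apply: measurableT_comp => //.
exact: (measurable_psum prm).
Qed.

Hypothesis ff : (\int[m]_z (f z)%:E < +oo)%E.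

Lemma psum_ae_fin : {ae P, forall w, psum pt fE w = (X w)%:E}.
Proof.
have mS := measurable_psum prm mfE fE0.
have : P.-integrable setT (psum pt fE).
  apply/integrableP; split => //.
  under eq_integral do rewrite gee0_abs ?psum_ge0//.
  by rewrite (expectation_psum prm mD fD).
move/(integrable_ae measurableT); apply: filterS => w /(_ I) h.
by rewrite /X fineK.
Qed.

(** By the second Campbell formula the variance of the sum is the integral of [f ^+ 2]. Passing to
    [fine] is harmless because the sum is almost surely finite. *)
Lemma psum_chebyshev (eps : R) : 0 < eps ->
  (P [set w | (eps <= `|X w - fine (\int[m]_z (f z)%:E)|)%R] <=
   (eps ^- 2)%:E * \int[m]_z (f z ^+ 2)%:E)%E.
Proof.
move=> e0; set mu := fine _.
have mX := measurable_fine_psum.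
have mS := measurable_psum prm mfE fE0.
have X0 w : 0 <= X w by rewrite fine_ge0// psum_ge0.
have mu0 : 0 <= mu by rewrite fine_ge0// integral_ge0// => z _; rewrite lee_fin.
have muE : (\int[m]_z (f z)%:E)%E = mu%:E.
  by rewrite fineK// ge0_fin_numE// integral_ge0// => z _; rewrite lee_fin.
have EX : (\int[P]_w (X w)%:E = mu%:E)%E.
  rewrite -muE -(expectation_psum prm mD fD mfE fE0 fEsupp).
  apply: ge0_ae_eq_integral => //.
  - exact/measurable_EFinP.
  - by move=> w _; rewrite lee_fin.
  - by move=> w _; exact: psum_ge0.
  - by apply: filterS psum_ae_fin => w ->.
have EX2 : (\int[P]_w (X w ^+ 2)%:E = (mu ^+ 2)%:E + \int[m]_z (f z ^+ 2)%:E)%E.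
  have := expectation_psum_sq prm mD fD mfE fE0 fEsupp.
  rewrite [in X in _ = X -> _]/fE/= muE -EFinM -expr2 => <-.
  apply: ge0_ae_eq_integral => //.
  - exact/measurable_EFinP/measurable_funX.
  - exact: emeasurable_funM.
  - by move=> w _; rewrite lee_fin exprn_ge0.
  - by move=> w _; rewrite mule_ge0// psum_ge0.
  - by apply: filterS psum_ae_fin => w -> _; rewrite -EFinM expr2.
have mXm : measurable_fun setT (fun w => X w - mu) by exact: measurable_funB.
have mXm2 : measurable_fun setT (fun w => ((X w - mu) ^+ 2)%:E).
  exact/measurable_EFinP/measurable_funX.
have VX : (\int[P]_w ((X w - mu) ^+ 2)%:E = \int[m]_z (f z ^+ 2)%:E)%E.
  (* The added constant is the mean of [2 * mu * X]; with it on both sides, every integrand is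
     nonnegative and additivity needs no integrability. *)
  have : (\int[P]_w ((X w - mu) ^+ 2)%:E + (2 * mu ^+ 2)%:E =
      \int[m]_z (f z ^+ 2)%:E + (2 * mu ^+ 2)%:E)%E.
    transitivity (\int[P]_w (((X w - mu) ^+ 2)%:E + (2 * mu)%:E * (X w)%:E))%E.
      rewrite ge0_integralD//; last 3 first.
      - by move=> w _; rewrite lee_fin sqr_ge0.
      - by move=> w _; rewrite -EFinM lee_fin !mulr_ge0.
      - by apply: measurable_funeM; exact/measurable_EFinP.
      rewrite ge0_integralZl//.
      - by rewrite EX -EFinM expr2 mulrA.
      - exact/measurable_EFinP.
      - by move=> w _; rewrite lee_fin.
      - by rewrite lee_fin mulr_ge0.
    transitivity (\int[P]_w ((X w ^+ 2)%:E + (cst (mu ^+ 2)%:E) w))%E.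
      by apply: eq_integral => w _; rewrite /= -EFinM -!EFinD; congr EFin; ring.
    rewrite ge0_integralD//; last 3 first.
    - by move=> w _; rewrite lee_fin sqr_ge0.
    - exact/measurable_EFinP/measurable_funX.
    - by move=> w _; rewrite /= lee_fin sqr_ge0.
    rewrite EX2 integral_cst// [X in (_ + _ * X)%E](_ : _ = 1%E) ?mule1; last exact: probability_setT.
    rewrite -addeA addeCA; congr +%E; rewrite -EFinD; congr EFin.
    by rewrite mulr_natl mulr2n.
  by move/(congr1 (fun x => x - (2 * mu ^+ 2)%:E)%E); rewrite !addeK.
have mA : measurable [set w | eps <= `|X w - mu|].
  rewrite -[X in measurable X]setTI.
  have mabs : measurable_fun setT (fun w => `|X w - mu|).
    exact: measurableT_comp.
  have -> : [set w | eps <= `|X w - mu|] = (fun w => `|X w - mu|) @^-1` `[eps, +oo[%classic.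
    by apply/seteqP; split => w /=; rewrite in_itv/= andbT.
  exact: mabs.
rewrite -VX -ge0_integralZl//; last 2 first.
- by move=> w _; rewrite lee_fin sqr_ge0.
- by rewrite lee_fin invr_ge0 exprn_ge0// ltW.
rewrite -[leLHS]mul1e -integral_cst//.
apply: (@le_trans _ _ (\int[P]_(w in [set w | (eps <= `|X w - mu|)%R])
    ((eps ^- 2)%:E * ((X w - mu) ^+ 2)%:E))%E).
  apply: ge0_le_integral => //.
  - by apply: measurable_funeM; exact: measurable_funS mXm2.
  - move=> w /= ew; rewrite -EFinM lee_fin mulrC ler_pdivlMr ?exprn_gt0// mul1r.
    by rewrite -[leRHS]real_normK ?num_real// lerXn2r// nnegrE// ltW.
apply: ge0_subset_integral => //.
- exact: measurable_funeM.
- by move=> w _; rewrite -EFinM lee_fin mulr_ge0 ?sqr_ge0// invr_ge0 exprn_ge0// ltW.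
Qed.

End Chebyshev.

(** * Sums over the large jumps *)

Section JumpSums.
Context (R : realType).

(** These truncations keep positive values only. Applied to [a] and to [- a], they split signed
    jumps into two nonnegative families, to which Campbell's formulas apply. *)
Definition window (delta tau x : R) : R := if delta < x <= tau then x else 0.
Definition cutoff (delta x : R) : R := if delta < x then x else 0.

Lemma window_ge0 delta tau x : 0 <= delta -> 0 <= window delta tau x.
Proof. by move=> d0; rewrite /window; case: ifP => // /andP[/(le_lt_trans d0)/ltW]. Qed.

Lemma cutoff_ge0 delta x : 0 <= delta -> 0 <= cutoff delta x.
Proof. by move=> d0; rewrite /cutoff; case: ifP => // /(le_lt_trans d0)/ltW. Qed.

Lemma measurable_window delta tau : measurable_fun setT (window delta tau).
Proof.
apply: measurable_fun_ifT => //; apply: measurable_and.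
- exact: measurable_fun_ltr.
- exact: measurable_fun_ler.
Qed.

Lemma measurable_cutoff delta : measurable_fun setT (cutoff delta).
Proof. by apply: measurable_fun_ifT => //; exact: measurable_fun_ltr. Qed.

Context (dO dE : measure_display) (Om : measurableType dO)
  (E : measurableType dE) (P : probability Om R) (m : {measure set E -> \bar R})
  (pt : nat -> Om -> E).

Lemma count_counting B w : count R pt B w = counting [set i | B (pt i w)].
Proof.
rewrite counting_dirac /count; apply: eq_eseriesr => i _.
by rewrite /dirac !indicE; congr (_%:R%:E); congr nat_of_bool; apply/idP/idP; rewrite !inE.
Qed.

Lemma count_finite B w : (count R pt B w < +oo)%E -> finite_set [set i | B (pt i w)].
Proof. by rewrite count_counting /counting; case: ifPn => // /asboolP. Qed.

Lemma count_finiteE B w :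
  (count R pt B w < +oo)%E <-> finite_set [set i | B (pt i w)].
Proof.
split; first exact: count_finite.
by rewrite count_counting /counting => h; rewrite asboolT// ltry.
Qed.

Lemma count_eq0 B w : count R pt B w = 0%E <-> forall i, ~ B (pt i w).
Proof.
split => [c0 i Bi|h]; last first.
  by apply: eseries0 => i _ _; rewrite /dirac indicE memNset.
have : (\d_(pt i w) B <= count R pt B w)%E.
  rewrite /count (@nneseriesD1 _ _ i)//; apply: leeDl; exact: nneseries_ge0.
by rewrite c0 /dirac indicE mem_set// lee_fin ler10.
Qed.

Lemma count_le1 B w : count R pt B w = 0%E \/ count R pt B w = 1%E ->
  forall i k, B (pt i w) -> B (pt k w) -> i = k.
Proof.
move=> h i k Bi Bk; apply/eqP; apply/negP => /negP ik.
have : (\d_(pt i w) B + \d_(pt k w) B <= count R pt B w)%E.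
  rewrite /count (@nneseriesD1 _ _ i)//; apply: leeD => //.
  rewrite (@nneseriesD1 _ _ k)//; last by rewrite eq_sym.
  by apply: leeDl; exact: nneseries_ge0.
rewrite /dirac !indicE !mem_set//= -EFinD mulr1n.
by case: h => ->; rewrite lee_fin => h; lra.
Qed.

Variable a : E -> R.

(** With infinitely many terms above a positive [delta] the value is 0 by convention; under a
    Poisson measure this event is null as soon as the tail of [a] beyond [delta] is finite. *)
Definition jump_sum (delta : R) (w : Om) : R :=
  \sum_(i \in [set i | delta < `|a (pt i w)|]) a (pt i w).

Lemma fine_psum_finite (f : E -> R) J w : (forall z, 0 <= f z) ->
  finite_set J -> (forall i, ~ J i -> f (pt i w) = 0) ->
  fine (psum pt (EFin \o f) w) = \sum_(i \in J) f (pt i w).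
Proof.
move=> f0 fJ fN; rewrite /psum nneseries_esumT; last by move=> i; rewrite lee_fin.
have -> : (\esum_(i in [set: nat]) (EFin \o f) (pt i w) =
    \esum_(i in J) (f (pt i w))%:E)%E.
  rewrite [RHS]esum_mkcond; apply: eq_esum => i _ /=; case: ifPn => //.
  by rewrite notin_setE => /fN ->.
by rewrite esum_fset// ?fsumEFin// => i _; rewrite lee_fin.
Qed.

(** Only the terms with modulus between [delta] and [tau] survive in the difference; they are
    regrouped by sign. *)
Lemma jump_sumD delta tau w : 0 < delta -> delta < tau ->
  finite_set [set i | delta < `|a (pt i w)|] ->
  jump_sum delta w - jump_sum tau w =
  fine (psum pt (EFin \o (window delta tau \o a)) w) -
  fine (psum pt (EFin \o (window delta tau \o (fun z => - a z))) w).
Proof.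
move=> d0 dt fJ; rewrite (fine_psum_finite _ fJ); last 2 first.
- by move=> z; rewrite /= window_ge0// ltW.
- move=> i /= /negP; rewrite -leNgt /window => h; case: ifP => // /andP[h1 _].
  by have := lt_le_trans h1 (ler_norm _); rewrite ltNge h.
rewrite (fine_psum_finite _ fJ); last 2 first.
- by move=> z; rewrite /= window_ge0// ltW.
- move=> i /= /negP; rewrite -leNgt /window => h; case: ifP => // /andP[h1 _].
  by have := lt_le_trans h1 (ler_norm _); rewrite normrN ltNge h.
have -> : jump_sum tau w = \sum_(i \in [set i | delta < `|a (pt i w)|])
    (if tau < `|a (pt i w)| then a (pt i w) else 0).
  rewrite /jump_sum (_ : [set i | tau < `|a (pt i w)|] =
    [set i | delta < `|a (pt i w)|] `&` [set i | tau < `|a (pt i w)|]).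
    rewrite fsbig_mkcondr; apply: eq_fsbigr => i _.
    by congr (if _ then _ else _); apply/idP/idP; rewrite inE.
  by apply/seteqP; split => i /=; [move=> h; split => //; exact: lt_trans h|case].
rewrite /jump_sum !fsbig_finite//= -!sumrB; apply: eq_big_seq => i.
rewrite in_fset_set// inE/= /window.
have [a0|a0] := leP 0 (a (pt i w)).
  rewrite ger0_norm// => ->/=; rewrite ltNge.
  have -> : (delta < - a (pt i w)) = false.
    by apply/negbTE; rewrite -leNgt (@le_trans _ _ 0)// ?oppr_le0// ltW.
  by case: leP => _ /=; rewrite !subr0 ?subrr.
rewrite ltr0_norm// => -> /=; rewrite ltNge.
have -> : (delta < a (pt i w)) = false.
  by apply/negbTE; rewrite -leNgt (@le_trans _ _ 0)// ltW.
by case: leP => _ /=; rewrite ?subr0 ?sub0r ?opprK ?subrr.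
Qed.

Lemma jump_sumE delta w : 0 < delta ->
  finite_set [set i | delta < `|a (pt i w)|] ->
  jump_sum delta w =
  fine (psum pt (EFin \o (cutoff delta \o a)) w) -
  fine (psum pt (EFin \o (cutoff delta \o (fun z => - a z))) w).
Proof.
move=> d0 fJ; rewrite (fine_psum_finite _ fJ); last 2 first.
- by move=> z; rewrite /= cutoff_ge0// ltW.
- move=> i /= /negP; rewrite -leNgt /cutoff => h; case: ifP => // h1.
  by have := lt_le_trans h1 (ler_norm _); rewrite ltNge h.
rewrite (fine_psum_finite _ fJ); last 2 first.
- by move=> z; rewrite /= cutoff_ge0// ltW.
- move=> i /= /negP; rewrite -leNgt /cutoff => h; case: ifP => // h1.
  by have := lt_le_trans h1 (ler_norm _); rewrite normrN ltNge h.
rewrite /jump_sum !fsbig_finite//= -!sumrB; apply: eq_big_seq => i.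
rewrite in_fset_set// inE/= /cutoff.
have [a0|a0] := leP 0 (a (pt i w)).
  rewrite ger0_norm// => ->/=.
  have -> : (delta < - a (pt i w)) = false.
    by apply/negbTE; rewrite -leNgt (@le_trans _ _ 0)// ?oppr_le0// ltW.
  by rewrite subr0.
rewrite ltr0_norm// => -> /=.
have -> : (delta < a (pt i w)) = false.
  by apply/negbTE; rewrite -leNgt (@le_trans _ _ 0)// ltW.
by rewrite sub0r opprK.
Qed.

Hypothesis prm : Poisson_random_measure P m pt.
Hypothesis ma : measurable_fun setT a.

Lemma measurable_abs_gt (delta : R) : measurable [set z | delta < `|a z|].
Proof.
have mabs : measurable_fun setT (fun z => `|a z|) by exact: measurableT_comp.
rewrite -[X in measurable X]setTI.
have -> : [set z | delta < `|a z|] = (fun z => `|a z|) @^-1` `]delta, +oo[%classic.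
  by apply/seteqP; split => z /=; rewrite in_itv/= andbT.
exact: mabs.
Qed.

Lemma measurable_jump_sum (delta : R) : 0 < delta -> measurable_fun setT (jump_sum delta).
Proof.
move=> d0.
have mN : measurable_fun setT (fun z => - a z) by exact: measurableT_comp.
have mc (b : E -> R) : measurable_fun setT b ->
    measurable_fun setT (fun w => fine (psum pt (EFin \o (cutoff delta \o b)) w)).
  move=> mb; apply: (measurable_fine_psum prm).
    by apply: measurableT_comp => //; exact: measurable_cutoff.
  by move=> z; rewrite /= cutoff_ge0// ltW.
(* Measurability requires a formula valid at every point, so the default value 0 on infinite index
   sets becomes a case distinction on a measurable count. *)
rewrite (_ : jump_sum delta = fun w =>
    if (count R pt [set z | (delta < `|a z|)%R] w < +oo)%E then
      fine (psum pt (EFin \o (cutoff delta \o a)) w) -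
      fine (psum pt (EFin \o (cutoff delta \o (fun z => - a z))) w)
    else 0); last first.
  apply/funext => w; case: ifPn => [/count_finite|].
    exact: jump_sumE.
  move=> /negP; rewrite count_finiteE => infJ.
  apply: fsbig_dflt => /=; rewrite setIidl// => i /= h; apply/eqP.
  by rewrite -normr_gt0 (lt_trans d0).
apply: measurable_fun_ifT => //; last by apply: measurable_funB; exact: mc.
apply: measurable_fun_lte => //; apply: (measurable_count prm).
exact: measurable_abs_gt.
Qed.

End JumpSums.

(** * Integrals determined or bounded by tails *)

Section TailIntegrals.
Context (R : realType) (dE : measure_display) (E : measurableType dE)
  (m : {measure set E -> \bar R}).

Lemma measurable_gt (f : E -> R) (x : R) : measurable_fun setT f ->
  measurable [set z | x < f z].
Proof.
move=> mf; rewrite -[X in measurable X]setTI.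
have -> : [set z | x < f z] = f @^-1` `]x, +oo[%classic.
  by apply/seteqP; split => z /=; rewrite in_itv/= andbT.
exact: mf.
Qed.

Section equal_tails.
Variables f g : E -> R.
Hypotheses (mf : measurable_fun setT f) (mg : measurable_fun setT g)
  (f0 : forall z, 0 <= f z) (g0 : forall z, 0 <= g z)
  (fg : forall x : R, 0 <= x -> m [set z | x < f z] = m [set z | x < g z])
  (ffin : (m [set z | (0 < f z)%R] < +oo)%E).

(** The image is taken after restriction to the points where [h] is positive: the set where [h]
    vanishes may have infinite mass but contributes nothing to the integral, and what remains has
    finite mass by [ffin] and the equality of tails at 0. *)
Let law (h : E -> R) (mh : measurable_fun setT h) : {measure set R -> \bar R} :=
  image_measure (mrestr m (measurable_gt 0 mh)) mh.

Let law_ray (h : E -> R) (mh : measurable_fun setT h) x :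
  law mh `]x, +oo[%classic = m [set z | Num.max x 0 < h z].
Proof.
rewrite /law /image_measure/= /pushforward /mrestr; congr (m _).
apply/seteqP; split => z /=; rewrite in_itv/= andbT gt_max; last by move=> /andP[].
by move=> [-> ->].
Qed.

Let integral_law (h : E -> R) (mh : measurable_fun setT h) :
  (forall z, 0 <= h z) ->
  (\int[m]_z (h z)%:E = \int[law mh]_x `|x|%:E)%E.
Proof.
move=> h0; transitivity (\int[mrestr m (measurable_gt 0 mh)]_z `|h z|%:E)%E; last first.
  apply/esym/(integral_image_measure (mrestr m (measurable_gt 0 mh)) mh
    (g := fun x => `|x|%:E)) => [|y]; last by rewrite lee_fin.
  exact/measurable_EFinP.
rewrite [RHS](eq_integral (fun z => (h z)%:E)); last first.
  by move=> z _; rewrite ger0_norm.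
apply: (integral_support (D := [set z | 0 < h z])) => [z /= /negP|A mA AD].
  by rewrite -leNgt => hz; congr EFin; apply/eqP; rewrite eq_le hz h0.
suff : m A = mrestr m (measurable_gt 0 mh) A by [].
by rewrite /mrestr setIidl.
Qed.

(** Open half-lines generate the Borel sets and are stable under intersection, so equal tails force
    equal laws. *)
Lemma integral_eq_tail : (\int[m]_z (f z)%:E = \int[m]_z (g z)%:E)%E.
Proof.
rewrite !integral_law//; apply: eq_measure_integral => A mA _.
apply: (measure_unique (@RGenOInfty.G R) (fun n => `]- n%:R, +oo[%classic)) => //.
- exact: RGenOInfty.measurableE.
- move=> _ _ [x ->] [y ->]; exists (Num.max x y).
  apply/seteqP; split => z /=; rewrite !in_itv/= !andbT gt_max.
    by move=> [-> ->].
  by move=> /andP[].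
- by move=> i; exists (- i%:R).
- apply/seteqP; split => // x _; exists (Num.bound `|x|) => //=.
  rewrite in_itv/= andbT ltrNl.
  by rewrite (le_lt_trans _ (archi_boundP (normr_ge0 x)))// -normrN ler_norm.
- move=> _ [x ->]; etransitivity; first exact: law_ray.
  by rewrite fg ?le_max ?lexx ?orbT//; exact/esym/law_ray.
- move=> k; rewrite (le_lt_trans _ ffin)//.
  have /= -> := law_ray mf (- k%:R).
  by rewrite max_r// oppr_le0.
Qed.

End equal_tails.

Lemma powR_half (alpha tau : R) : 0 < tau ->
  (tau / 2) `^ (2 - alpha) = tau `^ (2 - alpha) * 2 `^ (alpha - 2).
Proof.
move=> t0; rewrite powRM ?ltW//; congr (_ * _).
by rewrite -powR_inv1// -powRrM mulN1r opprB.
Qed.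

(* Dyadic induction on tau: adding the shell tau / 2 < b <= tau, of measure at most
   c (tau / 2)^(-alpha), reproduces the bound. *)
Lemma window_second_moment (alpha c delta tau : R) (b : E -> R) :
  0 < alpha < 2 -> 0 <= c -> 0 < delta -> 0 < tau ->
  measurable_fun setT b ->
  (forall x : R, 0 < x -> (m [set z | (x < b z)%R] <= (c * x `^ (- alpha))%:E)%E) ->
  (\int[m]_z (window delta tau (b z) ^+ 2)%:E <=
   (c * (2 `^ alpha / (1 - 2 `^ (alpha - 2))) * tau `^ (2 - alpha))%:E)%E.
Proof.
move=> /andP[al0 al2] c0 d0 t0 mb tail; set C : R := (2 `^ alpha / _).
have q1 : 2 `^ (alpha - 2) < 1 :> R.
  by rewrite /powR pnatr_eq0/= expR_lt1 pmulr_llt0 ?subr_lt0// ln_gt0// ltr1n.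
have C0 : 0 < C by rewrite divr_gt0 ?powR_gt0// subr_gt0.
(* This fixed-point equation defines [C]: one halving of [tau] multiplies the old bound by the first
   factor, and the new shell contributes the second summand. *)
have CE : C * 2 `^ (alpha - 2) + 2 `^ alpha = C.
  rewrite -[X in _ + X](divfK (_ : 1 - 2 `^ (alpha - 2) != 0 :> R)) -/C; last first.
    by rewrite subr_eq0 gt_eqF.
  by rewrite -mulrDr addrC subrK mulr1.
(* The induction runs on the number of halvings that bring [tau] below [delta], where the window is
   empty. The bound does not depend on this number. *)
have [n] : exists n, tau <= 2 ^+ n * delta.
  exists (Num.bound (tau / delta)); rewrite -ler_pdivrMr//.
  apply/ltW/(lt_le_trans (archi_boundP _)); first by rewrite divr_ge0 ?ltW.
  by rewrite -natrX ler_nat ltnW// ltn_expl.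
elim: n tau t0 => [|n IH] tau t0.
  rewrite expr0 mul1r => td; rewrite integral0_eq ?lee_fin.
    by rewrite mulr_ge0 ?powR_ge0// mulr_ge0// ltW.
  move=> z _; rewrite /window; case: ifP => [/andP[h1 h2]|_]; last by rewrite expr0n.
  by have := lt_le_trans h1 (le_trans h2 td); rewrite ltxx.
move=> td.
have t20 : 0 < tau / 2 by rewrite divr_gt0.
have mw (t : R) : measurable_fun setT (fun z => (window delta t (b z) ^+ 2)%:E).
  apply/measurable_EFinP/measurable_funX; apply: measurableT_comp => //.
  exact: measurable_window.
have mgt := measurable_gt (tau / 2) mb.
have mind : measurable_fun setT (fun z => (\1_[set z | (tau / 2 < b z)%R] z)%:E : \bar R).
  exact/measurable_EFinP/measurable_indic.
apply: (@le_trans _ _ (\int[m]_z ((window delta (tau / 2) (b z) ^+ 2)%:E +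
    (tau ^+ 2)%:E * (\1_[set z | (tau / 2 < b z)%R] z)%:E))%E).
  apply: ge0_le_integral => //.
  - by move=> z _; rewrite lee_fin sqr_ge0.
  - by apply: emeasurable_funD => //; exact: measurable_funeM.
  - move=> z _; rewrite -EFinM -EFinD lee_fin /window.
    have [bz|bz] := leP (b z) (tau / 2).
      have bt : b z <= tau by rewrite (le_trans bz)// ler_pdivrMr// ler_peMr ?ler1n// ltW.
      by rewrite bt !andbT lerDl mulr_ge0 ?sqr_ge0.
    rewrite andbF expr0n/= add0r indicE mem_set// mulr1.
    case: ifP => [/andP[db bt]|_]; last by rewrite expr0n sqr_ge0.
    by rewrite lerXn2r// nnegrE ltW// (lt_trans d0).
rewrite ge0_integralD//; last 3 first.
- by move=> z _; rewrite lee_fin sqr_ge0.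
- by move=> z _; rewrite -EFinM lee_fin mulr_ge0 ?sqr_ge0.
- exact: measurable_funeM.
rewrite ge0_integralZl//; last by rewrite lee_fin sqr_ge0.
rewrite integral_indic// setIT.
apply: (@le_trans _ _ ((c * C * (tau / 2) `^ (2 - alpha))%:E +
    (tau ^+ 2)%:E * (c * (tau / 2) `^ (- alpha))%:E)%E).
  apply: leeD.
    by apply: IH => //; rewrite ler_pdivrMr// mulrAC -exprSr.
  by rewrite lee_pmul2l// ?lte_fin ?exprn_gt0// tail.
rewrite -EFinM -EFinD lee_fin powR_half//.
have -> : (tau / 2) `^ (- alpha) = tau `^ (2 - alpha) * 2 `^ alpha / tau ^+ 2.
  rewrite powRM ?ltW// ?invr_ge0// powRB//; last by rewrite (gt_eqF t0) implybT.
  rewrite -(powR_mulrn 2 (ltW t0)) -powR_inv1// -powRrM mulN1r opprK powRN.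
  have : tau `^ 2 != 0 by rewrite gt_eqF// powR_gt0.
  have : tau `^ alpha != 0 by rewrite gt_eqF// powR_gt0.
  move: (tau `^ 2) (tau `^ alpha) (2 `^ alpha) => x y w y0 x0.
  by field; rewrite x0 y0.
have s0 : tau ^+ 2 != 0 by rewrite expf_neq0// gt_eqF.
rewrite le_eqVlt; apply/orP; left; apply/eqP.
rewrite -[in RHS]CE; clearbody C; clear -s0.
move: (tau ^+ 2) s0 (tau `^ _) (2 `^ alpha) (2 `^ _) C => s s0 T p q C'.
by field.
Qed.

End TailIntegrals.

Section MeasureBounds.
Context d (T : measurableType d) (R : realType) (mu : {measure set T -> \bar R}).

Lemma measure_mono (A B : set T) : measurable A -> measurable B ->
  A `<=` B -> (mu A <= mu B)%E.
Proof. by move=> mA mB; apply: le_measure; rewrite inE. Qed.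

Lemma measureU2_le (A B : set T) (x y : \bar R) :
  measurable A -> measurable B -> (mu A <= x)%E -> (mu B <= y)%E ->
  (mu (A `|` B) <= x + y)%E.
Proof. by move=> mA mB Ax By; apply: (le_trans (measureU2 _ mA mB)); exact: leeD. Qed.

End MeasureBounds.

(** * The contribution of the small jumps *)

Section Residual.
Context (R : realType) (dO dE : measure_display) (Om : measurableType dO)
  (E : measurableType dE) (P : probability Om R) (m : {measure set E -> \bar R})
  (pt : nat -> Om -> E).
Hypothesis prm : Poisson_random_measure P m pt.
Variables (alpha c : R) (a : E -> R).
Hypotheses (alpha02 : 0 < alpha < 2) (c0 : 0 <= c) (ma : measurable_fun setT a)
  (tailp : forall x : R, 0 < x -> m [set z | x < a z] = (c * x `^ (- alpha))%:E)
  (tailn : forall x : R, 0 < x -> m [set z | x < - a z] = (c * x `^ (- alpha))%:E).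

Let mN : measurable_fun setT (fun z => - a z).
Proof. exact: measurableT_comp. Qed.

Lemma abs_tail_le (x : R) : 0 < x ->
  (m [set z | (x < `|a z|)%R] <= (2 * c * x `^ (- alpha))%:E)%E.
Proof.
move=> x0; have -> : [set z | x < `|a z|] = [set z | x < a z] `|` [set z | x < - a z].
  apply/seteqP; split => z /=; rewrite lter_normr; first by move=> /orP.
  by move=> h; apply/orP.
rewrite -mulrA mulr_natl mulr2n EFinD.
by apply: measureU2_le; rewrite ?tailp ?tailn//; exact: measurable_gt.
Qed.

Lemma abs_tail_fin (x : R) : 0 < x -> (m [set z | (x < `|a z|)%R] < +oo)%E.
Proof. by move=> x0; rewrite (le_lt_trans (abs_tail_le x0))// ltry. Qed.

(** The tail of a truncation is a difference of two tails of [b], so it depends on [c] and [alpha]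
    alone; this gives [a] and [- a] windows of equal mean. *)
Let window_tail (b : E -> R) (delta tau x : R) : measurable_fun setT b ->
  (forall x : R, 0 < x -> m [set z | x < b z] = (c * x `^ (- alpha))%:E) ->
  0 < delta -> 0 <= x ->
  m [set z | x < window delta tau (b z)] =
  ((c * Num.max x delta `^ (- alpha))%:E -
   (c * Num.max (Num.max x delta) tau `^ (- alpha))%:E)%E.
Proof.
move=> mb tb d0 x0.
have M0 : 0 < Num.max x delta by rewrite lt_max d0 orbT.
have -> : [set z | x < window delta tau (b z)] =
    [set z | Num.max x delta < b z] `\` [set z | tau < b z].
  apply/seteqP; split => z /=; rewrite /window gt_max.
    case: ifP => [/andP[-> bt] -> |_]; last by move=> /(le_lt_trans x0); rewrite ltxx.
    by split => //; apply/negP; rewrite -leNgt.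
  by move=> [/andP[xb db] /negP]; rewrite -leNgt => bt; rewrite db bt.
have fin : (m [set z | (Num.max x delta < b z)%R] < +oo)%E by rewrite tb// ltry.
have -> : m ([set z | Num.max x delta < b z] `\` [set z | tau < b z]) =
    (m [set z | (Num.max x delta < b z)%R] -
     m ([set z | (Num.max x delta < b z)%R] `&` [set z | (tau < b z)%R]))%E.
  by apply: measureD => //; exact: measurable_gt.
rewrite tb// (_ : _ `&` _ = [set z | Num.max (Num.max x delta) tau < b z]).
  by rewrite tb// lt_max M0.
apply/seteqP; split => z /=; rewrite (gt_max _ _ tau); first by move=> [-> ->].
by move=> /andP[].
Qed.

Let window_eq (delta tau : R) : 0 < delta ->
  (\int[m]_z (window delta tau (a z))%:E =
   \int[m]_z (window delta tau (- a z))%:E)%E.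
Proof.
move=> d0; apply: integral_eq_tail.
- by apply: measurableT_comp => //; exact: measurable_window.
- by apply: measurableT_comp => //; exact: measurable_window.
- by move=> z; rewrite window_ge0// ltW.
- by move=> z; rewrite window_ge0// ltW.
- by move=> x x0; rewrite !window_tail.
- by rewrite window_tail// -EFinB ltry.
Qed.

Let window_fin (b : E -> R) (delta tau : R) : measurable_fun setT b ->
  (forall z, `|b z| = `|a z|) -> 0 < delta -> 0 < tau ->
  (\int[m]_z (window delta tau (b z))%:E < +oo)%E.
Proof.
move=> mb ba d0 t0.
have mD := measurable_abs_gt ma delta.
apply: (@le_lt_trans _ _ (\int[m]_z (tau%:E * (\1_[set z | (delta < `|a z|)%R] z)%:E))%E).
  apply: ge0_le_integral => //.
  - by move=> z _; rewrite lee_fin window_ge0// ltW.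
  - apply/measurable_EFinP; apply: measurableT_comp => //.
    exact: measurable_window.
  - by apply: measurable_funeM; exact/measurable_EFinP/measurable_indic.
  - move=> z _; rewrite -EFinM lee_fin /window; case: ifP => [/andP[h1 h2]|_].
      by rewrite indicE mem_set ?mulr1// /= -ba (lt_le_trans h1)// ler_norm.
    by rewrite mulr_ge0// ltW.
rewrite ge0_integralZl//; last 2 first.
- exact/measurable_EFinP/measurable_indic.
- by rewrite lee_fin ltW.
rewrite integral_indic// setIT lte_mul_pinfty ?lee_fin// ?ltW//.
exact: abs_tail_fin.
Qed.

(* 32 = 2 * 4 ^ 2: Chebyshev at level eps / 4, for each sign of the jumps; the other
   factor comes from [window_second_moment]. *)
Definition residual_const : R := 32 * (2 `^ alpha / (1 - 2 `^ (alpha - 2))).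

Lemma residual_const_ge0 : 0 <= residual_const.
Proof.
have /andP[_ al2] := alpha02.
rewrite mulr_ge0// divr_ge0 ?powR_ge0// subr_ge0 ltW//.
by rewrite /powR pnatr_eq0/= expR_lt1 pmulr_llt0 ?subr_lt0// ln_gt0// ltr1n.
Qed.

Let window_dev (b : E -> R) (delta tau eps : R) : measurable_fun setT b ->
  (forall z, `|b z| = `|a z|) ->
  (forall x : R, 0 < x -> m [set z | x < b z] = (c * x `^ (- alpha))%:E) ->
  0 < delta -> 0 < tau -> 0 < eps ->
  (P [set w | (eps / 4 <= `|fine (psum pt (EFin \o (window delta tau \o b)) w) -
                    fine (\int[m]_z (window delta tau (b z))%:E)|)%R] <=
  (residual_const / 2 * c * tau `^ (2 - alpha) / eps ^+ 2)%:E)%E.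
Proof.
move=> mb ba tb d0 t0 e0.
have mD := measurable_abs_gt ma delta.
have e40 : 0 < eps / 4 by rewrite divr_gt0.
have mw : measurable_fun setT (window delta tau \o b).
  by apply: measurableT_comp => //; exact: measurable_window.
apply: (le_trans (psum_chebyshev prm mD (abs_tail_fin d0) mw _ _ _ e40)).
- by move=> z; rewrite /= window_ge0// ltW.
- move=> z /= /negP; rewrite -leNgt -ba => h; rewrite /window; case: ifP => // /andP[h1 _].
  by have := lt_le_trans h1 (ler_norm _); rewrite ltNge h.
- exact: window_fin.
apply: (@le_trans _ _ (((eps / 4) ^- 2)%:E *
    (c * (2 `^ alpha / (1 - 2 `^ (alpha - 2))) * tau `^ (2 - alpha))%:E)%E).
  rewrite lee_pmul2l// ?lte_fin ?invr_gt0 ?exprn_gt0//.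
  by apply: window_second_moment => // x x0; rewrite tb.
rewrite -EFinM lee_fin /residual_const le_eqVlt; apply/orP; left; apply/eqP.
move: (2 `^ alpha / _) (tau `^ _) => C T.
by field; rewrite gt_eqF.
Qed.

Variable Y : Om -> R.
Hypotheses (mY : measurable_fun setT Y)
  (aY : sum_in_probability P (fun i w => a (pt i w)) Y).

Let mabs (f : Om -> R) (x : R) : measurable_fun setT f -> measurable [set w | x < `|f w|].
Proof. by move=> mf; apply: measurable_gt; exact: measurableT_comp. Qed.

Let mabsle (f : Om -> R) (x : R) : measurable_fun setT f -> measurable [set w | x <= `|f w|].
Proof.
move=> mf; rewrite -[X in measurable X]setTI.
have mabs' : measurable_fun setT (fun z => `|f z|) by exact: measurableT_comp.
have -> : [set z | x <= `|f z|] = (fun z => `|f z|) @^-1` `[x, +oo[%classic.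
  by apply/seteqP; split => z /=; rewrite in_itv/= andbT.
exact: mabs'.
Qed.

(* a and - a have the same tails, so the positive and negative parts of the small
   jumps have equal means, and no centering remains. *)
Lemma residual_bound (tau eps : R) : 0 < tau -> 0 < eps ->
  (P [set w | (eps < `|Y w - jump_sum pt a tau w|)%R] <=
  (residual_const * c * tau `^ (2 - alpha) / eps ^+ 2)%:E)%E.
Proof.
move=> t0 e0; apply/lee_addgt0Pr => eta eta0.
have e20 : 0 < eps / 2 by rewrite divr_gt0.
have /fine_cvgP[_ ] := aY e20.
move=> /cvgrPdist_lt/(_ _ eta0) near_eta.
(* Half of [eps] is spent on replacing [Y] by the sum above [delta], at the cost of probability
   [eta]; the other half is shared by the two signs of the jumps between [delta] and [tau]. *)
have [delta [d0 dt dP]] : exists delta, [/\ 0 < delta, delta < tau &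
   (P [set w | (eps / 2 < `|jump_sum pt a delta w - Y w|)%R] <= eta%:E)%E].
  have [delta [[h1 h2] h3]] : exists delta, (0 < delta /\ delta < tau) /\
      `|0 - (fine \o (fun delta => P [set w | eps / 2 <
      `|(\sum_(i \in [set i : nat | delta < `|a (pt i w)|]) a (pt i w)) - Y w|])) delta| < eta.
    near (0 : R)^'+ => delta; exists delta; split; last by near: delta.
    split; first by [].
    by near: delta; exact: nbhs_right_lt.
  exists delta; split => //.
  rewrite -[leLHS]fineK ?fin_num_measure//; last first.
    by apply: mabs; apply: measurable_funB => //; exact: (measurable_jump_sum prm).
  rewrite lee_fin ltW//; move: h3; rewrite sub0r normrN => h3.
  by apply: le_lt_trans h3; exact: ler_norm.
have mD := measurable_abs_gt ma delta.
have fD := abs_tail_fin d0.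
pose Z := count R pt [set z | delta < `|a z|].
have mZ : measurable_fun setT Z by exact: (measurable_count prm).
(* The null event that infinitely many terms exceed [delta]; off it the difference of the two jump
   sums can be computed. *)
pose Inf := ~` \bigcup_(k in [set: nat]) [set w | Z w = k%:R%:E].
have Inf0 : (P Inf <= 0)%E by rewrite (natural_ae mZ (count_pmf_sum prm mD fD)).
have mInf : measurable Inf.
  by apply: measurableC; apply: bigcupT_measurable => k; exact: (measurable_value mZ).
have mJ (t : R) : 0 < t -> measurable_fun setT (jump_sum pt a t).
  by move=> ?; exact: (measurable_jump_sum prm).
have ma' (b : E -> R) : measurable_fun setT b ->
    measurable_fun setT (fun w => fine (psum pt (EFin \o (window delta tau \o b)) w)).
  move=> mb; apply: (measurable_fine_psum prm).
    by apply: measurableT_comp => //; exact: measurable_window.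
  by move=> z; rewrite /= window_ge0// ltW.
pose mu := fine (\int[m]_z (window delta tau (a z))%:E)%E.
pose A1 := [set w | eps / 2 < `|jump_sum pt a delta w - Y w|].
pose A2 := [set w | eps / 4 <= `|fine (psum pt (EFin \o (window delta tau \o a)) w) - mu|].
pose A3 := [set w | eps / 4 <=
  `|fine (psum pt (EFin \o (window delta tau \o (fun z => - a z))) w) - mu|].
have mA1 : measurable A1 by apply: mabs; apply: measurable_funB => //; exact: mJ.
have mA2 : measurable A2 by apply: mabsle; apply: measurable_funB => //; exact: ma'.
have mA3 : measurable A3 by apply: mabsle; apply: measurable_funB => //; exact: ma'.
have sub : [set w | eps < `|Y w - jump_sum pt a tau w|] `<=`
    (A1 `|` Inf) `|` (A2 `|` A3).
  move=> w /= hw; apply: contrapT => /not_orP[/not_orP[nA1 nInf] /not_orP[nA2 nA3]].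
  have {}nInf : (Z w < +oo)%E.
    by move/contrapT : nInf => -[k _ /= ->]; rewrite ltry.
  have := jump_sumD d0 dt (count_finite nInf).
  move: nA1 nA2 nA3; rewrite /A1 /A2 /A3 /= => /negP + /negP + /negP.
  rewrite -leNgt -!ltNge.
  move: (fine _) (fine _) (jump_sum pt a delta w) (jump_sum pt a tau w) (Y w) hw => xp xn jd jt y.
  rewrite !ltr_norml !ler_norml lter_normr => /orP[h|h] /andP[h1 h2] /andP[h3 h4] /andP[h5 h6] h7; lra.
have mL : measurable [set w | eps < `|Y w - jump_sum pt a tau w|].
  by apply: mabs; apply: measurable_funB => //; exact: mJ.
apply: (@le_trans _ _ (P ((A1 `|` Inf) `|` (A2 `|` A3)))).
  by apply: measure_mono => //; do ! apply: measurableU.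
rewrite addeC; apply: measureU2_le; [exact: measurableU|exact: measurableU| |].
  by rewrite -[leRHS]adde0; exact: measureU2_le.
have -> : residual_const * c * tau `^ (2 - alpha) / eps ^+ 2 =
    residual_const / 2 * c * tau `^ (2 - alpha) / eps ^+ 2 +
    residual_const / 2 * c * tau `^ (2 - alpha) / eps ^+ 2.
  by field; rewrite gt_eqF.
rewrite EFinD; apply: measureU2_le => //; first exact: window_dev.
rewrite /A3 /mu window_eq//; apply: window_dev => // z.
by rewrite normrN.
Unshelve. all: by end_near.
Qed.

End Residual.

Section FiniteUnions.
Context (I : eqType) (T : Type).
Implicit Types (s : seq I) (Q : I -> set T).

Definition some_in s Q : set T := [set z | exists2 i, i \in s & Q i z].

Lemma some_in_nil Q : some_in [::] Q = set0.
Proof. by apply/seteqP; split => // z []. Qed.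

Lemma some_in_cons i s Q : some_in (i :: s) Q = Q i `|` some_in s Q.
Proof.
apply/seteqP; split => z /=.
  by move=> [k]; rewrite inE => /predU1P[->|ks] Qk; [left|right; exists k].
by move=> [Qi|[k ks Qk]]; [exists i; rewrite ?mem_head|exists k; rewrite // inE ks orbT].
Qed.

End FiniteUnions.

Section FiniteUnionMeasure.
Context (I : eqType) d (T : measurableType d) (R : realType)
  (mu : {measure set T -> \bar R}).
Implicit Types (s : seq I) (Q : I -> set T).

Lemma measurable_some_in s Q : (forall i, measurable (Q i)) -> measurable (some_in s Q).
Proof.
move=> mQ; elim: s => [|i s IH]; first by rewrite some_in_nil.
by rewrite some_in_cons; exact: measurableU.
Qed.

Lemma measure_some_in_le s Q (x : R) : (forall i, measurable (Q i)) ->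
  (forall i, i \in s -> (mu (Q i) <= x%:E)%E) ->
  (mu (some_in s Q) <= ((size s)%:R * x)%:E)%E.
Proof.
move=> mQ; elim: s => [|i s IH] Qx; first by rewrite some_in_nil measure0 mul0r.
rewrite some_in_cons/= -natr1 mulrDl mul1r addrC EFinD; apply: measureU2_le => //.
- exact: measurable_some_in.
- by apply: Qx; rewrite mem_head.
- by apply: IH => k ks; apply: Qx; rewrite inE ks orbT.
Qed.

End FiniteUnionMeasure.

Section PoissonTails.
Context (R : realType) (dO dE : measure_display) (Om : measurableType dO)
  (E : measurableType dE) (P : probability Om R) (m : {measure set E -> \bar R})
  (pt : nat -> Om -> E).
Hypothesis prm : Poisson_random_measure P m pt.
Variables (B : set E) (mB : measurable B) (x : R) (mBx : m B = x%:E).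

Let x0 : 0 <= x.
Proof. by rewrite -lee_fin -mBx. Qed.

Let fB : (m B < +oo)%E.
Proof. by rewrite mBx ltry. Qed.

Definition hits := [set w | count R pt B w != 0%E].
Definition multihits := [set w | count R pt B w != 0%E /\ count R pt B w != 1%E].

Let mk k : measurable [set w | count R pt B w = k].
Proof. exact: (measurable_value (measurable_count prm mB)). Qed.

Let hitsE : hits = ~` [set w | count R pt B w = 0%E].
Proof. by apply/seteqP; split => w /= /eqP. Qed.

Let multihitsE : multihits =
  ~` ([set w | count R pt B w = 0%E] `|` [set w | count R pt B w = 1%E]).
Proof.
rewrite setCU; apply/seteqP; split => w /=; first by move=> [/eqP ? /eqP].
by move=> [/eqP ? /eqP ?].
Qed.

Lemma measurable_hits : measurable hits.
Proof. by rewrite hitsE; exact: measurableC. Qed.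

Lemma measurable_multihits : measurable multihits.
Proof. by rewrite multihitsE; apply: measurableC; exact: measurableU. Qed.

Let P0 : P [set w | count R pt B w = 0%E] = (expR (- x))%:E.
Proof.
have := count_pmf prm 0 mB fB; rewrite mBx /= => ->.
by rewrite /poisson_weight expr0 fact0 mulr1 divr1.
Qed.

Let P1 : P [set w | count R pt B w = 1%E] = (expR (- x) * x)%:E.
Proof.
have := count_pmf prm 1 mB fB; rewrite mBx /= => ->.
by rewrite /poisson_weight expr1 divr1.
Qed.

Let Phits : P hits = (1 - expR (- x))%:E.
Proof. by rewrite hitsE probability_setC// P0. Qed.

Lemma hits_le : (P hits <= x%:E)%E.
Proof.
rewrite Phits lee_fin; have := expR_ge1Dx (- x); lra.
Qed.

(** The quadratic loss is harmless, as [x] will be of order n^p / gamma_n^alpha, which tends to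
    0. *)
Lemma hits_ge : ((x - x ^+ 2)%:E <= P hits)%E.
Proof.
rewrite Phits lee_fin.
have h := expR_ge1Dx x.
have e0 := expR_gt0 x.
rewrite expRN.
have x1 : 0 < 1 + x by rewrite ltr_pwDl.
have : (expR x)^-1 <= (1 + x)^-1 by rewrite lef_pV2.
have : (1 + x)^-1 <= 1 - x + x ^+ 2.
  rewrite -[leLHS]mul1r ler_pdivrMr//.
  have -> : (1 - x + x ^+ 2) * (1 + x) = 1 + x ^+ 3 by ring.
  by rewrite lerDl exprn_ge0.
lra.
Qed.

(** The probability is 1 - exp(-x)(1 + x), and exp(-x) is at least 1 - x. *)
Lemma multihits_le : (P multihits <= (x ^+ 2)%:E)%E.
Proof.
rewrite multihitsE probability_setC; last exact: measurableU.
rewrite measureU//; last first.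
  apply/seteqP; split => // w [/= -> /eqP]; rewrite eqe.
  by rewrite eq_sym oner_eq0.
rewrite [X in (_ - (X + _))%E](_ : _ = (expR (- x))%:E)//.
rewrite [X in (_ - (_ + X))%E](_ : _ = (expR (- x) * x)%:E)//.
suff : 1 - (expR (- x) + expR (- x) * x) <= x ^+ 2.
  by rewrite -lee_fin EFinB EFinD.
have h := expR_ge1Dx (- x).
have : (1 + - x) * (1 + x) <= expR (- x) * (1 + x).
  by rewrite ler_wpM2r// addr_ge0.
have -> : (1 + - x) * (1 + x) = 1 - x ^+ 2 by ring.
rewrite mulrDr mulr1; lra.
Qed.

End PoissonTails.

(** * Comparison with a single large jump *)

Section OneBigJump.
Context (R : realType) (dO dE : measure_display) (Om : measurableType dO)
  (E : measurableType dE) (P : probability Om R) (m : {measure set E -> \bar R})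
  (pt : nat -> Om -> E).
Hypothesis prm : Poisson_random_measure P m pt.
Variables (alpha c : R) (I : eqType) (a : I -> E -> R) (Y : I -> Om -> R).
Hypotheses (alpha02 : 0 < alpha < 2) (c0 : 0 <= c)
  (ma : forall s, measurable_fun setT (a s))
  (tailp : forall s (x : R), 0 < x ->
    m [set z | x < a s z] = (c * x `^ (- alpha))%:E)
  (tailn : forall s (x : R), 0 < x ->
    m [set z | x < - a s z] = (c * x `^ (- alpha))%:E)
  (mY : forall s, measurable_fun setT (Y s))
  (aY : forall s, sum_in_probability P (fun i w => a s (pt i w)) (Y s)).
Variables (S : seq I) (tau eps : R).
Hypotheses (tau0 : 0 < tau) (eps0 : 0 < eps).

Definition exceed (T : Type) (f : I -> T -> R) (r : R) : set T :=
  some_in S (fun s => [set z | r < f s z]).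

Lemma measurable_exceed d (T : measurableType d) (f : I -> T -> R) r :
  (forall s, measurable_fun setT (f s)) -> measurable (exceed f r).
Proof. by move=> mf; apply: measurable_some_in => s; exact: measurable_gt. Qed.

Let big := exceed (fun s z => `|a s z|) tau.
Let mbig : measurable big.
Proof. by apply: measurable_exceed => s; exact: measurableT_comp. Qed.

Let bigle : (m big <= ((size S)%:R * (2 * c * tau `^ (- alpha)))%:E)%E.
Proof.
apply: measure_some_in_le => [s|s _].
  by apply: measurable_gt; exact: measurableT_comp.
exact: (abs_tail_le (ma s) (tailp s) (tailn s)).
Qed.

Let bigE : m big = (fine (m big))%:E.
Proof. by rewrite fineK// ge0_fin_numE// (le_lt_trans bigle)// ltry. Qed.

Let rest := some_in S (fun s => [set w | eps < `|Y s w - jump_sum pt (a s) tau w|]).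

Let mrest : measurable rest.
Proof.
apply: measurable_some_in => s; apply: measurable_gt.
apply: measurableT_comp => //; apply: measurable_funB => //.
exact: (measurable_jump_sum prm).
Qed.

(** The first term bounds the probability that two points have a term above [tau] at some index; it
    is the square of a union bound. The second is a union bound for the residuals. With [tau] equal
    to gamma_n theta and n^p indices, the first is of order (n^p / gamma_n^alpha)^2, hence
    negligible, while the second has the order of the main term but carries the factor theta^(2 -
    alpha). *)
Definition jump_error : R :=
  ((size S)%:R * (2 * c * tau `^ (- alpha))) ^+ 2 +
  (size S)%:R * (residual_const alpha * c * tau `^ (2 - alpha) / eps ^+ 2).

Let bad := multihits R pt big `|` rest.
Let mbad : measurable bad.
Proof. by apply: measurableU => //; exact: (measurable_multihits prm). Qed.

Let badle : (P bad <= jump_error%:E)%E.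
Proof.
rewrite /jump_error EFinD; apply: measureU2_le => //.
- exact: (measurable_multihits prm).
- apply: (le_trans (multihits_le prm mbig bigE)); rewrite lee_fin.
  rewrite lerXn2r// ?nnegrE ?fine_ge0//.
    by rewrite !mulr_ge0// powR_ge0.
  by rewrite -lee_fin -bigE.
- apply: measure_some_in_le => [s|s _].
    apply: measurable_gt.
    apply: measurableT_comp => //; apply: measurable_funB => //.
    exact: (measurable_jump_sum prm).
  exact: (residual_bound prm alpha02 c0 (ma s) (tailp s) (tailn s) (mY s) (aY s)).
Qed.

(** At most one point is large at any index of [S], so a large term is the whole jump sum. *)
Let single w s i : ~ multihits R pt big w -> s \in S -> tau < `|a s (pt i w)| ->
  jump_sum pt (a s) tau w = a s (pt i w).
Proof.
move=> nm sS ti; rewrite /jump_sum.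
have cnt : count R pt big w = 0%E \/ count R pt big w = 1%E.
  apply: contrapT => /not_orP[h1 h2]; apply: nm.
  by split; apply/eqP.
have -> : [set k | tau < `|a s (pt k w)|] = [set i].
  apply/seteqP; split => k /=; last by move=> ->.
  by move=> tk; apply: (count_le1 cnt); exists s.
by rewrite fsbig_set1.
Qed.

Let goodP w s : ~ bad w -> s \in S ->
  ~ multihits R pt big w /\ `|Y s w - jump_sum pt (a s) tau w| <= eps.
Proof.
move=> /not_orP[h1 h2] sS; split => //; rewrite leNgt; apply/negP => h.
by apply: h2; exists s.
Qed.

(** Off the bad event the jump sum exceeds [r - eps], which is nonnegative; the sum is therefore not
    empty and equals its only term. *)
Lemma exceed_upper (r : R) : eps <= r ->
  (P (exceed Y r) <= m (exceed a (r - eps)) + jump_error%:E)%E.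
Proof.
move=> er.
have mD : measurable (exceed a (r - eps)) by exact: measurable_exceed.
apply: (@le_trans _ _ (P (hits R pt (exceed a (r - eps)) `|` bad))).
  apply: measure_mono => //; first exact: measurable_exceed.
    by apply: measurableU => //; exact: (measurable_hits prm).
  move=> w [s sS rY]; have [bw|nbw] := pselect (bad w); first by right.
  left; have [nm Yj] := goodP nbw sS; apply/eqP => /count_eq0 nhit.
  have rj : r - eps < jump_sum pt (a s) tau w.
    by move: Yj rY => /=; rewrite ler_norml => /andP[_]; lra.
  have [[i ti]|none] := pselect (exists i, tau < `|a s (pt i w)|).
    by apply: (nhit i); exists s => //=; rewrite -(single nm sS ti).
  have : jump_sum pt (a s) tau w = 0.
    by rewrite /jump_sum fsbig1// => i ti; exfalso; apply: none; exists i.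
  by lra.
have [Dfin|] := boolP (m (exceed a (r - eps)) \is a fin_num); last first.
  by rewrite ge0_fin_numE// -leNgt leye_eq => /eqP ->; rewrite addye// leey.
apply: measureU2_le => //; first exact: (measurable_hits prm).
rewrite -(fineK Dfin); apply: (hits_le prm) => //.
by rewrite fineK.
Qed.

(** The condition on [tau] makes a term above [r + eps] large. Off the bad event it is then the
    whole jump sum, and [Y] lies at most [eps] below it. *)
Lemma exceed_lower (r x : R) : tau <= r + eps -> m (exceed a (r + eps)) = x%:E ->
  ((x - x ^+ 2)%:E <= P (exceed Y r) + jump_error%:E)%E.
Proof.
move=> er Dx.
have mD : measurable (exceed a (r + eps)) by exact: measurable_exceed.
apply: (le_trans (hits_ge prm mD Dx)).
apply: (@le_trans _ _ (P (exceed Y r `|` bad))); last first.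
  by apply: measureU2_le => //; exact: measurable_exceed.
apply: measure_mono => //; first exact: (measurable_hits prm).
  by apply: measurableU => //; exact: measurable_exceed.
move=> w hw; have [bw|nbw] := pselect (bad w); first by right.
left; have [i [s sS ai]] : exists i, exceed a (r + eps) (pt i w).
  apply: contrapT => /forallNP none; move: hw; rewrite /hits/= => /eqP; apply.
  exact/count_eq0.
have [nm Yj] := goodP nbw sS; exists s => //=.
have ti : tau < `|a s (pt i w)|.
  by apply: (le_lt_trans er); apply: (lt_le_trans ai); exact: ler_norm.
move: Yj; rewrite (single nm sS ti) ler_norml => /andP[+ _].
by move: ai => /=; lra.
Qed.

End OneBigJump.

(** * The mean measure of the jumps *)

Section CountingMeasure.
Context (R : realType).
Local Open Scope ereal_scope.

Lemma counting_bij (T : choiceType) (A B : set T) (f : T -> T) :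
  set_bij A B f -> counting A = counting B :> \bar R.
Proof.
move=> bijf; have AB : (A #= B)%card.
  have [fAB finj fsurj] := bijf.
  have -> : B = f @` A by apply/seteqP; split => // _ [x Ax <-]; exact: fAB.
  by rewrite card_eq_sym; apply: inj_card_eq.
rewrite /counting; have [fA|nA] := pselect (finite_set A).
  have fB : finite_set B by rewrite -(eq_finite_set AB).
  rewrite !asboolT//; have [n An] := fA.
  by rewrite (card_fset_set An) (@card_fset_set _ B n)// -(card_eql AB).
have nB : ~ finite_set B by rewrite -(eq_finite_set AB).
by rewrite !asboolF.
Qed.

Lemma counting_seq_le (T : choiceType) (s : seq T) (A : set T) : uniq s ->
  {in s, forall t, A t} -> ((size s)%:R%:E <= counting A :> \bar R).
Proof.
move=> us sA; rewrite /counting; case: ifPn => [/asboolP fA|_]; last exact: leey.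
rewrite lee_fin ler_nat; apply: uniq_leq_size => // t ts.
by rewrite in_fset_set// inE; exact: sA.
Qed.

Lemma counting_le_seq (T : choiceType) (s : seq T) (A : set T) :
  (forall t, A t -> t \in s) -> (counting A <= (size s)%:R%:E :> \bar R).
Proof.
move=> As; have fA : finite_set A.
  by apply: (@sub_finite_set _ _ [set` s]) => [t /As//|]; exact: finite_seq.
rewrite /counting asboolT// lee_fin ler_nat; apply: uniq_leq_size => // t.
by rewrite in_fset_set// inE => /As.
Qed.

End CountingMeasure.

(** * The intensity of the jump sizes *)

Section NuAlpha.
Context (R : realType) (alpha : R) (na : {measure set (\bar R) -> \bar R}).
Hypotheses (alpha0 : 0 < alpha) (hna : is_nu_alpha alpha na).

Lemma measurable_egt (x : \bar R) : measurable [set z : \bar R | (x < z)%E].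
Proof.
rewrite -[X in measurable X]setTI; exact: emeasurable_fun_o_infty.
Qed.

Lemma measurable_elt (x : \bar R) : measurable [set z : \bar R | (z < x)%E].
Proof.
rewrite -[X in measurable X]setTI; exact: emeasurable_fun_infty_o.
Qed.

Lemma nu_alpha_sigma_finite : sigma_finite setT na.
Proof.
exists (fun n => [set 0%E] `|` ([set z | ((n.+1%:R^-1)%:E < z)%E] `|`
                              [set z | (z < (- n.+1%:R^-1)%:E)%E])).
  apply/seteqP; split => // z _.
  case: z => [r| |].
  - have [->|r0] := eqVneq r 0; first by exists 0%N => //; left.
    have r0' : 0 < `|r| by rewrite normr_gt0.
    have [n /=] := ltr_add_invr r0'; rewrite add0r => nr.
    exists n => //; right; have [rge|rlt] := leP 0 r.
      by left => /=; rewrite lte_fin -(ger0_norm rge).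
    by right => /=; rewrite lte_fin ltrNr -(ltr0_norm rlt).
  - by exists 0%N => //; right; left; rewrite /= ltry.
  - by exists 0%N => //; right; right; rewrite /= ltNyr.
move=> n; have i0 : 0 < n.+1%:R^-1 :> R by rewrite invr_gt0.
have m1 := measurable_egt (n.+1%:R^-1)%:E.
have m2 := measurable_elt (- n.+1%:R^-1)%:E.
split; first by do ! apply: measurableU => //; exact: emeasurable_set1.
have [h0 /(_ _ i0)[h1 h2]] := hna.
rewrite (@le_lt_trans _ _ (0 + ((n.+1%:R^-1 `^ (- alpha))%:E + (n.+1%:R^-1 `^ (- alpha))%:E))%E)//.
  apply: measureU2_le => //; [exact: measurableU|by rewrite h0|].
  by apply: measureU2_le => //; rewrite ?h1 ?h2.
by rewrite add0e -EFinD ltry.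
Qed.

Let powR_cvg_small (e : R) : 0 < e -> exists2 x : R, 0 < x & x `^ (- alpha) <= e.
Proof.
move=> e0; exists (e `^ (- alpha^-1)); first by rewrite powR_gt0.
by rewrite -powRrM mulrNN mulVf ?gt_eqF// powRr1 ?lexx// ltW.
Qed.

Lemma nu_alpha_pinfty : na [set +oo%E] = 0%E.
Proof.
apply/eqP; rewrite eq_le measure_ge0 andbT; apply/lee_addgt0Pr => e e0.
rewrite add0e; have [x x0 xe] := powR_cvg_small e0.
apply: (@le_trans _ _ (x `^ (- alpha))%:E); last by rewrite lee_fin.
have [_ /(_ _ x0)[<- _]] := hna.
apply: measure_mono; [exact: emeasurable_set1|exact: measurable_egt|].
by move=> z /= ->; rewrite ltry.
Qed.

Lemma nu_alpha_ninfty : na [set -oo%E] = 0%E.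
Proof.
apply/eqP; rewrite eq_le measure_ge0 andbT; apply/lee_addgt0Pr => e e0.
rewrite add0e; have [x x0 xe] := powR_cvg_small e0.
apply: (@le_trans _ _ (x `^ (- alpha))%:E); last by rewrite lee_fin.
have [_ /(_ _ x0)[_ <-]] := hna.
apply: measure_mono; [exact: emeasurable_set1|exact: measurable_elt|].
by move=> z /= ->; rewrite ltNyr.
Qed.

(** Since [fine] sends [+oo] to 0, the event loses that point, which is null because the tails of
    [na] vanish at infinity. *)
Lemma nu_alpha_gt (t : R) : 0 < t -> na [set z | t < fine z] = (t `^ (- alpha))%:E.
Proof.
move=> t0; have [_ /(_ _ t0)[<- _]] := hna.
have E : [set z | (t%:E < z)%E] = [set z | t < fine z] `|` [set +oo%E].
  apply/seteqP; split => z /=.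
    by case: z => [r|_|//]; [rewrite lte_fin; left|right].
  case: z => [r||] /= [|//] h; rewrite ?ltry ?lte_fin//.
  by move: h; rewrite ltNge ltW.
have mt : measurable [set z : \bar R | t < fine z].
  by apply: measurable_gt; exact: fine_measurable.
rewrite E measureU//; last first.
  by apply/seteqP; split => // z [] /= + zE; rewrite zE /= ltNge ltW.
by rewrite [X in (_ + X)%E]nu_alpha_pinfty adde0.
Qed.

Lemma nu_alpha_lt (t : R) : 0 < t -> na [set z | t < - fine z] = (t `^ (- alpha))%:E.
Proof.
move=> t0; have [_ /(_ _ t0)[_ <-]] := hna.
have E : [set z | (z < (- t)%:E)%E] = [set z | t < - fine z] `|` [set -oo%E].
  apply/seteqP; split => z /=.
    by case: z => [r|//|_]; [rewrite lte_fin ltrNr; left|right].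
  case: z => [r||] /= [|//] h; rewrite ?ltNyr ?lte_fin 1?ltrNr//.
  by move: h; rewrite oppr0 ltNge ltW.
have mt : measurable [set z : \bar R | t < - fine z].
  by apply: measurable_gt; apply: measurableT_comp => //; exact: fine_measurable.
rewrite E measureU//; last first.
  by apply/seteqP; split => // z [] /= + zE; rewrite zE /= oppr0 ltNge ltW.
by rewrite [X in (_ + X)%E]nu_alpha_ninfty adde0.
Qed.

Let powR_scale (x y : R) : 0 < x -> 0 < y ->
  (x / y) `^ (- alpha) = x `^ (- alpha) * y `^ alpha.
Proof.
move=> x0 y0; rewrite powRM ?invr_ge0 ?ltW//; congr (_ * _).
by rewrite -powR_inv1 ?ltW// -powRrM mulrNN mul1r.
Qed.

Lemma nu_alpha_scaled (x y : R) : 0 < x ->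
  na [set z | x < fine z * y] = (x `^ (- alpha) * `|y| `^ alpha)%:E.
Proof.
move=> x0; have [y0|y0|<-] := ltgtP 0 y.
- rewrite gtr0_norm// -powR_scale// -nu_alpha_gt ?divr_gt0//.
  by congr (na _); apply/seteqP; split => z /=; rewrite ltr_pdivrMr.
- rewrite ltr0_norm// -powR_scale ?oppr_gt0// -nu_alpha_lt ?divr_gt0 ?oppr_gt0//.
  by congr (na _); apply/seteqP; split => z /=; rewrite ltr_pdivrMr ?oppr_gt0// mulrNN.
- rewrite normr0 powR0 ?gt_eqF// mulr0.
  rewrite (_ : [set z | _] = set0) ?measure0//.
  by apply/seteqP; split => // z /=; rewrite mulr0 ltNge ltW.
Qed.

(** The tail blows up at 0. This matters when the supremum of the kernel is infinite: then every
    positive jump size reaches the level. *)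
Lemma nu_alpha_pos : na [set z | 0 < fine z] = +oo%E.
Proof.
have mt (t : R) : measurable [set z : \bar R | t < fine z].
  by apply: measurable_gt; exact: fine_measurable.
apply/eqyP => A A0; pose t := A `^ (- alpha^-1).
have t0 : 0 < t by rewrite powR_gt0.
apply: (@le_trans _ _ (t `^ (- alpha))%:E).
  by rewrite lee_fin /t -powRrM mulrNN mulVf ?gt_eqF// powRr1 ?lexx// ltW.
by rewrite -nu_alpha_gt//; apply: measure_mono => // z /=; exact: lt_trans.
Qed.

Lemma nu_alpha_neg : na [set z | fine z < 0] = +oo%E.
Proof.
have mt (t : R) : measurable [set z : \bar R | t < - fine z].
  by apply: measurable_gt; apply: measurableT_comp => //; exact: fine_measurable.
rewrite (_ : [set z | _] = [set z | 0 < - fine z]); last first.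
  by apply/seteqP; split => z /=; rewrite oppr_gt0.
apply/eqyP => A A0; pose t := A `^ (- alpha^-1).
have t0 : 0 < t by rewrite powR_gt0.
apply: (@le_trans _ _ (t `^ (- alpha))%:E).
  by rewrite lee_fin /t -powRrM mulrNN mulVf ?gt_eqF// powRr1 ?lexx// ltW.
by rewrite -nu_alpha_lt//; apply: measure_mono => // z /=; exact: lt_trans.
Qed.

End NuAlpha.

(** * Jump sizes under the product measure *)

Section JumpMeasure.
Context (R : realType) (d : nat) (dW : measure_display) (W : measurableType dW).
Variables (alpha : R) (na : {sigma_finite_measure set (\bar R) -> \bar R})
  (nu : {sigma_finite_measure set W -> \bar R}) (H : set 'cV[int]_d).
Hypotheses (alpha0 : 0 < alpha) (hna : is_nu_alpha alpha na).

Notation cnt := (counting_on R H).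
Definition mark_measure : set (\bar R * W) -> \bar R := (na \x nu)%E.
HB.instance Definition _ := Measure.on mark_measure.

Let mark_measure_sigma_finite : sigma_finite setT mark_measure.
Proof.
have [F Fcover Ffin] := sigma_finiteT na.
have [G Gcover Gfin] := sigma_finiteT nu.
exists (fun n => if choice.unpickle n is Some ik then F ik.1 `*` G ik.2 else set0).
  apply/seteqP; split => // -[z w] _.
  have [i _ Fi] : (\bigcup_i F i) z by rewrite -Fcover.
  have [k _ Gk] : (\bigcup_i G i) w by rewrite -Gcover.
  by exists (choice.pickle (i, k)) => //; rewrite choice.pickleK.
move=> n; case: choice.unpickle => [[i k]|]; last by rewrite measure0.
have [[mF fF] [mG fG]] := (Ffin i, Gfin k).
split; first exact: measurableX.
rewrite /mark_measure product_measure1E// lte_mul_pinfty//.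
by rewrite ge0_fin_numE.
Qed.

HB.instance Definition _ :=
  @Measure_isSigmaFinite.Build _ _ _ mark_measure mark_measure_sigma_finite.

Definition jump_measure := (mark_measure \x cnt)%E.
HB.instance Definition _ := Measure.on jump_measure.

Implicit Types (g : W * 'cV[int]_d -> R) (sh : 'cV[int]_d -> 'cV[int]_d).

Definition jump_size g sh (z : (\bar R * W) * 'cV[int]_d) : R :=
  fine z.1.1 * g (z.1.2, sh z.2).

Lemma measurable_jump_size g sh : measurable_fun setT g ->
  measurable_fun setT (jump_size g sh).
Proof.
move=> mg; apply: measurable_funM.
  apply: measurableT_comp; first exact: fine_measurable.
  by apply: measurableT_comp => //; exact: measurable_fst.
apply: measurableT_comp => //; apply: measurable_fun_pair => /=.
  by apply: measurableT_comp => //; exact: measurable_snd.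
by apply: (measurableT_comp (f := sh)) => //; exact: measurable_snd.
Qed.

Lemma product_measure_swap d1 d2 (T1 : measurableType d1) (T2 : measurableType d2)
    (m1 : {sigma_finite_measure set T1 -> \bar R})
    (m2 : {sigma_finite_measure set T2 -> \bar R}) (A : set (T1 * T2)) :
  measurable A -> ((m1 \x m2) A = \int[m2]_y m1 (ysection A y))%E.
Proof.
move=> mA; rewrite (product_measure_unique (m' := (m1 \x^ m2)%E))//.
by move=> B C mB mC; exact: product_measure2E.
Qed.

Lemma integral_counting_bij sh (f : 'cV[int]_d -> \bar R) : set_bij H H sh ->
  (forall t, 0 <= f t)%E ->
  (\int[cnt]_u f (sh u) = \int[cnt]_u f u)%E.
Proof.
move=> bij f0; have msh : measurable_fun setT sh by [].
rewrite -(integral_image_measure cnt msh (g := f))//.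
apply: eq_measure_integral => A mA _.
suff : counting (sh @^-1` A `&` H) = counting (A `&` H) :> \bar R by [].
have [hH iH sH] := bij; apply: (@counting_bij _ _ _ _ sh); split.
- by move=> t [/= At Ht]; split => //; exact: hH.
- move=> t t' /set_mem[_ Ht] /set_mem[_ Ht']; apply: iH; exact/mem_set.
- by move=> t [At /sH[t' Ht' tE]]; exists t' => //; split => //; rewrite /= tE.
Qed.

(** Integrating out the jump size first leaves a power of the kernel; the shift then disappears
    because it permutes [H]. This is stationarity at the level of the mean measure: the tail is the
    same at every index. *)
Lemma jump_tail g sh (x : R) : measurable_fun setT g -> set_bij H H sh -> 0 < x ->
  (jump_measure [set z | (x < jump_size g sh z)%R] =
   (x `^ (- alpha))%:E * \int[nu \x cnt]_z (`|g z| `^ alpha)%:E)%E.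
Proof.
move=> mg bij x0.
have mA : measurable [set z | x < jump_size g sh z].
  by apply: measurable_gt; exact: measurable_jump_size.
have mga : measurable_fun setT (fun z => (`|g z| `^ alpha)%:E).
  apply/measurable_EFinP; apply: (measurableT_comp (measurable_powR _)) => //.
  exact: measurableT_comp.
have mgu u : measurable_fun setT (fun v => (`|g (v, u)| `^ alpha)%:E).
  apply: (measurableT_comp mga); exact: measurable_pair2.
etransitivity; first exact: (product_measure_swap mark_measure cnt mA).
transitivity (\int[cnt]_u ((x `^ (- alpha))%:E *
    \int[nu]_v (`|g (v, sh u)| `^ alpha)%:E))%E.
  apply: eq_integral => u _.
  rewrite [LHS](product_measure_swap na nu); last exact: measurable_ysection.
  rewrite -ge0_integralZl//.
  - apply: eq_integral => v _; rewrite -EFinM -(nu_alpha_scaled alpha0 hna)//.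
    by congr (na _); apply/seteqP; split => j /=; rewrite /ysection/= !inE/= ?inE.
  - by rewrite lee_fin powR_ge0.
rewrite ge0_integralZl//; last 2 first.
- by move=> u _; apply: integral_ge0 => v _; rewrite lee_fin powR_ge0.
- by rewrite lee_fin powR_ge0.
congr *%E; rewrite (integral_counting_bij (f := fun u => \int[nu]_v (`|g (v, u)| `^ alpha)%:E)%E)//.
  by rewrite fubini_tonelli2// => z; rewrite lee_fin powR_ge0.
by move=> u; apply: integral_ge0 => v _; rewrite lee_fin powR_ge0.
Qed.

End JumpMeasure.

(** * Marks whose largest jump exceeds a level *)

Section MarkSup.
Context (R : realType) (d : nat) (dW : measure_display) (W : measurableType dW).
Variables (alpha : R) (na : {sigma_finite_measure set (\bar R) -> \bar R})
  (nu : {sigma_finite_measure set W -> \bar R}) (H : set 'cV[int]_d).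
Hypotheses (alpha0 : 0 < alpha) (hna : is_nu_alpha alpha na).
Hypothesis (H0 : H !=set0).

(** For a finite supremum, some point reaches the level exactly when the supremum does, the
    inequality being strict. For an infinite one, every [j] with [0 < psi j] qualifies and both
    sides are [+oo]. The function [psi] stands for the jump size or its opposite. *)
Let na_sup (psi : \bar R -> R) (f : 'cV[int]_d -> R) (r : R) : 0 < r ->
  (forall u, 0 <= f u) ->
  (forall s, 0 <= s -> na [set j | r < psi j * s] = (r `^ (- alpha) * s `^ alpha)%:E) ->
  na [set j | 0 < psi j] = +oo%E ->
  (na [set j | exists2 u, H u & (r < psi j * f u)%R] =
   (r `^ (- alpha))%:E * ereal_sup [set (f u)%:E | u in H] `^ alpha)%E.
Proof.
move=> r0 f0 psi_s psi_oo; set S := ereal_sup _.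
have psi_pos j u : r < psi j * f u -> 0 < psi j.
  move=> h; rewrite ltNge; apply/negP => pj.
  by move: h; rewrite ltNge (le_trans _ (ltW r0))// mulr_le0_ge0.
have fS u : H u -> ((f u)%:E <= S)%E by move=> Hu; apply: ereal_sup_ubound; exists u.
have S0 : (0 <= S)%E.
  by have [u Hu] := H0; apply: le_trans (fS _ Hu); rewrite lee_fin.
have Sgt j : 0 < psi j -> ((r / psi j)%:E < S)%E -> exists2 u, H u & r < psi j * f u.
  move=> pj /ereal_sup_gt[_ [u Hu <-]]; rewrite lte_fin => h.
  by exists u => //; rewrite -ltr_pdivrMl// mulrC.
move: S0 fS Sgt; case: S => [s| |//]; last first.
  move=> _ _ Sgt; rewrite poweRyr ?gt_eqF// gt0_muley ?lte_fin ?powR_gt0//.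
  rewrite -psi_oo; congr (na _); apply/seteqP; split => j /=.
    by move=> [u _ /psi_pos].
  by move=> pj; apply: Sgt => //; rewrite ltry.
rewrite lee_fin => s0 fS Sgt; rewrite poweR_EFin -EFinM -psi_s//.
congr (na _); apply/seteqP; split => j /=.
  move=> [u Hu h]; apply: (lt_le_trans h); rewrite ler_wpM2l// ?(ltW (psi_pos _ _ h))//.
  by have := fS _ Hu; rewrite lee_fin.
move=> h; have pj : 0 < psi j.
  rewrite ltNge; apply/negP => pj.
  by move: h; rewrite ltNge (le_trans _ (ltW r0))// mulr_le0_ge0.
by apply: Sgt => //; rewrite lte_fin ltr_pdivrMr// mulrC.
Qed.

Variable g : W * 'cV[int]_d -> R.
Hypothesis mg : measurable_fun setT g.

Definition sup_exceed (r : R) : set (\bar R * W) :=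
  [set x | exists2 u, H u & r < fine x.1 * g (x.2, u)].

Lemma measurable_sup_exceed r : measurable (sup_exceed r).
Proof.
have -> : sup_exceed r = \bigcup_(u in H) [set x | r < fine x.1 * g (x.2, u)].
  by apply/seteqP; split => x [u Hu h]; exists u.
rewrite bigcup_mkcond; apply: countable_bigcupT_measurable => [|u].
  exact: countableP.
case: ifP => // _; apply: measurable_gt; apply: measurable_funM.
  by apply: measurableT_comp; [exact: fine_measurable|exact: measurable_fst].
by apply: measurableT_comp => //; exact: measurable_fun_pair.
Qed.

Lemma mark_sup_exceed (r : R) : 0 < r ->
  (mark_measure na nu (sup_exceed r) =
   (r `^ (- alpha))%:E * sup_integral nu H alpha g)%E.
Proof.
move=> r0; have mE := measurable_sup_exceed r.
rewrite [LHS](product_measure_swap na nu)//.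
pose J v := (ereal_sup [set (Num.max (g (v, u)) 0)%:E | u in H] `^ alpha +
      ereal_sup [set (Num.max (- g (v, u)) 0)%:E | u in H] `^ alpha)%E.
have secE v : (na (ysection (sup_exceed r) v) = (r `^ (- alpha))%:E * J v)%E.
  (* A positive jump can exceed the level only through the positive part of the kernel, and a
     negative jump only through the negative part; hence the two suprema of the integrand. *)
  pose Ap := [set j | exists2 u, H u & (r < fine j * Num.max (g (v, u)) 0)%R].
  pose An := [set j | exists2 u, H u & (r < - fine j * Num.max (- g (v, u)) 0)%R].
  have -> : ysection (sup_exceed r) v = Ap `|` An.
    apply/seteqP; split => j; rewrite /ysection/= ?inE.
      move=> [u Hu /= h]; have [g0|g0] := leP 0 (g (v, u)).
        by left; exists u => //; rewrite max_l.
      by right; exists u => //; rewrite max_l ?mulrNN// oppr_ge0 ltW.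
    move=> [] [u Hu]; have [g0|g0] := leP 0 (g (v, u)).
    - by move=> h; exists u.
    - by rewrite mulr0 ltNge ltW.
    - move: (g0); rewrite -oppr_le0 => g0'; rewrite max_r//.
      by rewrite mulr0 ltNge ltW.
    - by rewrite max_l ?oppr_ge0 1?ltW// mulrNN => h; exists u.
  have max0 (x : R) : 0 <= Num.max x 0 by rewrite le_max lexx orbT.
  have mA (psi : \bar R -> R) (f : 'cV[int]_d -> R) : measurable_fun setT psi ->
      measurable [set j | exists2 u, H u & (r < psi j * f u)%R].
    move=> mpsi.
    have -> : [set j | exists2 u, H u & (r < psi j * f u)%R] =
        \bigcup_(u in H) [set j | r < psi j * f u].
      by apply/seteqP; split => j [u Hu h]; exists u.
    rewrite bigcup_mkcond; apply: countable_bigcupT_measurable => [|u].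
      exact: countableP.
    by case: ifP => // _; apply: measurable_gt; exact: measurable_funM.
  have mf : measurable_fun setT (fine : \bar R -> R) by exact: fine_measurable.
  have mfN : measurable_fun setT (fun j : \bar R => - fine j) by exact: measurableT_comp.
  rewrite measureU; [|exact: mA|exact: (mA (fun j => - fine j))|]; last first.
    apply/seteqP; split => // j [] [u _ h] [u' _ h'].
    have [fj|fj] := leP 0 (fine j).
      by move: h'; rewrite ltNge (le_trans _ (ltW r0))// mulr_le0_ge0// oppr_le0.
    by move: h; rewrite ltNge (le_trans _ (ltW r0))// mulr_le0_ge0// ltW.
  rewrite [X in (X + _)%E](_ : _ = (r `^ (- alpha))%:E *
      ereal_sup [set (Num.max (g (v, u)) 0)%:E | u in H] `^ alpha)%E; last first.
    apply: (na_sup (psi := fine)) => //; last exact: nu_alpha_pos alpha0 hna.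
    by move=> s s0; rewrite (nu_alpha_scaled alpha0 hna)// ger0_norm.
  rewrite [X in (_ + X)%E](_ : _ = (r `^ (- alpha))%:E *
      ereal_sup [set (Num.max (- g (v, u)) 0)%:E | u in H] `^ alpha)%E; last first.
    apply: (na_sup (psi := fun j => - fine j)) => //.
      move=> s s0; rewrite -[in RHS](ger0_norm s0) -normrN -(nu_alpha_scaled alpha0 hna)//.
      by congr (na _); apply/seteqP; split => j /=; rewrite mulNr mulrN.
    rewrite -(nu_alpha_neg alpha0 hna); congr (na _).
    by apply/seteqP; split => j /=; rewrite oppr_gt0.
  by rewrite ge0_muleDr// poweR_ge0.
(* Measurability is read off from the sections of a measurable set, of which [J] is a constant
   multiple. *)
have mJ : measurable_fun setT J.
  rewrite (_ : J = fun v => ((r `^ alpha)%:E * na (ysection (sup_exceed r) v))%E).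
    apply: measurable_funeM; exact: measurable_fun_ysection.
  apply/funext => v; rewrite secE muleA -EFinM powRN mulfV ?mul1e//.
  by rewrite gt_eqF// powR_gt0.
under eq_integral do rewrite secE.
rewrite ge0_integralZl//.
- by move=> v _; rewrite /J adde_ge0// poweR_ge0.
- by rewrite lee_fin powR_ge0.
Qed.

End MarkSup.

(** * Points exceeding a level at some index *)

Section ExceedBounds.
Context (R : realType) (d : nat) (dW : measure_display) (W : measurableType dW).
Variables (alpha : R) (na : {sigma_finite_measure set (\bar R) -> \bar R})
  (nu : {sigma_finite_measure set W -> \bar R}) (H : set 'cV[int]_d).
Hypotheses (alpha0 : 0 < alpha) (hna : is_nu_alpha alpha na).
Variables (g : W * 'cV[int]_d -> R) (mg : measurable_fun setT g).
Variables (I : eqType) (T : seq I) (sh : I -> 'cV[int]_d -> 'cV[int]_d).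
Hypothesis sh_bij : forall s, set_bij H H (sh s).

Let a (s : I) := jump_size g (sh s).

Let ma s : measurable_fun setT (a s).
Proof. exact: measurable_jump_size. Qed.

(* A mark (j, w) with r < j g(w, u') for some u' is counted at the distinct points u
   with sh s u = u', one for each s in T. *)
Lemma exceed_ge (r : R) : uniq T ->
  {in T &, forall s s', forall u, H u -> sh s u = sh s' u -> s = s'} ->
  ((size T)%:R%:E * mark_measure na nu (sup_exceed H g r) <=
   jump_measure na nu H (exceed T a r))%E.
Proof.
move=> uT injT; have mE := measurable_sup_exceed H mg r.
have mA : measurable (exceed T a r) by exact: measurable_exceed.
rewrite -integral_cst//.
have mc : measurable_fun setT (fun x => counting_on R H (xsection (exceed T a r) x)).
  exact: measurable_fun_xsection.
apply: (@le_trans _ _ (\int[mark_measure na nu]_(x in sup_exceed H g r)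
    counting_on R H (xsection (exceed T a r) x))%E); last first.
  by apply: ge0_subset_integral => // x _; exact: measure_ge0.
apply: ge0_le_integral => //.
- by move=> x _; rewrite lee_fin.
- exact: measurable_funS mc.
- move=> x [u' Hu' gu'].
  pose inv s : 'cV[int]_d := xget 0 [set u | H u /\ sh s u = u'].
  have invP s : H (inv s) /\ sh s (inv s) = u'.
    have [_ _ /(_ _ Hu')[u Hu su]] := sh_bij s.
    by rewrite /inv; case: xgetP => [y _ //|/(_ u)]; case.
  rewrite /counting_on /mrestr -(size_map inv); apply: counting_seq_le.
    rewrite map_inj_in_uniq// => s s' sT s'T ss'.
    apply: (injT _ _ sT s'T (inv s)); first by case: (invP s).
    by rewrite (invP s).2 ss' (invP s').2.
  move=> _ /mapP[s sT ->]; have [Hi si] := invP s; split => //.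
  by rewrite /xsection/= inE; exists s => //=; rewrite /a /jump_size/= si.
Qed.

(** Here [B] is the region in which the kernel is kept, [N] contains the points of [H] that some
    shift moves into [B], and [kappa] is the mass of the kernel outside [B]. *)
Variables (B : set 'cV[int]_d) (N : seq 'cV[int]_d) (kappa : R).
Hypotheses
  (BN : forall s u, s \in T -> H u -> B (sh s u) -> u \in N)
  (kappaE : (\int[nu \x counting_on R H]_z
     (`|if z.2 \in B then 0 else g z| `^ alpha)%:E = kappa%:E)%E).

(* The part of g supported in B reaches the level r only from points of N; what is
   left of g is treated by the union bound over T. *)
Lemma exceed_le (r : R) : 0 < r ->
  (jump_measure na nu H (exceed T a r) <=
   (size N)%:R%:E * mark_measure na nu (sup_exceed H g r) +
   ((size T)%:R * (r `^ (- alpha) * kappa))%:E)%E.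
Proof.
move=> r0; have mE := measurable_sup_exceed H mg r.
have mA : measurable (exceed T a r) by exact: measurable_exceed.
pose gB (z : W * 'cV[int]_d) := if z.2 \in B then 0 else g z.
have mgB : measurable_fun setT gB.
  apply: measurable_fun_ifT => //.
  by apply: (measurableT_comp (f := fun u : 'cV[int]_d => u \in B)) => //; exact: measurable_snd.
pose A1 := sup_exceed H g r `*` [set` N].
(* The sets live on all of Z^d while the measure counts points of [H] only; the part off [H] is
   null. *)
pose A2 := [set: \bar R * W] `*` ~` H.
pose A3 := some_in T (fun s => [set z | r < jump_size gB (sh s) z]).
have mA1 : measurable A1 by exact: measurableX.
have mA2 : measurable A2 by exact: measurableX.
have mA3 : measurable A3.
  by apply: measurable_some_in => s; apply: measurable_gt; exact: measurable_jump_size.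
apply: (@le_trans _ _ (jump_measure na nu H (A2 `|` (A1 `|` A3)))).
  apply: measure_mono => //; first by do ! apply: measurableU.
  move=> [x u] [s sT /= ru]; have [Hu|nHu] := pselect (H u); last by left.
  right; have [Bu|nBu] := pselect (B (sh s u)).
    left; split => /=; last exact: BN Bu.
    by exists (sh s u) => //; have [+ _ _] := sh_bij s; exact.
  by right; exists s => //=; rewrite /jump_size /gB/= memNset.
have A2le : (jump_measure na nu H A2 <= 0)%E.
  rewrite /jump_measure product_measure1E// [X in (_ * X)%E](_ : _ = 0%E) ?mule0//.
  apply/eqP; rewrite eq_le measure_ge0 andbT.
  suff : (counting (~` H `&` H) <= 0 :> \bar R)%E by [].
  by rewrite setICl; exact: (@counting_le_seq _ _ [::]).
have A1le : (jump_measure na nu H A1 <=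
    (size N)%:R%:E * mark_measure na nu (sup_exceed H g r))%E.
  rewrite /jump_measure product_measure1E// muleC lee_wpmul2r//.
  by apply: counting_le_seq => t [].
rewrite -[leRHS]add0e; apply: measureU2_le => //; first exact: measurableU.
apply: measureU2_le => //.
apply: measure_some_in_le => [s|s _].
  by apply: measurable_gt; exact: measurable_jump_size.
rewrite [leLHS](jump_tail nu alpha0 hna mgB (sh_bij s) r0).
by rewrite [X in (_ * X)%E]kappaE.
Qed.

End ExceedBounds.

(** * Integrability of the kernel *)

Section KernelTails.
Context (R : realType) (d : nat) (dW : measure_display) (W : measurableType dW).
Variables (alpha : R) (m : {measure set (W * 'cV[int]_d) -> \bar R}).
Hypothesis alpha0 : 0 < alpha.

Lemma integral_norm_powR (g : W * 'cV[int]_d -> R) : measurable_fun setT g ->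
  (\int[m]_z (`|g z| `^ alpha)%:E < +oo)%E ->
  exists2 c : R, 0 <= c & (\int[m]_z (`|g z| `^ alpha)%:E = c%:E)%E.
Proof.
move=> mg g_fin; exists (fine (\int[m]_z (`|g z| `^ alpha)%:E)%E).
  by apply: fine_ge0; apply: integral_ge0 => z _; rewrite lee_fin powR_ge0.
rewrite fineK// ge0_fin_numE//.
by apply: integral_ge0 => z _; rewrite lee_fin powR_ge0.
Qed.

(** The kernel is controlled on [H] only; extended by 0 it becomes measurable everywhere, with the
    same norm. *)
Lemma in_Lalpha_patch (H : set 'cV[int]_d) (h : W * 'cV[int]_d -> R) :
  in_Lalpha m alpha (setT `*` H) h ->
  in_Lalpha m alpha setT (fun z => if z.2 \in H then h z else 0).
Proof.
have mH : measurable ([set: W] `*` H) by exact: measurableX.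
have zH z : (z \in [set: W] `*` H) = (z.2 \in H).
  by apply/idP/idP => /set_mem; [case=> _ Hz|move=> Hz]; apply/mem_set.
have gE : (fun z => if z.2 \in H then h z else 0) = h \_ ([set: W] `*` H).
  by apply/funext => z; rewrite patchE zH.
move=> [mh h_fin]; rewrite gE; split; first by apply/(measurable_restrictT _ mH).
rewrite (le_lt_trans _ h_fin)// [leRHS]integral_mkcond le_eqVlt; apply/orP; left.
apply/eqP/eq_integral => z _; rewrite !patchE; case: ifP => // _.
by rewrite normr0 powR0// gt_eqF.
Qed.

(** Dominated convergence: each point eventually enters the ball of radius [k]. *)
Lemma kernel_tail_cvg0 (g : W * 'cV[int]_d -> R) : in_Lalpha m alpha setT g ->
  exists2 kappa : nat -> R, kappa @ \oo --> 0 &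
  forall k, (\int[m]_z (`|if z.2 \in [set u | (supnorm u <= k)%N] then 0 else g z|
    `^ alpha)%:E = (kappa k)%:E)%E.
Proof.
move=> [mg g_fin].
pose gk k (z : W * 'cV[int]_d) : R :=
  if z.2 \in [set u | (supnorm u <= k)%N] then 0 else g z.
have mgk k : measurable_fun setT (gk k).
  apply: measurable_fun_ifT => //.
  by apply: (measurableT_comp (f := fun u : 'cV[int]_d => u \in _)) => //; exact: measurable_snd.
have mpow (f : W * 'cV[int]_d -> R) : measurable_fun setT f ->
    measurable_fun setT (fun z => (`|f z| `^ alpha)%:E).
  move=> mf; apply/measurable_EFinP; apply: (measurableT_comp (measurable_powR alpha)).
  exact: measurableT_comp.
have gk_le k z : `|gk k z| `^ alpha <= `|g z| `^ alpha.
  by rewrite /gk; case: ifP => _//; rewrite normr0 powR0 ?powR_ge0// gt_eqF.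
have gk_fin k : (\int[m]_z (`|gk k z| `^ alpha)%:E < +oo)%E.
  apply: le_lt_trans g_fin; apply: ge0_le_integral => //; first exact: mpow.
    exact: mpow.
  by move=> z _; rewrite lee_fin.
have gkE k : (\int[m]_z (`|gk k z| `^ alpha)%:E =
    (fine (\int[m]_z (`|gk k z| `^ alpha)%:E))%:E)%E.
  by have [c _ ->] := integral_norm_powR (mgk k) (gk_fin k).
exists (fun k => fine (\int[m]_z (`|gk k z| `^ alpha)%:E)%E); last exact: gkE.
apply: (fine_cvg (f := fun k => (\int[m]_z (`|gk k z| `^ alpha)%:E)%E)).
have [] := @dominated_convergence _ _ R m setT measurableT
  (fun k z => (`|gk k z| `^ alpha)%:E) (cst 0%E) (fun z => (`|g z| `^ alpha)%:E).
- by move=> k; exact: mpow.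
- exact: measurable_cst.
- apply: aeW => z _; apply: cvg_near_cst; exists (supnorm z.2) => // k /= zk.
  by rewrite /gk mem_set// normr0 powR0// gt_eqF.
- apply/integrableP; split; first exact: mpow.
  by under eq_integral do rewrite gee0_abs ?lee_fin ?powR_ge0//.
- by apply: aeW => z k _; rewrite gee0_abs ?lee_fin ?powR_ge0.
- by move=> _ _; rewrite integral0.
Qed.

End KernelTails.

(** * Passage to the limit *)

Section LimitSqueeze.
Context (R : realType).

Lemma continuous_powR (a y : R) : 0 < y -> {for y, continuous (fun x : R => x `^ a)}.
Proof.
move=> y0; apply/differentiable_continuous/derivable1_diffP.
by apply: derivable_powR; rewrite in_itv/= andbT.
Qed.

(* f n is the rescaled probability, t n the rescaled size of T_n, N k n that of its
   k-enlargement and b n = n^p / gamma_n^alpha.  The upper limits are taken in the order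
   n, k, theta, eps: for fixed eps the error term tends to 0 with theta as alpha < 2. *)
Lemma asymptotic_squeeze (alpha y S c K L : R) (f t b : nat -> R)
    (N : nat -> nat -> R) (kappa : nat -> R) :
  0 < alpha < 2 -> 0 < y -> 0 <= S -> 0 <= c -> 0 <= K ->
  t @ \oo --> L -> (forall k, N k @ \oo --> L) -> b @ \oo --> 0 ->
  kappa @ \oo --> 0 ->
  (forall (eps theta : R) (k : nat), 0 < eps < y -> 0 < theta ->
    \forall n \near \oo,
    f n <= N k n * ((y - eps) `^ (- alpha) * S) +
      t n * ((y - eps) `^ (- alpha) * kappa k) +
      (t n ^+ 2 * (2 * c * theta `^ (- alpha)) ^+ 2 * b n +
       t n * (K * c * theta `^ (2 - alpha) / eps ^+ 2))) ->
  (forall (eps theta : R), 0 < eps < y -> 0 < theta < y ->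
    \forall n \near \oo,
    t n * ((y + eps) `^ (- alpha) * S) -
      t n ^+ 2 * (c * (y + eps) `^ (- alpha)) ^+ 2 * b n -
      (t n ^+ 2 * (2 * c * theta `^ (- alpha)) ^+ 2 * b n +
       t n * (K * c * theta `^ (2 - alpha) / eps ^+ 2)) <= f n) ->
  f @ \oo --> L * S * y `^ (- alpha).
Proof.
move=> /andP[al0 al2] y0 S0 c0 K0 tL NL b0 k0 up lo.
have cP := @continuous_powR (- alpha) _ y0.
have al2' : 0 < 2 - alpha by rewrite subr_gt0.
have theta_small (eps e : R) : 0 < eps -> 0 < e ->
    exists2 theta, 0 < theta < y & L * (K * c * theta `^ (2 - alpha) / eps ^+ 2) < e.
  move=> eps0 e0.
  have : (fun theta : R => L * (K * c * theta `^ (2 - alpha) / eps ^+ 2)) @ 0^'+ -->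
      L * (K * c * 0 / eps ^+ 2).
    apply: cvgMr; apply: cvgMl; apply: cvgMr; exact: powR_cvg0.
  rewrite mulr0 mul0r mulr0 => /cvgrPdist_lt/(_ _ e0) h.
  near (0 : R)^'+ => theta; exists theta.
    by apply/andP; split => //; near: theta; exact: nbhs_right_lt.
  apply: le_lt_trans (ler_norm _) _; rewrite -normrN -sub0r.
  by near: theta.
apply/cvgrPdist_le => e e0.
(* Four errors share [e]: the shift of the level by [eps], the kernel mass beyond [k], the residual
   controlled by [theta], and the convergence in [n]. *)
have e40 : 0 < e / 4 by rewrite divr_gt0.
have [eps /andP[eps0 epsy] [h1 h2]] : exists2 eps : R, 0 < eps < y &
    L * S * (y - eps) `^ (- alpha) < L * S * y `^ (- alpha) + e / 4 /\
    L * S * y `^ (- alpha) - e / 4 < L * S * (y + eps) `^ (- alpha).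
  have : (fun x : R => L * S * x `^ (- alpha)) @ y --> L * S * y `^ (- alpha).
    by apply: cvgMr.
  move=> /cvgrPdist_lt/(_ _ e40) /nbhs_ballP[r /= r0 hr].
  exists (Num.min r y / 2).
    rewrite divr_gt0 ?lt_min ?r0 ?y0//= ltr_pdivrMr// (@le_lt_trans _ _ y) ?ge_min ?lexx ?orbT//.
    by rewrite mulr_natr mulr2n ltrDl.
  have mr : Num.min r y / 2 < r.
    by rewrite ltr_pdivrMr// mulr_natr mulr2n (@le_lt_trans _ _ r) ?ge_min ?lexx// ltrDl.
  have m0 : 0 < Num.min r y / 2 by rewrite divr_gt0 ?lt_min ?r0 ?y0.
  split.
    have := hr (y - Num.min r y / 2); rewrite /ball/= opprB addrC subrK gtr0_norm// => /(_ mr).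
    by rewrite ltr_norml => /andP[]; lra.
  have := hr (y + Num.min r y / 2); rewrite /ball/= opprD addrA subrr sub0r normrN gtr0_norm// => /(_ mr).
  by rewrite ltr_norml => /andP[]; lra.
have [theta /andP[theta0 thetay] htheta] := theta_small _ _ eps0 e40.
have [k hk] : exists k, L * ((y - eps) `^ (- alpha) * kappa k) < e / 4.
  have : (fun k => L * ((y - eps) `^ (- alpha) * kappa k)) @ \oo -->
      L * ((y - eps) `^ (- alpha) * 0).
    by apply: cvgMr; exact: cvgMr.
  rewrite !mulr0 => /cvgrPdist_lt/(_ _ e40)[k _ hk].
  exists k; apply: le_lt_trans (ler_norm _) _; rewrite -normrN -sub0r.
  exact: (hk k (leqnn k)).
have upc : (fun n => N k n * ((y - eps) `^ (- alpha) * S) +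
      t n * ((y - eps) `^ (- alpha) * kappa k) +
      (t n ^+ 2 * (2 * c * theta `^ (- alpha)) ^+ 2 * b n +
       t n * (K * c * theta `^ (2 - alpha) / eps ^+ 2))) @ \oo -->
   L * ((y - eps) `^ (- alpha) * S) +
      L * ((y - eps) `^ (- alpha) * kappa k) +
      (L ^+ 2 * (2 * c * theta `^ (- alpha)) ^+ 2 * 0 +
       L * (K * c * theta `^ (2 - alpha) / eps ^+ 2)).
  apply: cvgD; first by apply: cvgD; apply: cvgMl.
  apply: cvgD; last exact: cvgMl.
  apply: cvgM => //; apply: cvgMl.
  by rewrite expr2; under eq_fun do rewrite expr2; exact: cvgM.
have loc : (fun n => t n * ((y + eps) `^ (- alpha) * S) -
      t n ^+ 2 * (c * (y + eps) `^ (- alpha)) ^+ 2 * b n -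
      (t n ^+ 2 * (2 * c * theta `^ (- alpha)) ^+ 2 * b n +
       t n * (K * c * theta `^ (2 - alpha) / eps ^+ 2))) @ \oo -->
  L * ((y + eps) `^ (- alpha) * S) -
      L ^+ 2 * (c * (y + eps) `^ (- alpha)) ^+ 2 * 0 -
      (L ^+ 2 * (2 * c * theta `^ (- alpha)) ^+ 2 * 0 +
       L * (K * c * theta `^ (2 - alpha) / eps ^+ 2)).
  have t2 : (fun n => t n ^+ 2) @ \oo --> L ^+ 2.
    by rewrite expr2; under eq_fun do rewrite expr2; exact: cvgM.
  apply: cvgB; first apply: cvgB; first exact: cvgMl.
    by apply: cvgM => //; exact: cvgMl.
  apply: cvgD; last exact: cvgMl.
  by apply: cvgM => //; exact: cvgMl.
have epsy' : 0 < eps < y by rewrite eps0.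
have := up eps theta k epsy' theta0.
have := lo eps theta epsy' (_ : 0 < theta < y).
rewrite theta0 thetay => /(_ isT).
move/cvgrPdist_lt : upc => /(_ _ e40); move/cvgrPdist_lt : loc => /(_ _ e40).
move=> H1 H2 H3 H4.
apply: (filterS _ (filterI (filterI H1 H2) (filterI H3 H4))).
move=> n [[q1 q2] [q3 q4]].
move: q1 q2; rewrite !ltr_norml ler_norml => /andP[_ q1] /andP[q2 _].
by apply/andP; split; lra.
Unshelve. all: by end_near.
Qed.

End LimitSqueeze.

(** * Lattice point counts *)

Section LatticeQuotient.
Context (d p q l : nat) (K F H : set 'cV[int]_d) (x : 'I_l -> 'cV[int]_d)
  (U : 'M[int]_(d, p)) (V : 'M[int]_(d, q)).
Hypotheses (hU : Zbasis U F) (hV : Zbasis V K)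
  (FK0 : forall t, F t -> K t -> t = 0)
  (hx : coset_representatives x F K) (hH : H = coset_union x F).

Let subgroup r (B : 'M[int]_(d, r)) (L : set 'cV[int]_d) : Zbasis B L ->
  L 0 /\ (forall s t, L s -> L t -> L (s - t)).
Proof.
move=> [BL _ LB]; split; first by rewrite -(mulmx0 _ B); exact: BL.
by move=> _ _ /LB[a _ <-] /LB[b _ <-]; rewrite -mulmxBr; exact: BL.
Qed.

Let K0 : K 0. Proof. by have [] := subgroup hV. Qed.
Let KB s t : K s -> K t -> K (s - t). Proof. by have [_] := subgroup hV; exact. Qed.
Let KN t : K t -> K (- t). Proof. by move=> Kt; rewrite -sub0r; exact: KB. Qed.
Let FB s t : F s -> F t -> F (s - t). Proof. by have [_] := subgroup hU; exact. Qed.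

(** Both points have the same coset representative, so they differ by an element of [F]; it also
    lies in [K], hence vanishes. *)
Lemma coset_section s s' : H s -> H s' -> K (s - s') -> s = s'.
Proof.
rewrite hH => -[i [f Ff ->]] [k [f' Ff' ->]] Kss.
have [j [_ j_uniq]] := hx (x i + f).
have ij : j = i by apply: j_uniq; exists f, 0; split => //; rewrite addr0.
have kj : j = k.
  apply: j_uniq; exists f', (x i + f - (x k + f')); split => //.
  by rewrite addrA [RHS]addrC subrK.
move: Kss; rewrite -ij -kj opprD addrACA subrr add0r => Kff.
by rewrite (_ : f = f')//; apply/eqP; rewrite -subr_eq0; apply/eqP/FK0 => //; exact: FB.
Qed.

Lemma coset_projP t : H (coset_proj K H t) /\ K (t - coset_proj K H t).
Proof.
rewrite /coset_proj; case: xgetP => [y _ //|/=].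
have [i [[f [v [Ff Kv tE]]] _]] := hx t.
move=> /(_ (x i + f)) []; split.
  by rewrite hH; exists i => //; exists f.
by rewrite tE opprD addrACA subrr add0r addrAC subrr add0r.
Qed.

Lemma coset_proj_unique t s : H s -> K (t - s) -> coset_proj K H t = s.
Proof.
move=> Hs Kts; have [Ht Kt] := coset_projP t; apply: coset_section => //.
rewrite (_ : _ - _ = (t - s) - (t - coset_proj K H t)); first exact: KB.
by rewrite opprB [RHS]addrC addrA subrK.
Qed.

Lemma coset_proj_id s : H s -> coset_proj K H s = s.
Proof. by move=> Hs; apply: coset_proj_unique => //; rewrite subrr. Qed.

Lemma coset_nonempty : H !=set0.
Proof. by exists (coset_proj K H 0); have [] := coset_projP 0. Qed.

Lemma oplus_bij s : set_bij H H (fun u => oplus K H u s).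
Proof.
split.
- by move=> u _; exact: (coset_projP _).1.
- move=> u u' /set_mem Hu /set_mem Hu' uu'; apply: coset_section => //.
  have [_ Ku] := coset_projP (u + s); have [_ Ku'] := coset_projP (u' + s).
  have := KB Ku Ku'; rewrite -/(oplus K H u s) -/(oplus K H u' s) uu'.
  by rewrite opprB addrA subrK opprD addrACA subrr addr0.
- move=> u' Hu'; have [Hu Ku] := coset_projP (u' - s).
  exists (coset_proj K H (u' - s)) => //; apply: coset_proj_unique => //.
  rewrite (_ : _ - _ = - (u' - s - coset_proj K H (u' - s))); first exact: KN.
  by rewrite !opprB addrA addrAC.
Qed.

Lemma oplus_injr u s s' : H s -> H s' ->
  oplus K H u s = oplus K H u s' -> s = s'.
Proof.
move=> Hs Hs' ss'; apply: coset_section => //.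
have [_ Ks] := coset_projP (u + s); have [_ Ks'] := coset_projP (u + s').
have := KB Ks Ks'; rewrite -/(oplus K H u s) -/(oplus K H u s') ss'.
by rewrite opprB addrA subrK opprD addrACA subrr add0r.
Qed.

(** Solving for [u] locates the points that a box element [t] moves to [b]: they come from [b - t],
    whose norm is at most the sum of the two norms. This is the origin of the enlarged box. *)
Lemma oplus_shift u t b : H u -> oplus K H u (coset_proj K H t) = b ->
  u = coset_proj K H (b - t).
Proof.
move=> Hu ub; apply/esym/coset_proj_unique => //.
have [_ Kt] := coset_projP t.
have [_] := coset_projP (u + coset_proj K H t).
rewrite -/(oplus K H u (coset_proj K H t)) ub => Ku.
rewrite (_ : b - t - u = - (u + coset_proj K H t - b) - (t - coset_proj K H t)).
  by apply: KB => //; exact: KN.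
by rewrite !opprB opprD !addrA subrK addrAC.
Qed.

Lemma coset_repr t : exists i a b, t = x i + (U *m a + V *m b).
Proof.
have [i [[f [v [Ff Kv tE]]] _]] := hx t.
have [_ _ /(_ _ Ff)[a _ fE]] := hU; have [_ _ /(_ _ Kv)[b _ vE]] := hV.
by exists i, a, b; rewrite fE vE.
Qed.

(** Pigeonhole: two of the first [l.+1] multiples of [t] lie in the same coset, and their difference
    is the required multiple. Over the reals it follows that the columns of [U] and [V] span the
    whole space. *)
Lemma multiple_in_sum (t : 'cV[int]_d) : exists N a b,
  (0 < N)%N /\ t *+ N = U *m a + V *m b.
Proof.
pose idx s := projT1 (cid (hx s)).
have idxP s : exists a b, s = x (idx s) + (U *m a + V *m b).
  rewrite /idx; case: cid => i /= [[f [v [Ff Kv tE]]] _].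
  have [_ _ /(_ _ Ff)[a _ fE]] := hU; have [_ _ /(_ _ Kv)[b _ vE]] := hV.
  by exists a, b; rewrite fE vE.
have [m [m' [mm' imm']]] : exists m m' : 'I_l.+1, m != m' /\ idx (t *+ m) = idx (t *+ m').
  apply: contrapT => h; have inj : injective (fun m : 'I_l.+1 => idx (t *+ m)).
    by move=> m m' E; apply/eqP/negPn/negP => mm'; apply: h; exists m, m'.
  by have := leq_card _ inj; rewrite !card_ord ltnn.
wlog lt_mm' : m m' mm' imm' / (m' < m)%N.
  move=> wl; move: (mm'); rewrite neq_ltn => /orP[h|h]; last exact: (wl m m').
  by apply: (wl m' m) => //; rewrite eq_sym.
have [a [b E]] := idxP (t *+ m); have [a' [b' E']] := idxP (t *+ m').
exists (m - m')%N, (a - a'), (b - b'); split; first by rewrite subn_gt0.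
rewrite mulrnBr; last exact: ltnW.
by rewrite E E' imm' opprD addrACA subrr add0r !mulmxBr opprD addrACA.
Qed.

End LatticeQuotient.

Section IntegerBoxes.
Context (R : realType) (p : nat).

Lemma finite_int_ball (n : nat) :
  finite_set [set a : 'cV[int]_p | forall i, (`|a i ord0| <= n)%N].
Proof.
pose f (m : 'cV['I_(n + n).+1]_p) : 'cV[int]_p := \col_i ((m i ord0)%:Z - n%:Z).
apply: (@sub_finite_set _ _ (range f)); last exact: finite_image.
move=> a /= an; exists (\col_i inord `|(a i ord0 + n%:Z)%R|%N) => //.
apply/colP => i; rewrite !mxE inordK; have : (`|(a i 0)%R| <= n)%N := an i.
  by move: (a i 0) => z; lia.
have -> : a i ord0 = a i 0 by [].
by move: (a i 0) => z; lia.
Qed.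

(** An open interval of length w contains at most w + 1 integers. Offsets from the first integer
    above [lo] encode the points injectively as finite functions. *)
Lemma int_box_count (s : seq 'cV[int]_p) (lo hi : 'I_p -> R) : uniq s ->
  (forall i, lo i <= hi i) ->
  (forall a, a \in s -> forall i, lo i < (a i ord0)%:~R < hi i) ->
  (size s)%:R <= \prod_(i < p) (hi i - lo i + 1).
Proof.
move=> us lohi sbox; pose n i := (Num.truncn (hi i - lo i)).+1.
pose M := \max_(i < p) n i.
pose shift (a : 'cV[int]_p) i := `|(a i ord0 - (Num.floor (lo i) + 1))%R|%N.
have shiftP a i : a \in s -> (shift a i < n i)%N /\
    a i ord0 = (shift a i)%:Z + (Num.floor (lo i) + 1).
  move=> /sbox/(_ i)/andP[loa ahi].
  have fa : Num.floor (lo i) + 1 <= a i ord0.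
    by rewrite -ltzD1 ltrD2r real_floor_lt_int ?num_real.
  have aE : a i ord0 = (shift a i)%:Z + (Num.floor (lo i) + 1).
    by rewrite /shift gez0_abs ?subr_ge0// subrK.
  split=> //; rewrite /n ltnS; rewrite truncn_ge_nat ?subr_ge0//.
  have := real_floorD1_gt (num_real (lo i)).
  move: ahi; rewrite {1}aE intrD => ahi lofl.
  rewrite -[X in X <= _]/((Posz (shift a i))%:~R) ltW//.
  by rewrite ltrBrDr (lt_trans _ ahi)// ltrD2l.
pose F (i : 'I_p) : pred 'I_M.+1 := fun m => (m < n i)%N.
pose enc a := [ffun i : 'I_p => inord (shift a i) : 'I_M.+1].
have nM i : (n i <= M)%N by rewrite /M; exact: leq_bigmax.
have encE a i : a \in s -> enc a i = shift a i :> nat.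
  move=> sa; rewrite ffunE inordK//.
  by have [h _] := shiftP a i sa; rewrite ltnS ltnW// (leq_trans h).
have encF a : a \in s -> enc a \in family F.
  by move=> sa; apply/familyP => i; rewrite unfold_in /F encE//; have [] := shiftP a i sa.
have inj : {in s &, injective enc}.
  move=> a b sa sb E; apply/colP => i.
  have [_ ->] := shiftP a i sa; have [_ ->] := shiftP b i sb.
  by rewrite -encE// E encE.
have : (size s <= #|family F|)%N.
  rewrite -(size_map enc) -(card_uniqP _); last by rewrite map_inj_in_uniq.
  by apply: subset_leq_card; apply/fintype.subsetP => _ /mapP[a sa ->]; exact: encF.
rewrite card_family foldrE big_map big_enum/= -(ler_nat R) => /le_trans; apply.
rewrite natr_prod; apply: ler_prod => i _; rewrite ler0n/=.
have -> : #|F i| = n i.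
  rewrite -sum1_card (eq_bigl (fun m : 'I_M.+1 => (m < n i)%N))//.
  by rewrite -(big_ord_widen _ (fun=> 1%N)) ?leqW// sum1_card card_ord.
by rewrite /n -natr1 lerD2r truncn_le subr_ge0.
Qed.

End IntegerBoxes.

Section MatrixNorm.
Context (R : realType).

Lemma mx_norm_leP (m n : nat) (A : 'M[R]_(m, n)) (r : R) : 0 <= r ->
  `|A| <= r <-> forall i j, `|A i j| <= r.
Proof.
move=> r0; rewrite /Num.norm/= mx_normrE; split => [/bigmax_leP[_ h] i j|h].
  exact: (h (i, j)).
by apply/bigmax_leP; split => // -[i j] _; exact: h.
Qed.

Lemma mx_norm_coord (m n : nat) (A : 'M[R]_(m, n)) i j : `|A i j| <= `|A|.
Proof. by move: i j; apply/mx_norm_leP. Qed.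

Lemma mulmx_col_le (m n : nat) (A : 'M[R]_(m, n)) (z : 'cV[R]_n) (r : R) : 0 <= r ->
  `|z| <= r -> `|A *m z| <= n%:R * `|A| * r.
Proof.
move=> r0 zr; apply/mx_norm_leP; first by rewrite !mulr_ge0.
move=> i k; rewrite mxE (le_trans (ler_norm_sum _ _ _))//.
apply: (@le_trans _ _ (\sum_(j < n) (`|A| * r))); last first.
  by rewrite sumr_const card_ord -mulrA mulr_natl.
apply: ler_sum => j _; rewrite normrM ler_pM//; first exact: mx_norm_coord.
by rewrite (le_trans _ zr)//; exact: mx_norm_coord.
Qed.

End MatrixNorm.

(** * Lattice points in dilated slabs *)

Section SlabCounting.
Context (R : realType) (d p q : nat) (U : 'M[int]_(d, p)) (V : 'M[int]_(d, q)).
Notation Ur := (map_mx intr U : 'M[R]_(d, p)).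
Notation Vr := (map_mx intr V : 'M[R]_(d, q)).

(** For positive [r] this is the dilate by [r] of [Delta R U V], which is the case [r = 1]. *)
Definition slab (r : R) : set 'cV[R]_p :=
  [set y | exists lam : 'cV[R]_q, `|Ur *m y + Vr *m lam| <= r].

Definition slab_points (r : R) : set 'cV[int]_p :=
  [set a | slab r (map_mx intr a)].

Definition slab_count (r : R) : nat := #|` fset_set (slab_points r)|.

(* Moving y by at most 1 in every coordinate moves Ur *m y by at most this much. *)
Definition slab_defect : R := p%:R * (`|Ur|).

Lemma slabZ (c r : R) (y : 'cV[R]_p) : 0 <= c -> slab r y -> slab (c * r) (c *: y).
Proof.
move=> c0 [lam h]; exists (c *: lam); rewrite -!scalemxAr -scalerDr normrZ.
by rewrite ger0_norm// ler_wpM2l.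
Qed.

Lemma slab_perturb (r : R) (y z : 'cV[R]_p) : (forall i, `|y i ord0 - z i ord0| <= 1) ->
  slab r y -> slab (r + slab_defect) z.
Proof.
move=> yz [lam h]; exists lam.
have -> : Ur *m z + Vr *m lam = Ur *m y + Vr *m lam - Ur *m (y - z).
  by rewrite mulmxBr opprB [RHS]addrC addrA subrK.
apply: (le_trans (ler_normB _ _)); apply: lerD => //.
rewrite -[slab_defect]mulr1; apply: mulmx_col_le => //.
by apply/mx_norm_leP => // i j; rewrite ord1 !mxE; exact: yz.
Qed.

(** [Lt] reads off the coordinates along [U] modulo the real span of [V]. It makes the slab the
    linear image of a ball, hence bounded. *)
Variable Lt : 'M[R]_(p, d).
Hypotheses (LU : Lt *m Ur = 1%:M) (LV : Lt *m Vr = 0)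
  (LR : forall z : 'cV[R]_d, exists lam, z = Ur *m (Lt *m z) + Vr *m lam).

Lemma slab_proj (r : R) (y : 'cV[R]_p) :
  slab r y <-> exists2 z : 'cV[R]_d, `|z| <= r & y = Lt *m z.
Proof.
split=> [[lam h]|[z h ->]].
  exists (Ur *m y + Vr *m lam) => //.
  by rewrite mulmxDr !mulmxA LU LV mul1mx mul0mx addr0.
by have [lam zE] := LR z; exists lam; rewrite -zE.
Qed.

Lemma finite_slab_points (r : R) : finite_set (slab_points r).
Proof.
have [r0|r0] := ltP r 0.
  rewrite (_ : slab_points r = set0)//; apply/seteqP; split => // a [lam h].
  by move: h; rewrite leNgt (lt_le_trans r0).
pose n := Num.bound (d%:R * `|Lt| * r).
apply: (sub_finite_set _ (finite_int_ball p n)) => a /slab_proj[z zr aE] i.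
have : `|(a i ord0)%:~R| <= d%:R * `|Lt| * r :> R.
  have := mulmx_col_le Lt r0 zr; rewrite -aE; apply: le_trans.
  by have := mx_norm_coord (map_mx intr a : 'cV[R]_p) i ord0; rewrite mxE.
have h0 : 0 <= d%:R * `|Lt| * r by rewrite !mulr_ge0.
move=> /le_lt_trans/(_ (archi_boundP h0)).
by rewrite -intr_norm -[X in _ < X]/(n%:~R) ltr_int => h; lia.
Qed.

Lemma slab_countE (r : R) (a : 'cV[int]_p) :
  (a \in fset_set (slab_points r)) = (a \in slab_points r).
Proof. by rewrite in_fset_set//; exact: finite_slab_points. Qed.

Hypothesis p0 : (0 < p)%N.

(** The cells of side 1/r at the lattice points scaled by 1/r cover the slab: rounding [r *: y] down
    moves it by at most 1 in each coordinate, which [slab_defect] absorbs. *)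
Lemma Leb_slab_le (r : R) : 0 < r ->
  (Leb (slab 1) <= ((slab_count (r + slab_defect))%:R / r ^+ p)%:E)%E.
Proof.
move=> r0; set G := fset_set (slab_points (r + slab_defect)).
pose s : seq 'cV[int]_p := G.
(* Beyond the finitely many lattice points the cover is padded with degenerate boxes, of volume 0
   since [p] is positive. *)
pose lo k : 'cV[R]_p := if (k < size s)%N then r^-1 *: map_mx intr (nth 0 s k) else 0.
pose hi k : 'cV[R]_p := if (k < size s)%N then
  \col_i ((((nth 0 s k) i ord0)%:~R + 1) / r) else 0.
have side k (i : 'I_p) : hi k i ord0 - lo k i ord0 = if (k < size s)%N then r^-1 else 0.
  rewrite /hi /lo; case: ifP => _; last by rewrite !mxE subrr.
  by rewrite !mxE mulrDl mul1r mulrC addrAC subrr add0r.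
have vol k : \prod_(i < p) (hi k i ord0 - lo k i ord0) =
    if (k < size s)%N then r ^- p else 0.
  under eq_bigr do rewrite side.
  rewrite prodr_const card_ord; case: ifP => _; first by rewrite exprVn.
  by rewrite expr0n gtn_eqF.
have r_ge0 : 0 <= r ^- p by rewrite invr_ge0 exprn_ge0// ltW.
have <- : (\sum_(0 <= k <oo)
    (\prod_(i < p) (hi k i ord0 - lo k i ord0))%:E =
    ((slab_count (r + slab_defect))%:R / r ^+ p)%:E)%E.
  under eq_eseriesr do rewrite vol.
  rewrite (nneseries_split 0%N (size s)); last first.
    by move=> k _; case: ifP; rewrite lee_fin.
  rewrite add0n [X in (_ + X)%E]eseries0 ?adde0; last first.
    by move=> k; rewrite leqNgt => /negbTE ->.
  rewrite (eq_big_nat _ _ (F2 := fun=> (r ^- p)%:E)); last first.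
    by move=> k /andP[_ ->].
  rewrite sumEFin sumr_const_nat subn0; congr EFin.
  by rewrite -[LHS]mulr_natl.
apply: ereal_inf_lbound; exists (lo, hi) => //; split.
  move=> k i /=; rewrite -subr_ge0 side; case: ifP => // _.
  by rewrite invr_ge0 ltW.
move=> y y1; pose a : 'cV[int]_p := \col_i Num.floor (r * y i ord0).
have fl i : (a i ord0)%:~R <= r * y i ord0 < (a i ord0)%:~R + 1.
  rewrite mxE; have := real_floor_itv (num_real (r * y i ord0)).
  by rewrite intrD.
have aG : a \in s.
  rewrite /s /G slab_countE; apply/mem_set; rewrite /slab_points /=.
  apply: (slab_perturb (y := r *: y)).
    move=> i; rewrite !mxE; have /andP[h1 h2] := fl i.
    rewrite ler_norml; move: h1 h2; rewrite !mxE => h1 h2.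
    by apply/andP; split; lra.
  by rewrite -[X in slab X]mulr1; apply: slabZ => //; exact: ltW.
exists (index a s) => // i /=.
rewrite /lo /hi index_mem aG !mxE nth_index//.
have /andP[h1 h2] := fl i.
by rewrite ler_pdivlMr// ler_pdivrMl// h1 mulrC ltW.
Qed.

End SlabCounting.

Section FiniteSums.
Context (R : realType).

Lemma size_le_sum_filter (T I : eqType) (s : seq T) (D : seq I) (Q : I -> pred T) :
  (forall a, a \in s -> exists2 k, k \in D & Q k a) ->
  (size s <= \sum_(k <- D) size (seq.filter (Q k) s))%N.
Proof.
elim: s => [|a s IH] h //=.
have -> : (\sum_(k <- D) size (if Q k a then a :: seq.filter (Q k) s else seq.filter (Q k) s) =
    \sum_(k <- D) Q k a + \sum_(k <- D) size (seq.filter (Q k) s))%N.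
  by rewrite -big_split; apply: eq_bigr => k _; case: ifP.
rewrite -[(size s).+1]add1n leq_add//; last first.
  by apply: IH => b sb; apply: h; rewrite inE sb orbT.
have [k kD Qk] := h a (mem_head _ _).
by rewrite (big_rem k)//= Qk.
Qed.

Lemma sum_seq_le_nat (D : seq nat) (f : nat -> R) : uniq D -> (forall k, 0 <= f k) ->
  exists N, \sum_(k <- D) f k <= \sum_(0 <= k < N) f k.
Proof.
move=> uD f0; exists (\max_(k <- D) k).+1; set N := _.+1.
have -> : \sum_(k <- D) f k = \sum_(k <- index_iota 0 N | k \in D) f k.
  rewrite -[RHS]big_filter; apply: perm_big; apply: uniq_perm => //.
    by rewrite filter_uniq// iota_uniq.
  move=> k; rewrite mem_filter mem_index_iota/=.
  by case: (boolP (k \in D)) => //= kD; rewrite ltnS leq_bigmax_seq.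
by rewrite big_mkcond; apply: ler_sum => k _; case: ifP.
Qed.

Lemma half_powers_le1 N : \sum_(0 <= k < N) (2 ^- k.+1) <= 1 :> R.
Proof.
suff -> : \sum_(0 <= k < N) (2 ^- k.+1) = 1 - 2 ^- N :> R.
  by rewrite lerBlDr lerDl invr_ge0 exprn_ge0.
elim: N => [|N IH]; first by rewrite big_geq// expr0 invr1 subrr.
rewrite big_nat_recr//= IH exprS; have : (2 : R) ^+ N != 0 by rewrite expf_neq0.
by move: (2 ^+ N) => x x0; field.
Qed.

Lemma cvg_big_prod (T : Type) (F : set_system T) (n : nat)
    (f : 'I_n -> T -> R) (l : 'I_n -> R) : Filter F ->
  (forall i, f i x @[x --> F] --> l i) ->
  \prod_(i < n) f i x @[x --> F] --> \prod_(i < n) l i.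
Proof. by move=> FF fl; apply: cvg_big => //; exact: mul_continuous. Qed.

End FiniteSums.

(** * Counting by means of an arbitrary cover *)

Section SlabUpperCount.
Context (R : realType) (d p q : nat) (U : 'M[int]_(d, p)) (V : 'M[int]_(d, q)).
Notation Ur := (map_mx intr U : 'M[R]_(d, p)).
Notation Vr := (map_mx intr V : 'M[R]_(d, q)).
Notation slab := (slab U V).
Notation slab_points := (slab_points (R := R) U V).
Notation slab_count := (slab_count (R := R) U V).
Variable Lt : 'M[R]_(p, d).
Hypotheses (LU : Lt *m Ur = 1%:M) (LV : Lt *m Vr = 0)
  (LR : forall z : 'cV[R]_d, exists lam, z = Ur *m (Lt *m z) + Vr *m lam).

Let slab_projE := slab_proj LU LV LR.

(** The cover of the slab is pulled back along [Lt] to the unit cube of R^d, which is compact as a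
    product of segments; points of the cube are row vectors. *)
Let coord (i : 'I_p) (z : 'rV[R]_d) : R := (Lt *m z^T) i ord0.

Let coord_cont i : continuous (coord i).
Proof.
rewrite (_ : coord i = fun z => \sum_(j < d) Lt i j * z ord0 j).
  apply: continuous_big => [|j _ z]; first exact: add_continuous.
  by apply: cvgMr; [exact: nbhs_filter|exact: coord_continuous].
by apply/funext => z; rewrite /coord mxE; apply: eq_bigr => j _; rewrite mxE.
Qed.

Let open_box (lo hi : 'I_p -> R) :
  open [set z : 'rV[R]_d | forall i, lo i < coord i z < hi i].
Proof.
rewrite openE => z /= zb.
suff : \forall t \near z, forall i, lo i < coord i t < hi i by [].
apply: (@filter_forall _ _ (fun i t => lo i < coord i t < hi i) (nbhs z)) => i.
have /andP[h1 h2] := zb i.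
near=> t; apply/andP; split; near: t.
- by apply: cvgr_gt h1; exact: coord_cont.
- by apply: cvgr_lt h2; exact: coord_cont.
Unshelve. all: by end_near. Qed.

Let cube := [set z : 'rV[R]_d | forall j, `[-1, 1]%classic (z ord0 j)].

Let cube_compact : compact cube.
Proof. by apply: (@rV_compact R d (fun=> `[-1, 1]%classic)) => j; exact: segment_compact. Qed.

(* Enlarging the k-th box by eta_k gives an open cover, of which the compact slab needs
   only finitely many members; lattice points are then counted box by box. *)
Lemma slab_count_cover (lo hi : nat -> 'cV[R]_p) (v e : R) : 0 < e ->
  (forall k i, lo k i ord0 <= hi k i ord0) ->
  slab 1 `<=` \bigcup_k [set y : 'cV[R]_p |
                  forall i, lo k i ord0 <= y i ord0 <= hi k i ord0] ->
  (\sum_(0 <= k <oo) (\prod_(i < p) (hi k i ord0 - lo k i ord0))%:E <= v%:E)%E ->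
  exists2 r0, 0 < r0 & forall r, r0 <= r -> (slab_count r)%:R <= (v + e) * r ^+ p.
Proof.
move=> e0 lohi cov vol.
pose w k i := hi k i ord0 - lo k i ord0.
have w0 k i : 0 <= w k i by rewrite subr_ge0.
(* The volumes added to the boxes sum to at most [e / 2]. *)
have fatten k : {eta | 0 < eta &
    \prod_(i < p) (w k i + 2 * eta) <= \prod_(i < p) w k i + e / 2 * 2 ^- k.+1}.
  apply: cid2.
  have ek : 0 < e / 2 * 2 ^- k.+1 by rewrite mulr_gt0 ?divr_gt0 ?invr_gt0 ?exprn_gt0.
  have : \prod_(i < p) (w k i + 2 * eta) @[eta --> (0 : R)^'+] --> \prod_(i < p) (w k i + 2 * 0).
    apply: cvg_big_prod => // i; apply: cvgD; first exact: cvg_cst.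
    by apply: cvgMr; apply: cvg_at_right_filter; exact: cvg_id.
  under [X in _ --> X]eq_bigr do rewrite mulr0 addr0.
  move=> /cvgr_lt/(_ (\prod_(i < p) w k i + e / 2 * 2 ^- k.+1)).
  rewrite ltrDl => /(_ ek) h.
  near (0 : R)^'+ => eta; exists eta => //.
  by apply: ltW; near: eta.
pose eta k := s2val (fatten k).
have eta0 k : 0 < eta k by rewrite /eta; case: (fatten k).
have etaP k : \prod_(i < p) (w k i + 2 * eta k) <= \prod_(i < p) w k i + e / 2 * 2 ^- k.+1.
  by rewrite /eta; case: (fatten k).
pose O k := [set z : 'rV[R]_d |
  forall i, lo k i ord0 - eta k < coord i z < hi k i ord0 + eta k].
have [D _ cubeD] : finite_subset_cover [set: nat] O cube.
  move: cube_compact; rewrite compact_cover; apply.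
    by move=> k _; exact: (@open_box (fun i => lo k i ord0 - eta k) (fun i => hi k i ord0 + eta k)).
  move=> z zc; have : slab 1 (Lt *m z^T).
    apply/slab_projE; exists z^T => //; apply/mx_norm_leP => // j i.
    by rewrite ord1 mxE ler_norml; have := zc j; rewrite /= in_itv.
  move=> /cov[k _ hk]; exists k => // i; have /andP[h1 h2] := hk i.
  by rewrite /coord; have := eta0 k; move: h1 h2; lra.
pose W k i := w k i + 2 * eta k.
have W0 k i : 0 < W k i by rewrite ltr_wpDl// mulr_gt0.
have count_le r : 0 < r ->
    (slab_count r)%:R <= \sum_(k <- D) \prod_(i < p) (r * W k i + 1).
  move=> r0; set G := fset_set (slab_points r).
  pose Q k : pred 'cV[int]_p := fun a => `[< forall i,
    r * (lo k i ord0 - eta k) < (a i ord0)%:~R < r * (hi k i ord0 + eta k) >].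
  have cG : forall a, a \in (G : seq _) -> exists2 k, k \in (D : seq _) & Q k a.
    move=> a; rewrite /G (slab_countE LU LV LR) => /set_mem/slab_projE[z zr aE].
    have zc : cube (r^-1 *: z^T).
      move=> j /=; rewrite in_itv/= -ler_norml !mxE normrM gtr0_norm ?invr_gt0//.
      by rewrite ler_pdivrMl// mulr1 (le_trans _ zr)// mx_norm_coord.
    have [k kD hk] := cubeD _ zc; exists k => //; apply/asboolP => i.
    have := hk i; rewrite /coord linearZ/= trmxK -scalemxAr -aE !mxE => /andP[h1 h2].
    by rewrite -ltr_pdivlMl// h1/= -ltr_pdivrMl.
  rewrite (le_trans (_ : _ <= (\sum_(k <- D) size (seq.filter (Q k) G))%:R))//.
    rewrite ler_nat; exact: (size_le_sum_filter cG).
  rewrite natr_sum; apply: ler_sum => k _.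
  apply: (le_trans (int_box_count (lo := fun i => r * (lo k i ord0 - eta k))
    (hi := fun i => r * (hi k i ord0 + eta k)) _ _ _)).
  - apply: filter_uniq; exact: fset_uniq.
  - move=> i; rewrite ler_pM2l//; have := lohi k i; have := eta0 k; lra.
  - by move=> a; rewrite mem_filter => /andP[/asboolP].
  apply: ler_prod => i _; rewrite -mulrBr.
  have hW : hi k i ord0 + eta k - (lo k i ord0 - eta k) = W k i by rewrite /W /w; ring.
  by rewrite hW lexx andbT addr_ge0// mulr_ge0// ltW.
have sumW : \sum_(k <- D) \prod_(i < p) W k i <= v + e / 2.
  have f0 k : 0 <= \prod_(i < p) w k i + e / 2 * 2 ^- k.+1.
    rewrite addr_ge0 ?prodr_ge0//.
    by rewrite mulr_ge0 ?divr_ge0 ?invr_ge0 ?exprn_ge0// ltW.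
  have [N DN] := sum_seq_le_nat (fset_uniq D) f0.
  apply: (le_trans (_ : _ <= \sum_(k <- D) (\prod_(i < p) w k i + e / 2 * 2 ^- k.+1))).
    by apply: ler_sum => k _; exact: etaP.
  apply: (le_trans DN); rewrite big_split/= -mulr_sumr; apply: lerD.
    rewrite -lee_fin -sumEFin; apply: le_trans vol.
    by apply: nneseries_lim_ge => k _; rewrite lee_fin prodr_ge0.
  by rewrite ler_piMr ?divr_ge0 ?(ltW e0)// half_powers_le1.
(* Counting integers adds 1 to each side [r * W k i], that is 1/r to [W k i]. Over the finitely many
   boxes of [D] this costs less than the remaining [e / 2] when 1/r is small. *)
have : \sum_(k <- D) \prod_(i < p) (W k i + x) @[x --> (0 : R)^'+] -->
    \sum_(k <- D) \prod_(i < p) (W k i + 0).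
  apply: cvg_big => [|k _]; first exact: add_continuous.
  apply: cvg_big_prod => // i; apply: cvgD; first exact: cvg_cst.
  by apply: cvg_at_right_filter; exact: cvg_id.
under [X in _ --> X]eq_bigr do under eq_bigr do rewrite addr0.
move=> /cvgr_lt/(_ (v + e)) /(_ _)[|x0 /= x00 hx].
  by apply: (le_lt_trans sumW); rewrite ltrD2l ltr_pdivrMr// mulr_natr mulr2n ltrDl.
exists (2 / x0); first by rewrite divr_gt0.
move=> r rx; have r0 : 0 < r by rewrite (lt_le_trans _ rx)// divr_gt0.
apply: (le_trans (count_le r r0)).
have -> : \sum_(k <- D) \prod_(i < p) (r * W k i + 1) =
    (\sum_(k <- D) \prod_(i < p) (W k i + r^-1)) * r ^+ p.
  rewrite mulr_suml; apply: eq_bigr => k _.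
  have -> : r ^+ p = \prod_(i < p) r by rewrite prodr_const card_ord.
  rewrite -big_split/=.
  apply: eq_bigr => i _; rewrite mulrDl mulVf ?gt_eqF//.
  by rewrite mulrC.
rewrite ler_wpM2r ?exprn_ge0 ?(ltW r0)// ltW//; apply: hx => /=.
- rewrite sub0r normrN gtr0_norm ?invr_gt0//.
  have xr : x0^-1 < r.
    by rewrite (lt_le_trans _ rx)// -[ltLHS]mul1r ltr_pM2r ?invr_gt0// ltr1n.
  by rewrite -[ltRHS]invrK ltf_pV2 ?posrE ?invr_gt0.
- by rewrite invr_gt0.
Unshelve. all: by end_near.
Qed.

End SlabUpperCount.

Lemma cvg_exprn (R : realType) (f : nat -> R) (l : R) (n : nat) :
  f @ \oo --> l -> (fun k => f k ^+ n) @ \oo --> l ^+ n.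
Proof.
move=> fl; elim: n => [|n IH]; first exact: cvg_cst.
by rewrite exprS; under eq_fun do rewrite exprS; exact: cvgM.
Qed.

(** Dividing the given combinations by [N] expresses each unit vector through the columns of [U] and
    [V]. The square block matrix of the two is thus invertible, and [Lt] is the upper block of its
    inverse. *)
Lemma slab_left_inverse (R : realType) (d p q : nat) (U : 'M[int]_(d, p))
    (V : 'M[int]_(d, q)) : d = (p + q)%N ->
  (forall t : 'cV[int]_d, exists N a b, (0 < N)%N /\ t *+ N = U *m a + V *m b) ->
  exists Lt : 'M[R]_(p, d), [/\ Lt *m map_mx intr U = 1%:M,
    Lt *m map_mx intr V = 0 &
    forall z : 'cV[R]_d, exists lam,
      z = map_mx intr U *m (Lt *m z) + map_mx intr V *m lam].
Proof.
move=> dpq; subst d => mult.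
pose Ur : 'M[R]_(p + q, p) := map_mx intr U.
pose Vr : 'M[R]_(p + q, q) := map_mx intr V.
have colP (i : 'I_(p + q)) : {c : 'cV[R]_(p + q) |
    row_mx Ur Vr *m c = delta_mx i ord0}.
  apply: cid; have [N [a [b [N0 E]]]] := mult (delta_mx i ord0).
  exists (N%:R^-1 *: col_mx (map_mx intr a) (map_mx intr b)).
  rewrite -scalemxAr mul_row_col -!map_mxM -map_mxD -E.
  have -> : map_mx intr (delta_mx i ord0 *+ N) = N%:R *: delta_mx i ord0 :> 'cV[R]_(p + q).
    apply/matrixP => r s; rewrite !mxE mulmxnE mxE.
    by rewrite rmorphMn/= mulr_natl; case: (_ && _).
  by rewrite scalerA mulVf ?scale1r// pnatr_eq0 -lt0n.
pose M : 'M[R]_(p + q) := \matrix_(i, j) projT1 (colP j) i ord0.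
have MR : row_mx Ur Vr *m M = 1%:M.
  apply/matrixP => i j; have /matrixP/(_ i ord0) := projT2 (colP j).
  rewrite !mxE eqxx andbT => E; rewrite -E; apply: eq_bigr => k _.
  by rewrite !mxE.
have := mulmx1C MR; rewrite -[M]vsubmxK mul_col_row scalar_mx_block.
move=> /eq_block_mx[LU LV _ _].
exists (usubmx M); split => // z; exists (dsubmx M *m z).
by rewrite !mulmxA -mulmxDl -mul_row_col vsubmxK MR mul1mx.
Qed.

(** * Asymptotic number of lattice points in a slab *)

Section SlabAsymptotics.
Context (R : realType) (d p q : nat) (U : 'M[int]_(d, p)) (V : 'M[int]_(d, q)).
Notation Ur := (map_mx intr U : 'M[R]_(d, p)).
Notation Vr := (map_mx intr V : 'M[R]_(d, q)).
Notation slab := (slab (R := R) U V).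
Notation slab_count := (slab_count (R := R) U V).
Variable Lt : 'M[R]_(p, d).
Hypotheses (LU : Lt *m Ur = 1%:M) (LV : Lt *m Vr = 0)
  (LR : forall z : 'cV[R]_d, exists lam, z = Ur *m (Lt *m z) + Vr *m lam)
  (p0 : (0 < p)%N).

Lemma Leb_ge0 (A : set 'cV[R]_p) : (0 <= Leb A)%E.
Proof.
apply: le_ereal_inf_tmp => _ [[lo hi] [lohi _] <-].
apply: nneseries_ge0 => k _ _; rewrite lee_fin prodr_ge0// => i _.
by rewrite subr_ge0; exact: lohi.
Qed.

Lemma Leb_slabE : Leb (slab 1) = (fine (Leb (slab 1)))%:E.
Proof.
rewrite fineK// ge0_fin_numE ?Leb_ge0//.
by rewrite (le_lt_trans (Leb_slab_le LU LV LR p0 ltr01))// ltry.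
Qed.

Let L := fine (Leb (slab 1)).

Lemma slab_count_upper (e : R) : 0 < e ->
  exists2 r0, 0 < r0 & forall r, r0 <= r -> (slab_count r)%:R <= (L + e) * r ^+ p.
Proof.
move=> e0; have e20 : 0 < e / 2 by rewrite divr_gt0.
have fin : Leb (slab 1) \is a fin_num by rewrite Leb_slabE.
have [_ [[lo hi] [lohi cov] <-] vol] := lb_ereal_inf_adherent e20 fin.
have vol' : (\sum_(0 <= k <oo) (\prod_(i < p) (hi k i ord0 - lo k i ord0))%:E <=
    (L + e / 2)%:E)%E.
  by apply: ltW; rewrite EFinD -Leb_slabE.
have [r0 r00 h] := slab_count_cover LU LV LR e20 lohi cov vol'.
exists r0 => // r rr; apply: (le_trans (h r rr)); rewrite le_eqVlt.
by apply/orP; left; apply/eqP; field.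
Qed.

Lemma slab_count_lower (r : R) : slab_defect R U < r ->
  L * (r - slab_defect R U) ^+ p <= (slab_count r)%:R.
Proof.
move=> dr; have rd : 0 < r - slab_defect R U by rewrite subr_gt0.
have := Leb_slab_le LU LV LR p0 rd; rewrite Leb_slabE subrK lee_fin.
by rewrite ler_pdivlMr// exprn_gt0.
Qed.

Lemma slab_count_cvg (rr : nat -> R) (lambda : R) : 0 < lambda ->
  rr n / n%:R @[n --> \oo] --> lambda ->
  (slab_count (rr n))%:R / n%:R ^+ p @[n --> \oo] --> lambda ^+ p * L.
Proof.
move=> la0 rrl.
have inv0 : (n%:R : R)^-1 @[n --> \oo] --> (0 : R).
  apply/gtr0_cvgV0; last exact: cvgr_idn.
  by near=> n; rewrite ltr0n; near: n; exact: nbhs_infty_gt.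
have rr_large (M : R) : \forall n \near \oo, M <= rr n.
  have la20 : 0 < lambda / 2 by rewrite divr_gt0.
  have la2 : lambda / 2 < lambda by rewrite ltr_pdivrMr// mulr_natr mulr2n ltrDl.
  near=> n; have n0 : 0 < n%:R :> R by rewrite ltr0n; near: n; exact: nbhs_infty_gt.
  have h1 : lambda / 2 < rr n / n%:R by near: n; exact: cvgr_gt la2.
  have h2 : M / (lambda / 2) <= n%:R by near: n; exact: nbhs_infty_ger.
  rewrite (le_trans (_ : _ <= lambda / 2 * n%:R))//.
    by rewrite -ler_pdivrMl// mulrC.
  by rewrite ltW// -ltr_pdivlMr.
have lowc : (fun n => L * (rr n / n%:R - slab_defect R U * n%:R^-1) ^+ p) @ \oo -->
    L * (lambda - slab_defect R U * 0) ^+ p.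
  by apply: cvgMr; apply: cvg_exprn; apply: cvgB => //; exact: cvgMr.
have upc e : (fun n => (L + e) * (rr n / n%:R) ^+ p) @ \oo --> (L + e) * lambda ^+ p.
  by apply: cvgMr; exact: cvg_exprn.
apply/cvgrPdist_le => eps eps0.
(* The excess [e] becomes [eps / 2] once multiplied by [lambda ^+ p]; the other half pays for the
   convergence in [n]. *)
pose e := eps / 2 / lambda ^+ p.
have lap : 0 < lambda ^+ p by rewrite exprn_gt0.
have e0 : 0 < e by rewrite !divr_gt0.
have [r0 r00 hr] := slab_count_upper e0.
have eps20 : 0 < eps / 2 by rewrite divr_gt0.
move/cvgrPdist_lt : lowc => /(_ _ eps0); move/cvgrPdist_lt : (upc e) => /(_ _ eps20).
move=> up low.
apply: (filterS _ (filterI (filterI up low) (filterI (rr_large r0)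
  (filterI (rr_large (slab_defect R U + 1)) (nbhs_infty_gt 0%N))))).
move=> n [[h1 h2] [h3 [h4 n0]]].
have n0' : 0 < n%:R :> R by rewrite ltr0n.
have np : 0 < n%:R ^+ p :> R by rewrite exprn_gt0.
have up' : (slab_count (rr n))%:R / n%:R ^+ p <= (L + e) * (rr n / n%:R) ^+ p.
  by rewrite ler_pdivrMr// expr_div_n mulrA divfK ?gt_eqF//; exact: hr.
have lo' : L * (rr n / n%:R - slab_defect R U * n%:R^-1) ^+ p <=
    (slab_count (rr n))%:R / n%:R ^+ p.
  rewrite ler_pdivlMr// -mulrBl expr_div_n mulrA divfK ?gt_eqF//.
  by apply: slab_count_lower; rewrite (lt_le_trans _ h4)// ltrDl.
move: h1 h2; rewrite mulr0 subr0 !ltr_norml ler_norml => /andP[h1 _] /andP[_ h2].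
have ee : e * lambda ^+ p = eps / 2 by rewrite /e divfK// gt_eqF.
rewrite mulrDl ee in h1.
by rewrite (mulrC (lambda ^+ p)); apply/andP; split; lra.
Unshelve. all: by end_near.
Qed.

End SlabAsymptotics.

(** * The projection of a box to the quotient *)

Section BoxProjection.
Context (R : realType) (d p q l : nat) (K F H : set 'cV[int]_d)
  (x : 'I_l -> 'cV[int]_d) (U : 'M[int]_(d, p)) (V : 'M[int]_(d, q)).
Hypotheses (hU : Zbasis U F) (hV : Zbasis V K)
  (FK0 : forall t, F t -> K t -> t = 0)
  (hx : coset_representatives x F K) (hH : H = coset_union x F)
  (dpq : d = (p + q)%N) (p0 : (0 < p)%N).
Notation Ur := (map_mx intr U : 'M[R]_(d, p)).
Notation Vr := (map_mx intr V : 'M[R]_(d, q)).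

Lemma supnorm_leP (t : 'cV[int]_d) n :
  (supnorm t <= n)%N <-> forall i, (`|t i ord0| <= n)%N.
Proof.
rewrite /supnorm; split=> [/bigmax_leqP h i|h]; first exact: h.
by apply/bigmax_leqP => i _; exact: h.
Qed.

Lemma supnormD_le (s t : 'cV[int]_d) m n : (supnorm s <= m)%N -> (supnorm t <= n)%N ->
  (supnorm (s - t) <= m + n)%N.
Proof.
move=> /supnorm_leP sm /supnorm_leP tn; apply/supnorm_leP => i.
rewrite !mxE -lez_nat abszE PoszD (le_trans (ler_normB _ _))//.
by rewrite lerD// -abszE lez_nat.
Qed.

Lemma supnorm_intr (t : 'cV[int]_d) n :
  `|map_mx intr t : 'cV[R]_d| <= n%:R <-> (supnorm t <= n)%N.
Proof.
rewrite mx_norm_leP// supnorm_leP; split=> h i.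
  by have := h i ord0; rewrite mxE -intr_norm -[X in _ <= X]/(n%:~R) ler_int -abszE lez_nat.
by move=> k; rewrite ord1 mxE -intr_norm -[X in _ <= X]/(n%:~R) ler_int -abszE lez_nat.
Qed.

Definition box_proj (n : nat) : {fset 'cV[int]_d} :=
  fset_set (coset_proj K H @` [set t | (supnorm t <= n)%N]).

Lemma finite_box n : finite_set [set t : 'cV[int]_d | (supnorm t <= n)%N].
Proof.
by apply: (sub_finite_set _ (finite_int_ball d n)) => t /supnorm_leP.
Qed.

Lemma mem_box_proj n s : s \in box_proj n <->
  exists2 t, (supnorm t <= n)%N & coset_proj K H t = s.
Proof.
rewrite /box_proj in_fset_set; last exact: finite_image (finite_box n).
by split => [/set_mem[t tn <-]|[t tn <-]]; [exists t|apply/mem_set; exists t].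
Qed.

(** A coset representative displaces a point by at most the first sum; rounding the real
    coefficients along [V] to integers displaces it by at most the second term. *)
Let width : R := \sum_(i < l) `|map_mx intr (x i) : 'cV[R]_d| + q%:R * `|Vr|.

Let width_x i : `|map_mx intr (x i) : 'cV[R]_d| <= \sum_(i < l) `|map_mx intr (x i) : 'cV[R]_d|.
Proof. by rewrite (bigD1 i)//= lerDl sumr_ge0. Qed.

Let coset_points (r : R) : seq 'cV[int]_d :=
  [seq x i + U *m a | i <- enum 'I_l, a <- (fset_set (slab_points (R := R) U V r) : seq _)].

Let size_coset_points r : size (coset_points r) = (l * slab_count U V r)%N.
Proof. by rewrite size_allpairs size_enum_ord. Qed.

Lemma slab_inverse_exists : exists Lt : 'M[R]_(p, d),
  [/\ Lt *m Ur = 1%:M, Lt *m Vr = 0 &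
    forall z : 'cV[R]_d, exists lam, z = Ur *m (Lt *m z) + Vr *m lam].
Proof.
apply: slab_left_inverse dpq _ => t.
exact: (multiple_in_sum hU hV hx).
Qed.

Let mem_slab_points r a : a \in (fset_set (slab_points (R := R) U V r) : seq _) <->
  slab_points U V r a.
Proof.
have [Lt [LU LV LR]] := slab_inverse_exists.
by rewrite (slab_countE LU LV LR); split => [/set_mem|/mem_set].
Qed.

Let coset_points_H i a : H (x i + U *m a).
Proof. by rewrite hH; exists i => //; exists (U *m a) => //; case: hU => + _ _; exact. Qed.

Let proj_coset_point i a b : coset_proj K H (x i + (U *m a + V *m b)) = x i + U *m a.
Proof.
apply: (coset_proj_unique hU hV FK0 hx hH) => //.
by rewrite opprD addrACA subrr add0r addrAC subrr add0r; case: hV => + _ _; exact.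
Qed.

Lemma box_proj_upper (n : nat) :
  (size (box_proj n) <= l * slab_count U V (n%:R + width))%N.
Proof.
rewrite -size_coset_points; apply: uniq_leq_size; first exact: fset_uniq.
move=> s /mem_box_proj[t tn <-].
have [i [a [b tE]]] := coset_repr hU hV hx t.
rewrite tE proj_coset_point; apply/allpairsP; exists (i, a); split => //=.
  by rewrite mem_enum.
apply/mem_slab_points; exists (map_mx intr b).
have -> : Ur *m map_mx intr a + Vr *m map_mx intr b =
    map_mx intr t - map_mx intr (x i).
  by rewrite -!map_mxM -map_mxD -map_mxB tE [x i + _]addrC addrK.
rewrite (le_trans (ler_normB _ _))// lerD//; first exact/supnorm_intr.
by rewrite (le_trans (width_x i))// lerDl.
Qed.

(** A slab point comes with real coefficients along [V]. Rounded down they give a lattice point, in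
    the box because [width] was subtracted, with the same projection. *)
Lemma box_proj_lower (n : nat) :
  (l * slab_count U V (n%:R - width) <= size (box_proj n))%N.
Proof.
rewrite -size_coset_points; apply: uniq_leq_size.
  apply: allpairs_uniq; [exact: enum_uniq|exact: fset_uniq|].
  move=> [i a] [i' a'] _ _ /= E.
  have [k [_ k_uniq]] := hx (x i + U *m a).
  have Fa a0 : F (U *m a0) by case: hU => + _ _; exact.
  have K0 : K 0 by rewrite -(mulmx0 _ V); case: hV => + _ _; exact.
  have ki : k = i by apply: k_uniq; exists (U *m a), 0; rewrite addr0.
  have ki' : k = i' by apply: k_uniq; exists (U *m a'), 0; rewrite addr0.
  move: E; rewrite -ki -ki' => /addrI E; congr (_, _).
  by have [_ injU _] := hU; apply: injU E; rewrite in_setT.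
move=> s /allpairsP[[i a] [_ /= /mem_slab_points[lam h] ->]].
pose b : 'cV[int]_q := \col_k Num.floor (lam k ord0).
apply/mem_box_proj; exists (x i + (U *m a + V *m b)); last exact: proj_coset_point.
apply/supnorm_intr.
have -> : map_mx intr (x i + (U *m a + V *m b)) =
    map_mx intr (x i) + (Ur *m map_mx intr a + Vr *m lam) - Vr *m (lam - map_mx intr b).
  rewrite !map_mxD !map_mxM mulmxBr opprB -!addrA; congr (_ + (_ + _)).
  by rewrite addrC subrK.
have lb : `|Vr *m (lam - map_mx intr b)| <= q%:R * `|Vr|.
  rewrite -[leRHS]mulr1; apply: mulmx_col_le => //.
  apply/mx_norm_leP => // k j; rewrite ord1 !mxE.
  have := real_floor_itv (num_real (lam k ord0)); rewrite intrD => /andP[h1 h2].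
  by rewrite ler_norml; apply/andP; split; move: h1 h2; lra.
rewrite (le_trans (ler_normB _ _))//.
have -> : n%:R = (\sum_(i < l) `|map_mx intr (x i) : 'cV[R]_d| + (n%:R - width)) +
    q%:R * `|Vr| by rewrite /width; ring.
by rewrite lerD// (le_trans (ler_normD _ _))// lerD.
Qed.

Lemma box_proj_cvg (k : nat -> nat) (C : nat) (lambda : R) : 0 < lambda ->
  (k n)%:R / n%:R @[n --> \oo] --> lambda ->
  (size (box_proj (k n + C)))%:R / n%:R ^+ p @[n --> \oo] -->
    lambda ^+ p * (l%:R * fine (Leb (slab (R := R) U V 1))).
Proof.
move=> la0 kl; have [Lt [LU LV LR]] := slab_inverse_exists.
have inv0 : (n%:R : R)^-1 @[n --> \oo] --> (0 : R).
  apply/gtr0_cvgV0; last exact: cvgr_idn.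
  by near=> n; rewrite ltr0n; near: n; exact: nbhs_infty_gt.
have shift (y : R) : ((k n + C)%:R + y) / n%:R @[n --> \oo] --> lambda.
  rewrite -[lambda]addr0 -(mulr0 (C%:R + y)).
  under eq_fun do rewrite natrD -addrA mulrDl.
  by apply: cvgD => //; exact: cvgMr.
have lc := slab_count_cvg LU LV LR p0 la0 (shift (- width)).
have uc := slab_count_cvg LU LV LR p0 la0 (shift width).
rewrite mulrCA.
apply: (squeeze_cvgr _ (cvgMr lc) (cvgMr uc)).
apply: nearW => n.
rewrite !mulrA -!natrM !ler_wpM2r ?invr_ge0 ?exprn_ge0//= ler_nat.
- exact: box_proj_upper.
- exact: box_proj_lower.
Unshelve. all: by end_near.
Qed.

End BoxProjection.

(** * Asymptotics of the maxima *)

Section NormalizingSequence.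
Context (R : realType).

Lemma powR_cvg_to0 (alpha : R) (z : nat -> R) : 0 < alpha -> (forall n, 0 <= z n) ->
  z @ \oo --> 0 -> (fun n => z n `^ alpha) @ \oo --> 0.
Proof.
move=> al0 z0 zc; apply/cvgrPdist_lt => e e0.
have e'0 : 0 < e `^ alpha^-1 by exact: powR_gt0.
move/cvgrPdist_lt : zc => /(_ _ e'0); apply: filterS => n.
rewrite !sub0r !normrN (ger0_norm (z0 n)) ger0_norm ?powR_ge0// => ze.
rewrite (_ : e = (e `^ alpha^-1) `^ alpha); last first.
  by rewrite -powRrM mulVf ?gt_eqF// powRr1// ltW.
by apply: gt0_ltr_powR => //; rewrite nnegrE// ltW.
Qed.

Lemma rate_cvg0 (alpha : R) (p : nat) (gamma : nat -> R) : 0 < alpha ->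
  (forall n, 0 < gamma n) ->
  n%:R `^ (p%:R / alpha) / gamma n @[n --> \oo] --> (0 : R) ->
  (fun n => n%:R ^+ p / gamma n `^ alpha) @ \oo --> 0.
Proof.
move=> al0 g0 /(powR_cvg_to0 al0); rewrite (_ : (fun n => _ `^ _) =
  (fun n => n%:R ^+ p / gamma n `^ alpha)); first apply.
  by move=> n; rewrite divr_ge0 ?powR_ge0// ltW.
apply/funext => n; rewrite powRM ?powR_ge0 ?invr_ge0 ?(ltW (g0 n))//.
by rewrite -powRrM divfK ?gt_eqF// powR_mulrn// -powR_inv1 ?(ltW (g0 n))//
   -!powRrM mulN1r powRN.
Qed.

(** Rescaling by homogeneity: [g] stands for gamma_n, [q] for n^p, [s] and [sN] for the sizes of the
    projected box and of its enlargement, and [A], [B], [D] for the powers of [y - eps] and of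
    [theta]. *)
Lemma scaled_upper (alpha g q A B D s sN S kap c K eps pr : R) : 0 < g -> 0 < q -> 0 < eps ->
  pr <= sN * ((g `^ (- alpha) * A) * S) + s * ((g `^ (- alpha) * A) * kap) +
    ((s * (2 * c * (g `^ (- alpha) * B))) ^+ 2 +
     s * (K * c * (g `^ (2 - alpha) * D) / (g * eps) ^+ 2)) ->
  g `^ alpha / q * pr <= sN / q * (A * S) + s / q * (A * kap) +
    ((s / q) ^+ 2 * (2 * c * B) ^+ 2 * (q / g `^ alpha) +
     s / q * (K * c * D / eps ^+ 2)).
Proof.
move=> g0 q0 eps0; have ga := powR_gt0 alpha g0.
have -> : g `^ (2 - alpha) = g ^+ 2 / g `^ alpha.
  by rewrite powRB ?(gt_eqF g0) ?implybT// powR_mulrn// ltW.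
rewrite powRN => h.
have w0 : 0 <= g `^ alpha / q by rewrite divr_ge0 ?ltW.
rewrite (le_trans (ler_wpM2l w0 h))// le_eqVlt; apply/orP; left; apply/eqP.
by field; rewrite !gt_eqF.
Qed.

Lemma scaled_lower (alpha g q A B D s S c K eps pr : R) : 0 < g -> 0 < q -> 0 < eps ->
  s * ((g `^ (- alpha) * A) * S) - (s * (c * (g `^ (- alpha) * A))) ^+ 2 -
    ((s * (2 * c * (g `^ (- alpha) * B))) ^+ 2 +
     s * (K * c * (g `^ (2 - alpha) * D) / (g * eps) ^+ 2)) <= pr ->
  s / q * (A * S) - (s / q) ^+ 2 * (c * A) ^+ 2 * (q / g `^ alpha) -
    ((s / q) ^+ 2 * (2 * c * B) ^+ 2 * (q / g `^ alpha) +
     s / q * (K * c * D / eps ^+ 2)) <= g `^ alpha / q * pr.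
Proof.
move=> g0 q0 eps0; have ga := powR_gt0 alpha g0.
have -> : g `^ (2 - alpha) = g ^+ 2 / g `^ alpha.
  by rewrite powRB ?(gt_eqF g0) ?implybT// powR_mulrn// ltW.
rewrite powRN => h.
have w0 : 0 <= g `^ alpha / q by rewrite divr_ge0 ?ltW.
rewrite (le_trans _ (ler_wpM2l w0 h))// le_eqVlt; apply/orP; left; apply/eqP.
by field; rewrite !gt_eqF.
Qed.

End NormalizingSequence.

(** * Exceedance probabilities over projected boxes *)

Section MaximaAsymptotics.
Context (R : realType) (d p q l : nat) (K F H : set 'cV[int]_d)
  (x : 'I_l -> 'cV[int]_d) (U : 'M[int]_(d, p)) (V : 'M[int]_(d, q)).
Hypotheses (hU : Zbasis U F) (hV : Zbasis V K)
  (FK0 : forall t, F t -> K t -> t = 0)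
  (hx : coset_representatives x F K) (hH : H = coset_union x F)
  (dpq : d = (p + q)%N) (p0 : (0 < p)%N).
Context (alpha : R) (dW : measure_display) (W : measurableType dW)
  (na : {sigma_finite_measure set (\bar R) -> \bar R})
  (nu : {sigma_finite_measure set W -> \bar R})
  (g : W * 'cV[int]_d -> R).
Hypotheses (alpha02 : 0 < alpha < 2) (hna : is_nu_alpha alpha na)
  (gL : in_Lalpha (nu \x counting_on R H)%E alpha setT g).
Context (dO : measure_display) (Om : measurableType dO) (P : probability Om R)
  (pt : nat -> Om -> \bar R * W * 'cV[int]_d) (Y : 'cV[int]_d -> Om -> R).
(** The index is projected to [H] first, so that the series representation, given on [H] only, holds
    at every index of Z^d. *)
Notation sh s := (fun u => oplus K H u (coset_proj K H s)).
Notation a := (fun s => jump_size g (sh s)).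
Hypotheses (prm : Poisson_random_measure P (jump_measure na nu H) pt)
  (mY : forall s, measurable_fun setT (Y s))
  (aY : forall s, sum_in_probability P (fun i w => a s (pt i w)) (Y s)).

Let alpha0 : 0 < alpha. Proof. by case/andP: alpha02. Qed.
Let mg : measurable_fun setT g. Proof. by case: gL. Qed.
Let sh_bij s : set_bij H H (sh s). Proof. exact: (oplus_bij hU hV FK0 hx hH). Qed.
Let ma s : measurable_fun setT (a s). Proof. exact: measurable_jump_size. Qed.

Let kernel_norm : exists2 c : R, 0 <= c &
  (\int[nu \x counting_on R H]_z (`|g z| `^ alpha)%:E = c%:E)%E.
Proof. by case: gL => ? /integral_norm_powR; exact. Qed.

Section Bounds.
Variables (c : R) (cE : (\int[nu \x counting_on R H]_z (`|g z| `^ alpha)%:E = c%:E)%E)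
  (c0 : 0 <= c).

Let tailp s y : 0 < y -> jump_measure na nu H [set z | y < a s z] = (c * y `^ (- alpha))%:E.
Proof. by move=> y0; rewrite (jump_tail nu alpha0 hna)// cE -EFinM mulrC. Qed.

Let tailn s y : 0 < y -> jump_measure na nu H [set z | y < - a s z] = (c * y `^ (- alpha))%:E.
Proof.
move=> y0.
have -> : [set z | y < - a s z] = [set z | y < jump_size (fun z => - g z) (sh s) z].
  by apply/seteqP; split => z; rewrite /= /jump_size mulrN.
rewrite (jump_tail nu alpha0 hna)//; last exact: measurableT_comp.
under eq_integral do rewrite normrN.
by rewrite cE -EFinM mulrC.
Qed.

(** The bound is [exceed_ge] for a single index at level 1, where the right-hand side is the tail of
    one jump size. *)
Lemma sup_integral_fin : (0 <= sup_integral nu H alpha g <= c%:E)%E.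
Proof.
have H0 : H !=set0 := coset_nonempty hx hH.
apply/andP; split.
  by apply: integral_ge0 => v _; apply: adde_ge0; exact: poweR_ge0.
have := @exceed_ge R d dW W na nu H g mg _ [:: 0] (fun s => sh s) sh_bij 1 isT.
rewrite (mark_sup_exceed nu alpha0 hna H0 mg ltr01) powR1 !mul1e => h.
have := tailp 0 (@ltr01 R); rewrite powR1 mulr1 => <-.
rewrite (_ : [set z | _] = exceed [:: 0] (fun s => jump_size g (sh s)) 1); last first.
  by apply/seteqP; split => [z z1|z [s]]; [exists 0; rewrite ?inE|rewrite inE => /eqP->].
by apply: h => s s'; rewrite !inE => /eqP-> /eqP->.
Qed.

Let S := fine (sup_integral nu H alpha g).

Let SE : sup_integral nu H alpha g = S%:E.
Proof.
have /andP[s0 s1] := sup_integral_fin.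
by rewrite /S fineK// ge0_fin_numE// (le_lt_trans s1)// ltry.
Qed.

Let mark_exceed r : 0 < r -> mark_measure na nu (sup_exceed H g r) = (r `^ (- alpha) * S)%:E.
Proof. by move=> r0; rewrite (mark_sup_exceed nu alpha0 hna (coset_nonempty hx hH) mg r0) SE. Qed.

Let box_proj_id n s : s \in (box_proj K H n : seq _) -> coset_proj K H s = s.
Proof.
move=> /mem_box_proj[t _ <-]; apply: (coset_proj_id hU hV FK0 hx hH).
exact: (coset_projP hx hH _).1.
Qed.

Let jump_exceed_ge n r : 0 < r ->
  (((size (box_proj K H n))%:R * (r `^ (- alpha) * S))%:E <=
   jump_measure na nu H (exceed (box_proj K H n) a r))%E.
Proof.
move=> r0; rewrite EFinM -mark_exceed//; apply: exceed_ge => //.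
move=> s s' sT s'T u Hu; rewrite (box_proj_id sT) (box_proj_id s'T).
apply: (oplus_injr hU hV FK0 hx hH).
  by rewrite -(box_proj_id sT); exact: (coset_projP hx hH _).1.
by rewrite -(box_proj_id s'T); exact: (coset_projP hx hH _).1.
Qed.

(** The kernel is cut at the ball of radius [k]; by [oplus_shift] the points that the box moves into
    this ball lie in the projection of the box of radius [n + k]. *)
Let jump_exceed_le n k kappa r : 0 < r ->
  (\int[nu \x counting_on R H]_z
    (`|if z.2 \in [set u | (supnorm u <= k)%N] then 0 else g z| `^ alpha)%:E = kappa%:E)%E ->
  (jump_measure na nu H (exceed (box_proj K H n) a r) <=
   ((size (box_proj K H (n + k)))%:R * (r `^ (- alpha) * S) +
    (size (box_proj K H n))%:R * (r `^ (- alpha) * kappa))%:E)%E.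
Proof.
move=> r0 kE; rewrite EFinD EFinM -mark_exceed//.
apply: (exceed_le alpha0 hna mg sh_bij _ kE r0) => s u sT Hu /= ub.
have /mem_box_proj[t tn ts] := sT; apply/mem_box_proj.
exists (oplus K H u s - t).
  by rewrite addnC; apply: supnormD_le => //; rewrite -[X in oplus _ _ _ X](box_proj_id sT).
by apply/esym; apply: (oplus_shift hU hV FK0 hx hH Hu); rewrite ts.
Qed.

Let jump_exceed_fin n r : 0 < r ->
  exists2 y : R, jump_measure na nu H (exceed (box_proj K H n) a r) = y%:E &
    (size (box_proj K H n))%:R * (r `^ (- alpha) * S) <= y <=
    (size (box_proj K H n))%:R * (c * r `^ (- alpha)).
Proof.
move=> r0; have lo := jump_exceed_ge n r0.
have hi : (jump_measure na nu H (exceed (box_proj K H n) a r) <=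
    ((size (box_proj K H n))%:R * (c * r `^ (- alpha)))%:E)%E.
  apply: measure_some_in_le => [s|s _]; last by rewrite -(tailp s r0).
  exact: measurable_gt.
have fin : jump_measure na nu H (exceed (box_proj K H n) a r) \is a fin_num.
  by rewrite ge0_fin_numE ?measure_ge0// (le_lt_trans hi)// ltry.
exists (fine (jump_measure na nu H (exceed (box_proj K H n) a r))); first by rewrite fineK.
by rewrite -!lee_fin fineK// lo.
Qed.

Let mexceed n r : measurable (exceed (box_proj K H n) Y r).
Proof. exact: measurable_exceed. Qed.

Let prob_fineK n r : (fine (P (exceed (box_proj K H n) Y r)))%:E =
  P (exceed (box_proj K H n) Y r).
Proof. by rewrite fineK// fin_num_measure. Qed.

Notation bpsize n := ((size (box_proj K H n))%:R : R).

Lemma prob_exceed_upper n k kappa y gam eps theta : 0 < gam -> 0 < eps < y -> 0 < theta ->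
  (\int[nu \x counting_on R H]_z
    (`|if z.2 \in [set u | (supnorm u <= k)%N] then 0 else g z| `^ alpha)%:E = kappa%:E)%E ->
  fine (P (exceed (box_proj K H n) Y (gam * y))) <=
    bpsize (n + k) * ((gam `^ (- alpha) * (y - eps) `^ (- alpha)) * S) +
    bpsize n * ((gam `^ (- alpha) * (y - eps) `^ (- alpha)) * kappa) +
    ((bpsize n * (2 * c * (gam `^ (- alpha) * theta `^ (- alpha)))) ^+ 2 +
     bpsize n * (residual_const alpha * c * (gam `^ (2 - alpha) * theta `^ (2 - alpha)) /
       (gam * eps) ^+ 2)).
Proof.
move=> gam0 /andP[eps0 epsy] theta0 kE.
have ye0 : 0 <= y - eps by rewrite subr_ge0 ltW.
rewrite -lee_fin prob_fineK -!powRM ?(ltW gam0) ?(ltW theta0)//.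
apply: (le_trans (exceed_upper prm alpha02 c0 ma tailp tailn mY aY _
  (mulr_gt0 gam0 theta0) (mulr_gt0 gam0 eps0) _)).
  by rewrite ler_pM2l// ltW.
rewrite -mulrBr [leRHS]EFinD; apply: leeD => //.
by apply: jump_exceed_le => //; rewrite mulr_gt0// subr_gt0.
Qed.

Lemma prob_exceed_lower n y gam eps theta : 0 < gam -> 0 < eps < y -> 0 < theta < y ->
  bpsize n * ((gam `^ (- alpha) * (y + eps) `^ (- alpha)) * S) -
    (bpsize n * (c * (gam `^ (- alpha) * (y + eps) `^ (- alpha)))) ^+ 2 -
    ((bpsize n * (2 * c * (gam `^ (- alpha) * theta `^ (- alpha)))) ^+ 2 +
     bpsize n * (residual_const alpha * c * (gam `^ (2 - alpha) * theta `^ (2 - alpha)) /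
       (gam * eps) ^+ 2)) <=
  fine (P (exceed (box_proj K H n) Y (gam * y))).
Proof.
move=> gam0 /andP[eps0 epsy] /andP[theta0 thetay].
have y0 : 0 < y by rewrite (lt_trans eps0).
have ye0 : 0 <= y + eps by rewrite addr_ge0 ?ltW.
rewrite -!powRM ?(ltW gam0) ?(ltW theta0)//.
have r0 : 0 < gam * (y + eps) by rewrite mulr_gt0// addr_gt0.
have [z zE /andP[z1 z2]] := jump_exceed_fin n r0.
have := @exceed_lower _ _ _ _ _ _ _ _ prm alpha c _ _ _ alpha02 c0 ma tailp tailn mY aY
  (box_proj K H n) _ _ (mulr_gt0 gam0 theta0) (mulr_gt0 gam0 eps0) (gam * y) z.
have tye : theta <= y + eps by rewrite (le_trans (ltW thetay))// lerDl ltW.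
rewrite -mulrDr ler_pM2l// => /(_ tye zE).
rewrite -prob_fineK -EFinD lee_fin => h.
rewrite lerBlDr (le_trans _ h)//.
(* The lower bound on [z] serves in the linear term, and the upper bound in the square. *)
apply: lerB => //; rewrite lerXn2r// nnegrE ?(le_trans _ z2)// (le_trans _ z1)//.
- by rewrite mulr_ge0// mulr_ge0 ?powR_ge0// -lee_fin -SE; case/andP: sup_integral_fin.
- by rewrite mulr_ge0// mulr_ge0 ?powR_ge0// -lee_fin -SE; case/andP: sup_integral_fin.
Qed.

End Bounds.

Lemma prob_exceed_cvg (gamma : nat -> R) (k : nat -> nat) (lambda y : R) :
  (forall n, 0 < gamma n) ->
  n%:R `^ (p%:R / alpha) / gamma n @[n --> \oo] --> (0 : R) ->
  0 < lambda -> (k n)%:R / n%:R @[n --> \oo] --> lambda -> 0 < y ->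
  gamma n `^ alpha / n%:R ^+ p * fine (P (exceed (box_proj K H (k n)) Y (gamma n * y)))
    @[n --> \oo] -->
  lambda ^+ p * (l%:R * fine (Leb (slab (R := R) U V 1))) *
    fine (sup_integral nu H alpha g) * y `^ (- alpha).
Proof.
move=> gamma0 hlim la0 kl y0; have [c c0 cE] := kernel_norm.
have [kappa kappa0 kappaE] := kernel_tail_cvg0 alpha0 gL.
have tl C := box_proj_cvg hU hV FK0 hx hH dpq p0 C la0 kl.
have t0 : (size (box_proj K H (k n)))%:R / n%:R ^+ p @[n --> \oo] -->
    lambda ^+ p * (l%:R * fine (Leb (slab (R := R) U V 1))).
  by have := tl 0%N; under eq_fun do rewrite addn0.
apply: (asymptotic_squeeze (c := c) (K := residual_const alpha)
  (N := fun i n => (size (box_proj K H (k n + i)))%:R / n%:R ^+ p)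
  alpha02 y0 _ c0 (residual_const_ge0 alpha02) t0 tl (rate_cvg0 alpha0 gamma0 hlim) kappa0).
- by apply: fine_ge0; have /andP[] := sup_integral_fin cE.
- move=> eps theta i /[dup] /andP[eps0 _] heps theta0.
  near=> n.
  have n0 : 0 < n%:R ^+ p :> R by rewrite exprn_gt0// ltr0n; near: n; exact: nbhs_infty_gt.
  apply: scaled_upper => //; exact: prob_exceed_upper.
- move=> eps theta /[dup] /andP[eps0 _] heps theta0.
  near=> n.
  have n0 : 0 < n%:R ^+ p :> R by rewrite exprn_gt0// ltr0n; near: n; exact: nbhs_infty_gt.
  apply: scaled_lower => //; exact: prob_exceed_lower.
Unshelve. all: by end_near.
Qed.

End MaximaAsymptotics.

Section TransformationGroup.
Context (d p l : nat) (S : Type) (phi : 'cV[int]_d -> S -> S)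
  (Fbar Nbar : set (S -> S)) (Psi : (S -> S) -> 'cV[int]_d).

(** An element of the image of [Psi] that acts trivially is [Psi id], which is 0 by additivity. *)
Lemma section_kernel0 : transf_decomposition phi p l Fbar Nbar ->
  transf_section phi Fbar Psi ->
  forall t, (Psi @` Fbar) t -> action_kernel phi t -> t = 0.
Proof.
move=> [[_ Fid _ _] _ _ _ _] [PsiD _ PsiK] _ [a Fa <-]; rewrite /action_kernel/= PsiK// => ->.
by have := PsiD _ _ Fid Fid => /eqP; rewrite -subr_eq0 opprD addrA subrr sub0r oppr_eq0 => /eqP.
Qed.

End TransformationGroup.

Lemma ae_eq_measure (R : realType) (d : measure_display) (T : measurableType d)
    (mu : {measure set T -> \bar R}) (A B : set T) :
  measurable A -> measurable B -> {ae mu, forall x, A x <-> B x} -> mu A = mu B.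
Proof.
move=> mA mB AB; rewrite -[A]setIT -[B]setIT -!integral_indic//.
apply: ae_eq_integral => //; try exact/measurable_EFinP.
apply: filterS AB => x AB _; rewrite !indicE.
by congr ((_ : bool)%:R)%:E; apply/idP/idP => /set_mem/AB/mem_set.
Qed.

Lemma ae_countable_forall (R : realType) (d : measure_display) (T : measurableType d)
    (mu : {measure set T -> \bar R}) (I : countType) (Q : I -> T -> Prop) :
  (forall i, {ae mu, forall x, Q i x}) -> {ae mu, forall x, forall i, Q i x}.
Proof.
move=> aeQ; have : {ae mu, forall (x : T) (n : nat),
    if choice.unpickle n is Some i then Q i x else True}.
  by apply: ae_foralln => n; case: choice.unpickle => [i|]; [exact: aeQ|exact: aeW].
by apply: filterS => x h i; have := h (choice.pickle i); rewrite choice.pickleK.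
Qed.

Lemma sup_finite_gtP (R : realType) (A : set R) (b : R) : finite_set A -> A !=set0 ->
  b < sup A <-> exists2 x, A x & b < x.
Proof.
move=> fA A0; split=> [/(sup_gt A0)//|[x Ax bx]].
apply: (lt_le_trans bx); apply: ub_le_sup Ax; have [s ->] := (finite_seqP A).1 fA.
exists (\sum_(y <- s) `|y|) => y /= ys; rewrite (big_rem y)//=.
by rewrite (le_trans (ler_norm y))// lerDl sumr_ge0.
Qed.

(** Radii are integers, so being at most [r] means being strictly below [truncn r + 1]; the strict
    inequality yields a witness from the infimum. *)
Lemma hitting_radius_leP (R : realType) (d : nat) (Om : Type) (X : 'cV[int]_d -> Om -> R)
    (b r : R) (w : Om) : 0 <= r ->
  (hitting_radius X b w <= r%:E)%E <->
  exists2 t, (supnorm t <= Num.truncn r)%N & b < X t w.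
Proof.
move=> r0; split=> [|[t tr bt]].
  move=> /le_lt_trans/(_ (_ : _ < (Num.truncn r).+1%:R%:E)%E).
  rewrite lte_fin truncnS_gt => /(_ isT) /ereal_inf_lt[_ [t bt <-]].
  by rewrite lte_fin ltr_nat ltnS; exists t.
apply: (@le_trans _ _ (supnorm t)%:R%:E); first by apply: ereal_inf_lbound; exists t.
by rewrite lee_fin -truncn_ge_nat.
Qed.

Lemma truncn_ratio_cvg (R : realType) (lambda : R) : 0 < lambda ->
  (Num.truncn (lambda * n%:R))%:R / n%:R @[n --> \oo] --> lambda.
Proof.
move=> la0.
have inv0 : (n%:R : R)^-1 @[n --> \oo] --> (0 : R).
  apply/gtr0_cvgV0; last exact: cvgr_idn.
  by near=> n; rewrite ltr0n; near: n; exact: nbhs_infty_gt.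
have lo : lambda - (n%:R : R)^-1 @[n --> \oo] --> lambda.
  by rewrite -[X in _ --> X]subr0; apply: cvgB => //; exact: cvg_cst.
apply: (squeeze_cvgr _ lo (cvg_cst lambda)); near=> n.
have n0 : 0 < n%:R :> R by rewrite ltr0n; near: n; exact: nbhs_infty_gt.
have ln0 : 0 <= lambda * n%:R by rewrite mulr_ge0 ?ltW.
rewrite ler_pdivlMr// mulrBl mulVf ?gt_eqF// ler_pdivrMr// truncn_le ln0 andbT.
by rewrite lerBlDr ltW// natr1 truncnS_gt.
Unshelve. all: by end_near.
Qed.

(** * The normalized field on boxes *)

Section NormalizedField.
Context (R : realType) (d p l : nat) (K F H : set 'cV[int]_d)
  (x : 'I_l -> 'cV[int]_d) (U : 'M[int]_(d, p)) (V : 'M[int]_(d, d - p)).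
Hypotheses (hU : Zbasis U F) (hV : Zbasis V K)
  (FK0 : forall t, F t -> K t -> t = 0)
  (hx : coset_representatives x F K) (hH : H = coset_union x F)
  (hp : (1 <= p < d)%N).
Context (alpha : R) (dW : measure_display) (W : measurableType dW)
  (na : {sigma_finite_measure set (\bar R) -> \bar R})
  (nu : {sigma_finite_measure set W -> \bar R})
  (h : W * 'cV[int]_d -> R).
Hypotheses (alpha02 : 0 < alpha < 2)
  (hh : in_Lalpha (nu \x counting_on R H)%E alpha (setT `*` H) h).
Context (dO : measure_display) (Om : measurableType dO) (P : probability Om R)
  (X : 'cV[int]_d -> {RV P >-> R})
  (j : nat -> Om -> \bar R) (v : nat -> Om -> W) (u : nat -> Om -> 'cV[int]_d).
Hypotheses (hser : Poisson_series nu K H alpha h na P j v u X)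
  (XK : forall t, {ae P, forall w, X t w = X (coset_proj K H t) w}).

Let g (z : W * 'cV[int]_d) : R := if z.2 \in H then h z else 0.

Let gH w s : H s -> g (w, s) = h (w, s).
Proof. by move=> Hs; rewrite /g mem_set. Qed.

Let sup_integral_g : sup_integral nu H alpha g = sup_integral nu H alpha h.
Proof.
apply: eq_integral => w _; congr (ereal_sup _ `^ _ + ereal_sup _ `^ _)%E;
  by apply: eq_imagel => s Hs; rewrite gH.
Qed.

Let mX t : measurable_fun setT (X t). Proof. exact: measurable_funPT. Qed.

(** The exceptional null sets of the identities between the field and its projection are countably
    many, so one null set serves the whole box. *)
Lemma prob_box_exceed n b :
  P [set w | exists2 t, (supnorm t <= n)%N & b < X t w] =
  P (exceed (box_proj K H n) (fun s => X (coset_proj K H s)) b).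
Proof.
have [_ _ prm _] := hser.
rewrite [X in P X = _](_ : _ =
    exceed (fset_set [set t : 'cV[int]_d | (supnorm t <= n)%N]) X b); last first.
  apply/seteqP; split => w [t tn bt]; exists t => //.
    by rewrite in_fset_set; [exact/mem_set|exact: finite_box].
  by move: tn; rewrite in_fset_set; [move/set_mem|exact: finite_box].
apply: ae_eq_measure; [exact: measurable_exceed|exact: measurable_exceed|].
apply: filterS (ae_countable_forall XK) => w XKw; split=> -[t].
  rewrite in_fset_set; last exact: finite_box.
  move=> /set_mem tn /=; rewrite XKw => bt; exists (coset_proj K H t).
    by apply/mem_box_proj; exists t.
  by rewrite /= (coset_proj_id hU hV FK0 hx hH)//; exact: (coset_projP hx hH _).1.
move=> /mem_box_proj[t' tn' <-].
rewrite /= (coset_proj_id hU hV FK0 hx hH); last exact: (coset_projP hx hH _).1.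
rewrite /= -XKw => bt; exists t' => //.
by rewrite in_fset_set; [exact/mem_set|exact: finite_box].
Qed.

(** The radius [k n] is left general so that one statement gives both limits: [k n = n] for the
    maximum, and the integer part of [lambda * n] for the hitting radius. *)
Lemma box_exceed_cvg (gamma : nat -> R) (k : nat -> nat) (lambda y : R) :
  (forall n, 0 < gamma n) ->
  n%:R `^ (p%:R / alpha) / gamma n @[n --> \oo] --> (0 : R) ->
  0 < lambda -> (k n)%:R / n%:R @[n --> \oo] --> lambda -> 0 < y ->
  ((gamma n `^ alpha / n%:R ^+ p)%:E *
     P [set w | exists2 t, (supnorm t <= k n)%N & (gamma n * y < X t w)%R])%E
    @[n --> \oo] -->
  ((lambda ^+ p)%:E * (l%:R%:E * Leb (Delta R U V)) * (y `^ (- alpha))%:E *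
     sup_integral nu H alpha h)%E.
Proof.
move=> gamma0 hlim la0 kl y0; have [p0 pd] := andP hp.
have alpha0 : 0 < alpha by case/andP: alpha02.
have dpq : d = (p + (d - p))%N by rewrite subnKC// ltnW.
have [hna _ prm aX] := hser.
have gL := in_Lalpha_patch alpha0 hh.
pose Y s : Om -> R := X (coset_proj K H s).
have mY s : measurable_fun setT (Y s) by exact: mX.
have aY s : sum_in_probability P (fun i w =>
    jump_size g (fun u => oplus K H u (coset_proj K H s)) ((j i w, v i w), u i w)) (Y s).
  have := aX _ (coset_projP hx hH s).1.
  rewrite (_ : (fun i w => fine (j i w) * _) = (fun i w =>
    jump_size g (fun u => oplus K H u (coset_proj K H s)) ((j i w, v i w), u i w)))//.
  apply/funext => i; apply/funext => w; rewrite /jump_size/= gH//.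
  exact: (coset_projP hx hH _).1.
have [Lt [LU LV LR]] := slab_inverse_exists R hU hV hx dpq.
have S_fin : sup_integral nu H alpha h \is a fin_num.
  have [_ /(integral_norm_powR)] := gL.
  have [mg _] := gL; move=> /(_ mg)[c c0 cE].
  have /andP[s0 s1] := sup_integral_fin hU hV FK0 hx hH alpha02 hna gL cE.
  by rewrite -sup_integral_g ge0_fin_numE// (le_lt_trans s1)// ltry.
have main := prob_exceed_cvg hU hV FK0 hx hH dpq p0 alpha02 hna gL prm mY aY
  gamma0 hlim la0 kl y0.
have -> : ((lambda ^+ p)%:E * (l%:R%:E * Leb (Delta R U V)) * (y `^ (- alpha))%:E *
     sup_integral nu H alpha h)%E =
   (lambda ^+ p * (l%:R * fine (Leb (slab (R := R) U V 1))) *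
    fine (sup_integral nu H alpha g) * y `^ (- alpha))%:E.
  rewrite sup_integral_g -[X in (_ * (_ * X))%E]/(Leb (slab (R := R) U V 1)).
  by rewrite (Leb_slabE LU LV LR p0) -(fineK S_fin) -!EFinM mulrAC.
under eq_fun do rewrite prob_box_exceed.
have fin n : P (exceed (box_proj K H (k n)) Y (gamma n * y)) \is a fin_num.
  by rewrite fin_num_measure//; exact: measurable_exceed.
apply: cvg_EFin; first by apply: nearW => n; rewrite fin_numM// fin.
apply: cvg_trans main; apply: near_eq_cvg; apply: nearW => n /=.
by rewrite fineM// fin.
Qed.

End NormalizedField.

Section StableJumpMeasure.
Context (R : realType) (alpha : R) (na : {measure set (\bar R) -> \bar R})
  (hna : is_nu_alpha alpha na).

(* na is not assumed sigma-finite; its tails make it so. *)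
Definition stable_jumps of is_nu_alpha alpha na : set (\bar R) -> \bar R := na.

HB.instance Definition _ := Measure.copy (stable_jumps hna) na.
HB.instance Definition _ := @Measure_isSigmaFinite.Build _ _ _ (stable_jumps hna)
  (nu_alpha_sigma_finite hna).

End StableJumpMeasure.

Theorem corollary4p4 (R : realType) (alpha : R) (d p l : nat)
  (halpha : 0 < alpha < 2) (hp : (1 <= p < d)%N)
  (dS : measure_display) (S : measurableType dS)
  (mu : {sigma_finite_measure set S -> \bar R})
  (hS : standard_Borel R S)
  (phi : 'cV[int]_d -> S -> S) (c : 'cV[int]_d -> S -> R)
  (hphi : nonsingular_action mu phi) (hcons : conservative mu phi setT)
  (hc : cocycle phi c)
  (Fbar Nbar : set (S -> S)) (Psi : (S -> S) -> 'cV[int]_d)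
  (hdec : transf_decomposition phi p l Fbar Nbar)
  (hPsi : transf_section phi Fbar Psi)
  (K : set 'cV[int]_d) (hK : K = action_kernel phi)
  (F : set 'cV[int]_d) (hF : F = Psi @` Fbar)
  (x : 'I_l -> 'cV[int]_d) (hx : coset_representatives x F K)
  (H : set 'cV[int]_d) (hH : H = coset_union x F)
  (U : 'M[int]_(d, p)) (hU : Zbasis U F)
  (V : 'M[int]_(d, d - p)) (hV : Zbasis V K)
  (hdiss : dissipative phi F)
  (hcK : forall v, K v -> forall s, c v s = 1)
  (* X0 is the field before normalization, X = kappa X0 the normalized one *)
  (dO : measure_display) (Om : measurableType dO) (P : probability Om R)
  (X0 : 'cV[int]_d -> {RV P >-> R})
  (hstat : stationary P X0) (hSaS : SaS_field P alpha X0)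
  (hgen : generated_by mu phi c alpha P X0)
  (dW : measure_display) (W : measurableType dW)
  (nu : {sigma_finite_measure set W -> \bar R})
  (hW : standard_Borel R W)
  (h : W * 'cV[int]_d -> R)
  (hh : in_Lalpha (nu \x counting_on R H)%E alpha (setT `*` H) h)
  (hmma : mixed_moving_average nu K H alpha h P X0)
  (kappa : R) (hkappa : 0 < kappa)
  (X : 'cV[int]_d -> {RV P >-> R}) (hX : forall t w, X t w = kappa * X0 t w)
  (na : {measure set (\bar R) -> \bar R})
  (j : nat -> Om -> \bar R) (v : nat -> Om -> W)
  (u : nat -> Om -> 'cV[int]_d)
  (hser : Poisson_series nu K H alpha h na P j v u X)
  (gamma : nat -> R) (hgamma : forall n, 0 < gamma n)
  (hlim : n%:R `^ (p%:R / alpha) / gamma n @[n --> \oo] --> (0 : R)) :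
  (forall y : R, 0 < y ->
     ((gamma n `^ alpha / n%:R ^+ p)%:E *
        P [set w | (gamma n * y <
             sup [set X t w | t in [set t | (supnorm t <= n)%N]])%R])%E
       @[n --> \oo] -->
     (l%:R%:E * Leb (Delta R U V) * (y `^ (- alpha))%:E *
        sup_integral nu H alpha h)%E) /\
  (forall a lambda : R, 0 < a -> 0 < lambda ->
     ((gamma n `^ alpha / n%:R ^+ p)%:E *
        P [set w | (hitting_radius X (a * gamma n)%R w
                      <= (lambda * n%:R)%:E)%E])%E
       @[n --> \oo] -->
     ((lambda ^+ p)%:E * (a `^ (- alpha))%:E * l%:R%:E *
        Leb (Delta R U V) * sup_integral nu H alpha h)%E).
Proof.
have [hna _ _ _] := hser.
pose na' : {sigma_finite_measure set (\bar R) -> \bar R} := stable_jumps hna.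
have hser' : Poisson_series nu K H alpha h na' P j v u X := hser.
have FK0 t : F t -> K t -> t = 0.
  by rewrite hK hF; exact: (section_kernel0 hdec hPsi).
have XK t : {ae P, forall w, X t w = X (coset_proj K H t) w}.
  by apply: filterS (hmma.2 t) => w X0w; rewrite !hX X0w.
have tail := box_exceed_cvg hU hV FK0 hx hH hp halpha hh hser' XK hgamma hlim.
split=> [y y0|a lambda a0 la0].
  have idn : (n%:R : R) / n%:R @[n --> \oo] --> (1 : R).
    apply: cvg_near_cst; near=> n; rewrite divff// pnatr_eq0 -lt0n.
    by near: n; exact: nbhs_infty_gt.
  have := tail id 1 y ltr01 idn y0; rewrite expr1n mul1e; apply: cvg_trans.
  apply: near_eq_cvg; apply: nearW => n; congr (_ * P _)%E.
  apply/seteqP; split=> w /=.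
    move=> [t tn bt]; apply/sup_finite_gtP; last by exists (X t w) => //; exists t.
      by apply: finite_image; exact: finite_box.
    by exists (X t w), t.
  move=> /sup_finite_gtP[||_ [t tn <-] bt]; last by exists t.
    by apply: finite_image; exact: finite_box.
  (* The origin lies in every box, so the supremum is over a nonempty set. *)
  by exists (X 0 w), 0 => //=; apply/supnorm_leP => i; rewrite mxE.
have := tail _ lambda a la0 (truncn_ratio_cvg la0) a0.
rewrite [X in _ --> X](_ : _ = ((lambda ^+ p)%:E * (a `^ (- alpha))%:E * l%:R%:E *
  Leb (Delta R U V) * sup_integral nu H alpha h)%E); last first.
  by rewrite -!muleA; congr (_ * _)%E; rewrite [RHS]muleCA; congr (_ * _)%E; exact: muleCA.
apply: cvg_trans; apply: near_eq_cvg; apply: nearW => n; congr (_ * P _)%E.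
have ln0 : 0 <= lambda * n%:R by rewrite mulr_ge0// ltW.
rewrite (mulrC a).
by apply/seteqP; split=> w /(hitting_radius_leP (fun t => X t) (gamma n * a) w ln0).
Unshelve. all: by end_near.
Qed.
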